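(* Suppose that $\Omega$ is a bounded finitely connected domain in the plane bounded by finitely many non-intersecting simple closed $C^\infty$ smooth curves. If $g$ is a Gustafsson mapping on $\Omega$, then $g$ is equal to a Bergman representative mapping on $\Omega$.
   Context: The double of $\Omega$ is the compact Riemann surface obtained by gluing $\Omega$ to a copy of itself with the conjugate complex structure along the common boundary $b\Omega$. (For merely $C^\infty$ smooth boundary, a function $h$ on $\Omega$ extends meromorphically to the double if $h\circ\varphi^{-1}$ extends meromorphically to the double of $\Omega_s$, where $\varphi$ is a biholomorphic map of $\Omega$ onto a bounded domain $\Omega_s$ with $C^\infty$ smooth real analytic boundary curves.) A function on $\Omega$ is a Gustafsson mapping if it is holomorphic and one-to-one on $\Omega$, extends meromorphically to the double of $\Omega$, and has no poles on the boundary of $\Omega$. Let $K(z,w)$ denote the Bergman kernel of $\Omega$ (the reproducing kernel of the space of square integrable holomorphic functions on $\Omega$), and let $K^{(m)}(z,w)=\frac{\partial^m}{\partial\bar w^m}K(z,w)$, with $K^{(0)}=K$. A Bergman representative mapping on $\Omega$ is a one-to-one function of the form $\mathcal{K}_1(z)/\mathcal{K}_2(z)$, where the numerator and the denominator are each of the form $$\sum_{j=1}^N\sum_{m=0}^{n_j}c_{jm}K^{(m)}(z,w_j)$$ with $w_j\in\Omega$ and $c_{jm}\in\mathbb{C}$ (the points, orders, and coefficients being allowed to differ for the numerator and denominator). *)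

(* Defs.v *)
From HB Require Import structures.
From mathcomp Require Import all_boot all_order all_algebra.
From mathcomp Require Import complex.
From mathcomp Require Import all_classical all_reals all_analysis.

Set Implicit Arguments.
Unset Strict Implicit.
Unset Printing Implicit Defensive.

Import Order.TTheory GRing.Theory Num.Theory.
Import numFieldNormedType.Exports.

Local Open Scope ring_scope.
Local Open Scope complex_scope.
Local Open Scope classical_set_scope.

(* The regular module [R[i]^o] is used because [R[i]] carries, as a canonical
   structure, its vector space structure over [R]; complex differentiability
   of [f] at [z] is [derivable f z 1] over the scalar field [R[i]]. *)
Notation cplane R := (R[i]^o).

Section ComplexAnalysis.
Variable R : realType.
Local Notation C := (cplane R).

Definition holomorphic_on (U : set C) (f : C -> C) : Prop :=
  forall z, U z -> derivable f z 1.

(* The Riemann sphere, [None] being the point at infinity. *)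
Definition sphere : Type := one_point_compactification C.

Definition to_sphere (z : C) : sphere := Some z.

Definition sphere_inv (z : C) : sphere :=
  if z == 0 then None else Some z^-1.

(* Near [z], either [f] is a finite holomorphic function, or [f] is the
   reciprocal of a holomorphic function with no zero in a punctured
   neighbourhood (so that [f] is not identically infinite). *)
Definition meromorphic_at (f : C -> sphere) (z : C) : Prop :=
  (exists g : C -> C,
     \forall w \near z, derivable g w 1 /\ f w = to_sphere (g w)) \/
  (exists g : C -> C,
     (\forall w \near z, derivable g w 1 /\ f w = sphere_inv (g w)) /\
     (\forall w \near z^', g w != 0)).

Definition meromorphic_on (U : set C) (f : C -> sphere) : Prop :=
  forall z, U z -> meromorphic_at f z.

Definition biholomorphic (U V : set C) (phi psi : C -> C) : Prop :=
  [/\ holomorphic_on U phi, holomorphic_on V psi,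
      (forall z, U z -> V (phi z) /\ psi (phi z) = z) &
      (forall w, V w -> U (psi w) /\ phi (psi w) = w)].

End ComplexAnalysis.

Section Domains.
Variable R : realType.
Local Notation C := (cplane R).

Definition boundary (A : set C) : set C := closure A `\` interior A.

Definition bounded_domain (Omega : set C) : Prop :=
  [/\ open Omega, connected Omega, Omega !=set0 & bounded_set Omega].

Definition smooth (f : R -> R) : Prop :=
  forall n t, derivable (f^`(n)) t 1.

Definition real_analytic (f : R -> R) : Prop :=
  forall t0 : R, exists a : R^nat, exists2 r : R, 0 < r &
    forall t, `|t - t0| < r ->
      series (fun n => a n * (t - t0) ^+ n) @ \oo --> f t.

(* A simple closed curve is a 1-periodic parametrization, injective on a
   period; smoothness includes regularity (nowhere vanishing velocity). *)
Definition smooth_simple_closed (gamma : R -> C) : Prop :=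
  let x t := complex.Re (gamma t) in
  let y t := complex.Im (gamma t) in
  [/\ smooth x, smooth y,
      (forall t, (x^`() t, y^`() t) != (0, 0)),
      (forall t, gamma (t + 1) = gamma t) &
      (forall s t : R, 0 <= s < 1 -> 0 <= t < 1 -> gamma s = gamma t -> s = t)].

Definition analytic_simple_closed (gamma : R -> C) : Prop :=
  [/\ smooth_simple_closed gamma,
      real_analytic (fun t => complex.Re (gamma t)) &
      real_analytic (fun t => complex.Im (gamma t))].

Definition bounded_by_curves (Q : (R -> C) -> Prop) (Omega : set C) : Prop :=
  exists (n : nat) (gamma : 'I_n -> R -> C),
    [/\ (forall i, Q (gamma i)),
        (forall i j, i != j ->
           range (gamma i) `&` range (gamma j) = set0) &
        boundary Omega = \bigcup_(i in [set: 'I_n]) range (gamma i)].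

End Domains.

Section Double.
Variable R : realType.
Local Notation C := (cplane R).

Record chart (T : Type) :=
  Chart { chart_dom : set T; chart_map : T -> C }.

(* Meromorphic functions on the Riemann surface with the given atlas; images
   of charts are meant to be open. *)
Definition meromorphic_atlas (T : Type) (atlas : set (chart T))
    (F : T -> sphere R) : Prop :=
  forall k, atlas k -> exists2 f : C -> sphere R,
    meromorphic_on (chart_map k @` chart_dom k) f &
    forall p, chart_dom k p -> F p = f (chart_map k p).

(* Points of the double: [(z, false)] is on the sheet [Omega], [(z, true)] on
   its copy; a boundary point is identified with its copy, and represented by
   [(z, false)] only. *)
Definition double_pt : Type := (C * bool)%type.

Definition double_points (Omega : set C) : set double_pt :=
  [set p | Omega p.1 \/ (boundary Omega p.1 /\ p.2 = false)].

Definition front_chart (Omega : set C) : chart double_pt :=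
  Chart [set p : double_pt | Omega p.1 /\ p.2 = false] (fun p => p.1).

Definition back_chart (Omega : set C) : chart double_pt :=
  Chart [set p : double_pt | Omega p.1 /\ p.2 = true] (fun p => (p.1)^*%C).

(* [psi] straightens the boundary of [Omega] inside [U] to the real axis,
   [Omega] being sent to the upper half-plane. *)
Definition straightens (Omega U : set C) (psi : C -> C) : Prop :=
  [/\ open U, holomorphic_on U psi,
      (forall z w, U z -> U w -> psi z = psi w -> z = w),
      (forall z, U z -> (Omega z <-> 0 < complex.Im (psi z))) &
      (forall z, U z -> (boundary Omega z <-> complex.Im (psi z) = 0))].

(* The two sheets are glued by reflection in the real axis. *)
Definition border_chart (Omega U : set C) (psi : C -> C) : chart double_pt :=
  Chart [set p | double_points Omega p /\ U p.1]
        (fun p => if p.2 then (psi p.1)^*%C else psi p.1).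

Definition double_atlas (Omega : set C) : set (chart double_pt) :=
  [set k | [\/ k = front_chart Omega, k = back_chart Omega |
            exists U psi, straightens Omega U psi /\
                          k = border_chart Omega U psi]].

(* [F] is the meromorphic function on the double of [Omega_s] extending
   [h \o psi], where [psi] is the inverse of the biholomorphic map [phi] of
   [Omega] onto the domain [Omega_s] with real analytic boundary. *)
Definition double_extension (Omega : set C) (h : C -> C)
    (Omega_s : set C) (phi psi : C -> C) (F : double_pt -> sphere R) : Prop :=
  [/\ bounded_domain Omega_s,
      bounded_by_curves (@analytic_simple_closed R) Omega_s,
      biholomorphic Omega Omega_s phi psi,
      meromorphic_atlas (double_atlas Omega_s) F &
      forall s, Omega_s s -> F (s, false) = to_sphere (h (psi s))].

Definition gustafsson_mapping (Omega : set C) (g : C -> C) : Prop :=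
  [/\ holomorphic_on Omega g,
      (forall z w, Omega z -> Omega w -> g z = g w -> z = w) &
      exists Omega_s phi psi F,
        double_extension Omega g Omega_s phi psi F /\
        (forall s, boundary Omega_s s -> F (s, false) <> None)].

End Double.

Section Bergman.
Variable R : realType.
Local Notation C := (cplane R).

Local Notation plane := (measurableTypeR R * measurableTypeR R)%type.

Definition area : {measure set plane -> \bar R} :=
  ((@lebesgue_measure R) \x (@lebesgue_measure R))%E.

Definition plane_set (A : set C) : set plane :=
  [set p | A (p.1 +i* p.2)].

Definition area_integral (A : set C) (f : C -> C) : C :=
  Rintegral area (plane_set A) (fun p : plane => complex.Re (f (p.1 +i* p.2))) +i*
  Rintegral area (plane_set A) (fun p : plane => complex.Im (f (p.1 +i* p.2))).

Definition bergman_space (Omega : set C) : set (C -> C) :=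
  [set f | holomorphic_on Omega f /\
     integrable area (plane_set Omega)
       (fun p : plane => ((ComplexField.Normc.normc (f (p.1 +i* p.2))) ^+ 2)%:E)].

Definition bergman_kernel (Omega : set C) (K : C -> C -> C) : Prop :=
  forall w, Omega w ->
    bergman_space Omega (fun z => K z w) /\
    (forall f, bergman_space Omega f ->
       f w = area_integral Omega (fun z => f z * (K z w)^*%C)).

(* Derivative of [f] at [w] in the real direction [v]. *)
Definition real_deriv (f : C -> C) (v w : C) : C :=
  (fun t : R => complex.Re (f (w + t%:C * v)))^`() 0 +i*
  (fun t : R => complex.Im (f (w + t%:C * v)))^`() 0.

(* d/dwbar = (d/du + i d/dv) / 2, with w = u + i v *)
Definition dbar (f : C -> C) (w : C) : C :=
  2^-1 * (real_deriv f 1 w + 'i%C * real_deriv f 'i%C w).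

Definition bergman_deriv (K : C -> C -> C) (m : nat) (z w : C) : C :=
  iter m dbar (K z) w.

Definition bergman_combination (Omega : set C) (K : C -> C -> C)
    (k : C -> C) : Prop :=
  exists (N : nat) (w : 'I_N -> C) (n : 'I_N -> nat) (c : 'I_N -> nat -> C),
    (forall j, Omega (w j)) /\
    (forall z, Omega z ->
       k z = \sum_(j < N) \sum_(m < (n j).+1)
               c j m * bergman_deriv K m z (w j)).

(* The quotient [k1 / k2] is the meromorphic one: it is determined by its
   values off the zeros of [k2], and could take the value infinity. *)
Definition bergman_representative_mapping (Omega : set C) (K : C -> C -> C)
    (f : C -> sphere R) : Prop :=
  [/\ meromorphic_on Omega f,
      (forall z w, Omega z -> Omega w -> f z = f w -> z = w) &
      exists k1 k2,
        [/\ bergman_combination Omega K k1,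
            bergman_combination Omega K k2,
            (exists2 z, Omega z & k2 z != 0) &
            (forall z, Omega z -> k2 z != 0 ->
               f z = to_sphere (k1 z / k2 z))]].

End Bergman.

(* Main.v *)
From HB Require Import structures.
Require Import Defs.
From mathcomp Require Import all_boot all_order all_algebra.
From mathcomp Require Import complex.
From mathcomp Require Import all_classical all_reals all_analysis.
From mathcomp Require Import measurable_realfun.
From mathcomp Require Import ring lra.

(** Both [g'] and [g g'] are finite Bergman combinations, and their quotient is
    [g].  Let [h] be [g] or [g^2 / 2].  The conjugated values of the extension
    on the second sheet define a meromorphic function [H] on [Omega] with
    finitely many poles, and the gluing along the boundary makes [h^* - H] tend
    to [0] there.  Stokes' formula then turns [\int_Omega f (h')^*] into a linear
    combination of derivatives of [f] at the poles of [H]; for [f = K(., z)] this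
    is the conjugate of the wanted expression of [h' z].

    Neither [h'] nor the boundary needs to be regular: for [P = h - H] and for
    [P = i (h + H)] the real part of [P] tends to [0] at the boundary, so that
    Stokes' formula can be applied to a truncation of [Re P] with compact
    support.  Taking [f = P'] gives, by Fatou's lemma, that [P'] is square
    integrable near the boundary; dominated convergence then removes the
    truncation for all [f] in the Bergman space.  The boundary charts of the
    double exist because a regular analytic arc of the boundary extends to a
    holomorphic function with a local inverse, and because [Omega] cannot lie on
    both sides of the arc: the winding number of the curve would jump. *)

Set Implicit Arguments.
Unset Strict Implicit.
Unset Printing Implicit Defensive.

Import Order.TTheory GRing.Theory Num.Theory.
Import numFieldNormedType.Exports.
Import ComplexField.Normc.

Local Open Scope ring_scope.
Local Open Scope complex_scope.
Local Open Scope classical_set_scope.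

(** The function [g^2 / 2] is chosen because its derivative is [g * g']; its partner on the second
    sheet is [H^2 / 2], with the same [H], so that a single study of the boundary serves both
    pairings. The obstacle is that the charts of the double belong to [Omega_s] while the integrals
    are over [Omega], and no boundary behaviour of the map [phi] between them is established. The
    boundary information is therefore put in a form that a biholomorphism transports: for every [e],
    the modulus of [h^* - H] is less than [e] off some compact subset of [Omega]. Smallness alone
    does not permit an integration by parts. Composing with a function that vanishes near [0] turns
    smallness into compact support, but such a truncation acts on a real-valued function. This is
    why two functions [P] occur: the real parts of [h - H] and [i (h + H)] are the real and
    imaginary parts of [h^* - H]. A further weight, equal to [0] near the poles of [H], keeps these
    poles away from the energy argument; its gradient carries the contribution of the poles. *)

Local Notation Re := complex.Re.
Local Notation Im := complex.Im.

(** * The complex plane with a real-valued modulus: neighbourhoods, limits, derivatives *)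

Section ComplexPlane.
Variable R : realType.
Local Notation C := (cplane R).
Implicit Types (z w : C) (f : C -> C).

Lemma normcEC z : `|z| = (normc z)%:C.
Proof. by rewrite normc_def; case: z. Qed.

Lemma normc_ge0 z : 0 <= normc z.
Proof. by rewrite -ler0c -normcEC. Qed.

Lemma normcB z w : normc (z - w) = normc (w - z).
Proof. by rewrite -normcN opprB. Qed.

Lemma normc_eq0 z : (normc z == 0) = (z == 0).
Proof. by apply/eqP/eqP => [/eq0_normc//|->]; rewrite normc0. Qed.

Lemma normc_gt0 z : (0 < normc z) = (z != 0).
Proof. by rewrite lt_def normc_eq0 normc_ge0 andbT. Qed.

Lemma normc_triangle z w t : normc (z - w) <= normc (z - t) + normc (t - w).
Proof. by rewrite -[z - w](subrKA t); exact: le_normcD. Qed.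

Lemma normc_real (x : R) : normc (x%:C : C) = `|x|.
Proof. by rewrite /normc /= expr0n addr0 sqrtr_sqr. Qed.

Lemma normcX z n : normc (z ^+ n) = normc z ^+ n.
Proof. by elim: n => [|n IH]; rewrite ?expr0 ?normc1 // !exprS normcM IH. Qed.

Lemma normc_conj z : normc (z^*) = normc z.
Proof. by case: z => x y; rewrite /normc /= sqrrN. Qed.

Lemma normc_i : normc ('i%C : C) = 1.
Proof. by rewrite /normc expr0n add0r expr1n sqrtr1. Qed.

Lemma Re_le_normc z : `|Re z| <= normc z.
Proof. by case: z => x y /=; rewrite -sqrtr_sqr ler_wsqrtr // lerDl sqr_ge0. Qed.

Lemma Im_le_normc z : `|Im z| <= normc z.
Proof. by case: z => x y /=; rewrite -sqrtr_sqr ler_wsqrtr // lerDr sqr_ge0. Qed.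

Lemma normc_le_ReIm z : normc z <= `|Re z| + `|Im z|.
Proof.
rewrite [in X in X <= _](complexE z); apply: le_trans (le_normcD _ _) _.
by rewrite normcM normc_i mul1r !normc_real.
Qed.

Lemma sqr_normcE z : normc z ^+ 2 = Re z ^+ 2 + Im z ^+ 2.
Proof. by case: z => x y; rewrite /normc sqr_sqrtr // addr_ge0 // sqr_ge0. Qed.

(** A ball of this normed space has a radius in [R[i]]; being positive, the radius is real. This
    brings neighbourhoods, and with them limits and derivatives, back to inequalities in [R], where
    [lra] and [nra] apply. *)
Lemma nbhs_normcP z (A : set C) :
  nbhs z A <-> exists2 r : R, 0 < r & forall w, normc (w - z) < r -> A w.
Proof.
split=> [/nbhs_ballP[e /= e0 H]|[r r0 H]].
  have e_r : e = (Re e)%:C by rewrite RRe_real// ger0_real// ltW.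
  exists (Re e); first by rewrite -ltcR -e_r.
  move=> w wr; apply: H; rewrite -ball_normE /ball_ /=.
  by rewrite distrC normcEC e_r ltcR.
apply/nbhs_ballP; exists (r%:C); first by rewrite /= ltcR.
move=> w; rewrite -ball_normE /ball_ /= distrC normcEC ltcR; exact: H.
Qed.

Lemma cvg_normcP (T : Type) (F : set_system T) {FF : Filter F} (f : T -> C) z :
  f @ F --> z <-> forall e : R, 0 < e -> \forall t \near F, normc (f t - z) < e.
Proof.
split=> [H e e0|H A /nbhs_normcP[e e0 eA]].
  by apply: (H [set w | normc (w - z) < e]); apply/nbhs_normcP; exists e.
by apply: filterS (H _ e0) => t /=; exact: eA.
Qed.

Lemma continuous_normcP f z : {for z, continuous f} <->
  forall e : R, 0 < e ->
    exists2 r : R, 0 < r & forall w, normc (w - z) < r -> normc (f w - f z) < e.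
Proof.
split=> [/cvg_normcP H e e0|H].
  by have /nbhs_normcP := H _ e0.
by apply/(@cvg_normcP _ (nbhs z)) => e e0; apply/nbhs_normcP; exact: H.
Qed.

Lemma cvg_Re (T : Type) (F : set_system T) {FF : Filter F} (f : T -> C) z :
  f @ F --> z -> (fun t => Re (f t)) @ F --> Re z.
Proof.
move=> /cvg_normcP H; apply/cvgrPdist_lt => e e0.
apply: filterS (H _ e0) => t /=; apply: le_lt_trans.
by rewrite distrC -raddfB Re_le_normc.
Qed.

Lemma cvg_Im (T : Type) (F : set_system T) {FF : Filter F} (f : T -> C) z :
  f @ F --> z -> (fun t => Im (f t)) @ F --> Im z.
Proof.
move=> /cvg_normcP H; apply/cvgrPdist_lt => e e0.
apply: filterS (H _ e0) => t /=; apply: le_lt_trans.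
by rewrite distrC -raddfB Im_le_normc.
Qed.

Lemma cvg_complex (T : Type) (F : set_system T) {FF : Filter F} (f : T -> C) z :
  (fun t => Re (f t)) @ F --> Re z -> (fun t => Im (f t)) @ F --> Im z ->
  f @ F --> z.
Proof.
move=> /cvgrPdist_lt H1 /cvgrPdist_lt H2; apply/cvg_normcP => e e0.
have e2 : 0 < e / 2 by rewrite divr_gt0.
near=> t; apply: le_lt_trans (normc_le_ReIm _) _.
rewrite !raddfB [e]splitr ltrD//; rewrite distrC; near: t;
  [exact: H1|exact: H2].
Unshelve. all: by end_near. Qed.

Lemma cvg_normc (T : Type) (F : set_system T) {FF : Filter F} (f : T -> C) z :
  f @ F --> z -> (fun t => normc (f t)) @ F --> normc z.
Proof.
move=> /cvg_normcP H; apply/cvgrPdist_lt => e e0.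
apply: filterS (H _ e0) => t /=; apply: le_lt_trans.
rewrite ler_norml; apply/andP; split.
  rewrite lerNl opprB lerBlDr -[X in normc X <= _](subrK z).
  exact: le_normcD.
by rewrite lerBlDr -[X in normc X <= _](subrK (f t)) normcB le_normcD.
Unshelve. Qed.

Lemma cvg_conj (T : Type) (F : set_system T) {FF : Filter F} (f : T -> C) z :
  f @ F --> z -> (fun t => (f t)^* : C) @ F --> (z^* : C).
Proof.
move=> /cvg_normcP H; apply/cvg_normcP => e e0.
by apply: filterS (H _ e0) => t /=; rewrite -rmorphB normc_conj.
Qed.

Lemma cvg_realC (T : Type) (F : set_system T) {FF : Filter F} (f : T -> R) (x : R) :
  f @ F --> x -> (fun t => (f t)%:C : C) @ F --> (x%:C : C).
Proof. by move=> H; apply: cvg_complex => //=; exact: cvg_cst. Qed.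

(** The difference quotient is cleared of its denominator. With [<=] the estimate also covers
    [w = z], so that no punctured neighbourhood remains in later proofs. *)
Lemma is_derive_normcP f z d : is_derive z 1 f d <->
  forall e : R, 0 < e -> exists2 r : R, 0 < r & forall w, normc (w - z) < r ->
    normc (f w - f z - d * (w - z)) <= e * normc (w - z).
Proof.
have aux : (h^-1 *: (f (h *: 1 + z) - f z) @[h --> (0:C)^'] --> d) <->
    forall e : R, 0 < e -> exists2 r : R, 0 < r & forall w, normc (w - z) < r ->
    normc (f w - f z - d * (w - z)) <= e * normc (w - z).
  split.
    move=> /cvg_normcP H e e0.
    have /nbhs_normcP[r r0 Hr] := H _ e0.
    exists r => // w wr; have [->|wz] := eqVneq w z.
      by rewrite !subrr mulr0 subr0 !normc0 mulr0.
    have wz0 : w - z != 0 by rewrite subr_eq0.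
    have := Hr (w - z); rewrite subr0 => /(_ wr wz0).
    rewrite /GRing.scale/= mulr1 subrK => h.
    have -> : f w - f z - d * (w - z) =
      ((w - z)^-1 * (f w - f z) - d) * (w - z).
      by rewrite mulrBl mulrAC mulVf// mul1r.
    by rewrite normcM ler_wpM2r ?normc_ge0// ltW.
  move=> H; apply/cvg_normcP => e e0.
  have e2 : 0 < e / 2 by rewrite divr_gt0.
  have [r r0 Hr] := H _ e2.
  apply/nbhs_normcP; exists r => // w; rewrite subr0 => wr w0.
  have := Hr (w + z); rewrite addrK => /(_ wr) h.
  rewrite /GRing.scale/= mulr1.
  have -> : w^-1 * (f (w + z) - f z) - d = (f (w + z) - f z - d * w) * w^-1.
    by rewrite mulrBl mulfK// mulrC.
  rewrite normcM normcV ltr_pdivrMr ?normc_gt0//.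
  apply: le_lt_trans h _; rewrite ltr_pM2r ?normc_gt0//.
  by rewrite ltr_pdivrMr// ltr_pMr// ltr1n.
rewrite -aux; split; first by case=> dfz <-.
move=> H; apply: DeriveDef; first by apply/cvg_ex; exists d.
by apply/cvg_lim.
Qed.

End ComplexPlane.

(** * Calculus rules for complex derivatives *)

Section Derivatives.
Variable R : realType.
Local Notation C := (cplane R).
Implicit Types (z w d e : C) (f g : C -> C).

Lemma cvgcD (T : Type) (F : set_system T) {FF : Filter F} (f g : T -> C) (a b : C) :
  f @ F --> a -> g @ F --> b -> (fun t => f t + g t : C) @ F --> (a + b : C).
Proof.
move=> fa gb; apply: cvg_complex.
  by under eq_fun do rewrite raddfD; rewrite raddfD; apply: cvgD; apply: cvg_Re.
by under eq_fun do rewrite raddfD; rewrite raddfD; apply: cvgD; apply: cvg_Im.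
Qed.

Lemma ReD z w : Re (z + w) = Re z + Re w. Proof. by case: z; case: w. Qed.
Lemma ImD z w : Im (z + w) = Im z + Im w. Proof. by case: z; case: w. Qed.
Lemma ImN z : Im (- z) = - Im z. Proof. by case: z. Qed.
Lemma ReB z w : Re (z - w) = Re z - Re w. Proof. by case: z; case: w. Qed.
Lemma ImB z w : Im (z - w) = Im z - Im w. Proof. by case: z; case: w. Qed.
Lemma ReJ z : Re (z^*)%C = Re z. Proof. by case: z. Qed.
Lemma ImJ z : Im (z^*)%C = - Im z. Proof. by case: z. Qed.

Lemma ReM z w : Re (z * w) = Re z * Re w - Im z * Im w.
Proof. by case: z; case: w. Qed.

Lemma ImM z w : Im (z * w) = Re z * Im w + Im z * Re w.
Proof. by case: z; case: w. Qed.

Lemma cvgcM (T : Type) (F : set_system T) {FF : Filter F} (f g : T -> C) (a b : C) :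
  f @ F --> a -> g @ F --> b -> (fun t => f t * g t : C) @ F --> (a * b : C).
Proof.
move=> fa gb; apply: cvg_complex.
  under eq_fun do rewrite ReM.
  by rewrite ReM; apply: cvgB; apply: cvgM; (apply: cvg_Re || apply: cvg_Im).
under eq_fun do rewrite ImM.
by rewrite ImM; apply: cvgD; apply: cvgM; (apply: cvg_Re || apply: cvg_Im).
Qed.

Lemma cvgcN (T : Type) (F : set_system T) {FF : Filter F} (f : T -> C) (a : C) :
  f @ F --> a -> (fun t => - f t : C) @ F --> (- a : C).
Proof.
move=> fa; apply: cvg_complex.
  by under eq_fun do rewrite raddfN; rewrite raddfN; apply: cvgN; apply: cvg_Re.
by under eq_fun do rewrite raddfN; rewrite raddfN; apply: cvgN; apply: cvg_Im.
Qed.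

Lemma cvgcB (T : Type) (F : set_system T) {FF : Filter F} (f g : T -> C) (a b : C) :
  f @ F --> a -> g @ F --> b -> (fun t => f t - g t : C) @ F --> (a - b : C).
Proof. by move=> fa gb; exact: (cvgcD fa (cvgcN gb)). Qed.

Lemma cvgcV (T : Type) (F : set_system T) {FF : Filter F} (f : T -> C) (a : C) :
  a != 0 -> f @ F --> a -> (fun t => (f t)^-1 : C) @ F --> (a^-1 : C).
Proof. by move=> a0 fa; apply: cvgV. Qed.

Lemma cvgcX (T : Type) (F : set_system T) {FF : Filter F} (f : T -> C) (a : C) n :
  f @ F --> a -> (fun t => f t ^+ n : C) @ F --> (a ^+ n : C).
Proof.
move=> fa; elim: n => [|n IH]; first exact: cvg_cst.
under eq_fun do rewrite exprS.
by rewrite exprS; apply: cvgcM.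
Qed.

Lemma is_derivecM z d e f g : is_derive z 1 f d -> is_derive z 1 g e ->
  is_derive z 1 (fun x => f x * g x : C) (d * g z + f z * e).
Proof.
move=> fd ge; have h := is_deriveM fd ge; apply: is_derive_eq h _.
by rewrite addrC; congr (_ + _); rewrite mulrC.
Qed.

Lemma is_derivecD z d e f g : is_derive z 1 f d -> is_derive z 1 g e ->
  is_derive z 1 (fun x => f x + g x : C) (d + e).
Proof. by move=> fd ge; exact: is_deriveD. Qed.

Lemma is_derivecN z d f : is_derive z 1 f d ->
  is_derive z 1 (fun x => - f x : C) (- d).
Proof. by move=> fd; exact: is_deriveN. Qed.

Lemma is_derivecB z d e f g : is_derive z 1 f d -> is_derive z 1 g e ->
  is_derive z 1 (fun x => f x - g x : C) (d - e).
Proof. by move=> fd ge; exact: is_deriveB. Qed.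

Lemma is_derivec_cst z (c : C) : is_derive z 1 (fun=> c) (0 : C).
Proof. exact: is_derive_cst. Qed.

Lemma is_derivec_id z : is_derive z 1 (fun x : C => x) (1 : C).
Proof. exact: is_derive_id. Qed.

Lemma derivable_continuous_at f z : derivable f z 1 -> {for z, continuous f}.
Proof. by move=> /derivable1_diffP /differentiable_continuous. Qed.

Lemma is_derive_continuous_at f z d : is_derive z 1 f d -> {for z, continuous f}.
Proof. by case=> /derivable_continuous_at. Qed.

Lemma is_derivec_comp f g z d e : is_derive z 1 g e -> is_derive (g z) 1 f d ->
  is_derive z 1 (fun x => f (g x)) (d * e).
Proof.
move=> ge fd; have gc := is_derive_continuous_at ge.
move: ge fd => /is_derive_normcP ge /is_derive_normcP fd.
apply/is_derive_normcP => eps eps0.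
pose M := 1 + normc e + normc d.
have M1 : 1 <= M by rewrite /M -addrA lerDl addr_ge0 ?normc_ge0.
have M0 : 0 < M by exact: lt_le_trans M1.
(* The bound by [1] makes [g] Lipschitz at [z] with constant [M]; the bound by [eps / (2 * M)] makes
   each of the two errors at most half of the allowed one. *)
pose e1 := Num.min 1 (eps / (2 * M)).
have e10 : 0 < e1 by rewrite lt_min ltr01 divr_gt0// mulr_gt0.
have [r1 r10 h1] := ge _ e10; have [r2 r20 h2] := fd _ e10.
have /continuous_normcP/(_ _ r20)[r3 r30 h3] := gc.
exists (Num.min r1 r3); first by rewrite lt_min r10.
move=> w; rewrite lt_min => /andP[/h1 {}h1 /h3/h2 {}h2].
have -> : f (g w) - f (g z) - d * e * (w - z) =
  (f (g w) - f (g z) - d * (g w - g z)) + d * (g w - g z - e * (w - z)) by ring.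
have hg : normc (g w - g z) <= M * normc (w - z).
  have -> : g w - g z = (g w - g z - e * (w - z)) + e * (w - z) by ring.
  apply: le_trans (le_normcD _ _) _; rewrite normcM.
  have := normc_ge0 d; have : e1 <= 1 by rewrite ge_min lexx.
  by move: h1 (normc_ge0 (w - z)); rewrite /M; nra.
apply: le_trans (le_normcD _ _) _; rewrite normcM.
have h4 : e1 * (2 * M) <= eps by rewrite -ler_pdivlMr ?mulr_gt0// ge_min lexx orbT.
have dM : normc d <= M by rewrite /M lerDr addr_ge0 ?normc_ge0.
apply: (@le_trans _ _ (e1 * (M * normc (w - z)) + M * (e1 * normc (w - z)))).
  apply: lerD; first by apply: le_trans h2 _; rewrite ler_pM2l.
  by apply: ler_pM => //; exact: normc_ge0.
have := normc_ge0 (w - z); move: h4; set a := normc (w - z); nra.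
Qed.

(** The remainder equals [(z^-1 - w^-1) * (w - z) / z], so differentiability follows from the
    continuity of the inverse. *)
Lemma is_derivec_inv z : z != 0 -> is_derive z 1 (fun x : C => x^-1 : C) (- z ^- 2).
Proof.
move=> z0; have h0 : (fun x : C => x^-1 : C) @ z --> (z^-1 : C).
  by apply: (@cvgcV C (nbhs z)) => //; exact: cvg_id.
move: h0 => /(@cvg_normcP R C (nbhs z) _) h; apply/is_derive_normcP => e e0.
have nz0 : 0 < normc z by rewrite normc_gt0.
have {}h := h (e * normc z) (mulr_gt0 e0 nz0).
have /nbhs_normcP[r r0 hr] := h.
exists (Num.min r (normc z)); first by rewrite lt_min r0.
move=> w; rewrite lt_min => /andP[/hr wr wz].
have w0 : w != 0.
  by apply: contraTneq wz => ->; rewrite sub0r normcN ltxx.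
have -> : w^-1 - z^-1 - - z ^- 2 * (w - z) = (z^-1 - w^-1) * (w - z) / z.
  by field; rewrite w0 z0.
rewrite normcM normcV normcM mulrAC ler_wpM2r ?normc_ge0//.
by rewrite ler_pdivrMr// normcB ltW.
Qed.

Lemma is_derivecV z d f : f z != 0 -> is_derive z 1 f d ->
  is_derive z 1 (fun x => (f x)^-1 : C) (- d / f z ^+ 2).
Proof.
move=> fz0 fd; have h := is_derivec_comp fd (is_derivec_inv fz0).
by apply: is_derive_eq h _; rewrite mulNr mulrC mulNr.
Qed.

Lemma derivable_is_derive f z : derivable f z 1 -> is_derive z 1 f ('D_1 f z).
Proof. by move=> fz; apply: DeriveDef. Qed.

Lemma is_derive_derivable f z d : is_derive z 1 f d -> derivable f z 1.
Proof. by case. Qed.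

Lemma is_derive_val f z d : is_derive z 1 f d -> 'D_1 f z = d.
Proof. by case. Qed.

Lemma is_derive_near f g z d : (\forall w \near z, f w = g w) ->
  is_derive z 1 f d -> is_derive z 1 g d.
Proof.
move=> fg /is_derive_normcP h; apply/is_derive_normcP => e e0.
have [r r0 hr] := h _ e0; have fgz := nbhs_singleton fg.
have /nbhs_normcP[r1 r10 h1] := fg.
exists (Num.min r r1); first by rewrite lt_min r0.
by move=> w; rewrite lt_min => /andP[/hr wr /h1 <-]; rewrite -fgz.
Qed.

(** Schwarz reflection. It makes the values on the second sheet of the double, which are holomorphic
    in the conjugate variable, holomorphic after conjugation. *)
Lemma is_derive_conj f z d : is_derive z 1 f d ->
  is_derive ((z^*)%C : C) 1 (fun w : C => ((f (w^*)%C)^*)%C : C) (d^*)%C.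
Proof.
move=> /is_derive_normcP h; apply/is_derive_normcP => e e0.
have [r r0 hr] := h _ e0; exists r => // w.
rewrite -normc_conj rmorphB/= conjcK => /hr.
have <- := conjcK w; rewrite !conjcK => {}hr.
have -> : (f (w^*)%C)^*%C - (f z)^*%C - d^*%C * (w - z^*%C) =
    ((f (w^*)%C - f z - d * (w^*%C - z))^*)%C :> C.
  by rewrite !rmorphB/= rmorphM/= rmorphB/= conjcK.
by rewrite normc_conj.
Qed.

End Derivatives.

(** * Real derivatives in the form of an estimate *)

Section RealDerive.
Variable R : realType.
Implicit Types (f : R -> R) (t d : R).

Lemma is_derive_realP f t d : is_derive t 1 f d <->
  forall e : R, 0 < e -> exists2 r : R, 0 < r & forall s, `|s - t| < r ->
    `|f s - f t - d * (s - t)| <= e * `|s - t|.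
Proof.
have aux : (h^-1 *: (f (h *: 1 + t) - f t) @[h --> (0:R)^'] --> d) <->
    forall e : R, 0 < e -> exists2 r : R, 0 < r & forall s, `|s - t| < r ->
    `|f s - f t - d * (s - t)| <= e * `|s - t|.
  split.
    move=> /cvgrPdist_lt H e e0.
    have /nbhs_ballP[r /= r0 Hr] := H _ e0.
    exists r => // w wr; have [->|wz] := eqVneq w t.
      by rewrite !subrr mulr0 subr0 !normr0 mulr0.
    have wz0 : w - t != 0 by rewrite subr_eq0.
    have := Hr (w - t); rewrite /ball/= sub0r normrN => /(_ wr wz0).
    rewrite /GRing.scale/= mulr1 subrK => h.
    have -> : f w - f t - d * (w - t) =
      ((w - t)^-1 * (f w - f t) - d) * (w - t).
      by rewrite mulrBl mulrAC mulVf// mul1r.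
    by rewrite normrM ler_wpM2r// distrC ltW.
  move=> H; apply/cvgrPdist_lt => e e0.
  have e2 : 0 < e / 2 by rewrite divr_gt0.
  have [r r0 Hr] := H _ e2.
  apply/nbhs_ballP; exists r => //= w; rewrite /ball/= sub0r normrN => wr w0.
  have := Hr (w + t); rewrite addrK => /(_ wr) h.
  rewrite /GRing.scale/= mulr1 distrC.
  have -> : w^-1 * (f (w + t) - f t) - d = (f (w + t) - f t - d * w) * w^-1.
    by rewrite mulrBl mulfK// mulrC.
  rewrite normrM normfV ltr_pdivrMr ?normr_gt0//.
  apply: le_lt_trans h _; rewrite ltr_pM2r ?normr_gt0//.
  by rewrite ltr_pdivrMr// ltr_pMr// ltr1n.
rewrite -aux; split; first by case=> dfz <-.
move=> H; apply: DeriveDef; first by apply/cvg_ex; exists d.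
by apply/cvg_lim.
Qed.

Lemma is_derive_real_near f g t d : (\forall w \near t, f w = g w) ->
  is_derive t 1 f d -> is_derive t 1 g d.
Proof.
move=> fg /is_derive_realP h; apply/is_derive_realP => e e0.
have [r r0 hr] := h _ e0; have fgz := nbhs_singleton fg.
have /nbhs_ballP[r1 /= r10 h1] := fg.
exists (Num.min r r1); first by rewrite lt_min r0.
move=> w; rewrite lt_min => /andP[/hr wr wr1]; rewrite -fgz -h1//.
by rewrite /ball/= distrC.
Qed.

Lemma derivable_real_continuous f t d : is_derive t 1 f d -> {for t, continuous f}.
Proof. by case=> /derivable1_diffP /differentiable_continuous. Qed.

End RealDerive.

(** * Curves in the plane with a real parameter *)

Section Curves.
Variable R : realType.
Local Notation C := (cplane R).
Implicit Types (t : R) (v d : C) (a b : R -> C).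

(** The scalars of [C] are [R[i]], so a derivative in a real variable is stated for the two
    components, as real derivatives. *)
Definition cderiv a t v :=
  is_derive t 1 (fun s => Re (a s)) (Re v) /\
  is_derive t 1 (fun s => Im (a s)) (Im v).

Lemma cderivP a t v : cderiv a t v <->
  forall e : R, 0 < e -> exists2 r : R, 0 < r & forall s, `|s - t| < r ->
    normc (a s - a t - v * (s - t)%:C) <= e * `|s - t|.
Proof.
have ReE s : Re (a s - a t - v * (s - t)%:C) = Re (a s) - Re (a t) - Re v * (s - t).
  by rewrite !ReB ReM/= !mulr0 subr0.
have ImE s : Im (a s - a t - v * (s - t)%:C) = Im (a s) - Im (a t) - Im v * (s - t).
  by rewrite !ImB ImM/= mulr0 add0r.
split.
  move=> [/is_derive_realP h1 /is_derive_realP h2] e e0.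
  have e2 : 0 < e / 2 by rewrite divr_gt0.
  have [r r0 hr] := h1 _ e2; have [r1 r10 hr1] := h2 _ e2.
  exists (Num.min r r1); first by rewrite lt_min r0.
  move=> s; rewrite lt_min => /andP[/hr sr /hr1 sr1].
  apply: le_trans (normc_le_ReIm _) _.
  by rewrite ReE ImE [e]splitr mulrDl lerD.
move=> h; split; apply/is_derive_realP => e e0; have [r r0 hr] := h _ e0;
  exists r => // s /hr; apply: le_trans.
- by rewrite -ReE Re_le_normc.
- by rewrite -ImE Im_le_normc.
Qed.

Lemma cderiv_continuous a t v : cderiv a t v -> {for t, continuous a}.
Proof.
move=> [h1 h2]; apply: (@cvg_complex _ _ (nbhs t)).
  exact: derivable_real_continuous h1.
exact: derivable_real_continuous h2.
Qed.

Lemma cderiv_eq a t v w : cderiv a t v -> v = w -> cderiv a t w.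
Proof. by move=> h <-. Qed.

Lemma cderiv_near a b t v : (\forall s \near t, a s = b s) ->
  cderiv a t v -> cderiv b t v.
Proof.
move=> ab [h1 h2]; split.
  by apply: is_derive_real_near h1; near=> s; congr Re; near: s.
by apply: is_derive_real_near h2; near=> s; congr Im; near: s.
Unshelve. all: by end_near. Qed.

Lemma cderiv_comp (f : C -> C) a t d v :
  cderiv a t v -> is_derive (a t) 1 f d -> cderiv (fun s => f (a s)) t (d * v).
Proof.
move=> ge fd; have gc := cderiv_continuous ge.
move: ge fd => /cderivP ge /is_derive_normcP fd.
apply/cderivP => eps eps0.
pose M := 1 + normc v + normc d.
have M1 : 1 <= M by rewrite /M -addrA lerDl addr_ge0 ?normc_ge0.
have M0 : 0 < M by exact: lt_le_trans M1.
pose e1 := Num.min 1 (eps / (2 * M)).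
have e10 : 0 < e1 by rewrite lt_min ltr01 divr_gt0// mulr_gt0.
have [r1 r10 h1] := ge _ e10; have [r2 r20 h2] := fd _ e10.
have /(@cvg_normcP _ _ (nbhs t))/(_ _ r20)/nbhs_ballP[r3 /= r30 h3] := gc.
exists (Num.min r1 r3); first by rewrite lt_min r10.
move=> w; rewrite lt_min => /andP[/h1 {}h1 wr3].
have {}h2 : normc (f (a w) - f (a t) - d * (a w - a t)) <= e1 * normc (a w - a t).
  by apply: h2; apply: h3; rewrite /ball/= distrC.
have -> : f (a w) - f (a t) - d * v * (w - t)%:C =
  (f (a w) - f (a t) - d * (a w - a t)) + d * (a w - a t - v * (w - t)%:C) by ring.
have hg : normc (a w - a t) <= M * `|w - t|.
  have -> : a w - a t = (a w - a t - v * (w - t)%:C) + v * (w - t)%:C by ring.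
  apply: le_trans (le_normcD _ _) _; rewrite normcM normc_real.
  have := normc_ge0 d; have : e1 <= 1 by rewrite ge_min lexx.
  by move: h1 (normr_ge0 (w - t)); rewrite /M; nra.
apply: le_trans (le_normcD _ _) _; rewrite normcM.
have h4 : e1 * (2 * M) <= eps by rewrite -ler_pdivlMr ?mulr_gt0// ge_min lexx orbT.
have dM : normc d <= M by rewrite /M lerDr addr_ge0 ?normc_ge0.
apply: (@le_trans _ _ (e1 * (M * `|w - t|) + M * (e1 * `|w - t|))).
  apply: lerD; first by apply: le_trans h2 _; rewrite ler_pM2l.
  by apply: ler_pM => //; exact: normc_ge0.
have := normr_ge0 (w - t); move: h4; set x := `|w - t|; nra.
Qed.

Lemma cderivM a b t v w : cderiv a t v -> cderiv b t w ->
  cderiv (fun s => a s * b s : C) t (v * b t + a t * w).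
Proof.
move=> [a1 a2] [b1 b2]; split.
  have h := is_deriveB (is_deriveM a1 b1) (is_deriveM a2 b2).
  have -> : (fun s => Re (a s * b s)) =
      (fun s => Re (a s) * Re (b s)) - (fun s => Im (a s) * Im (b s)).
    by apply/funext => s; rewrite ReM.
  by apply: is_derive_eq h _; rewrite ReD !ReM /GRing.scale/=; ring.
have h := is_deriveD (is_deriveM a1 b2) (is_deriveM a2 b1).
have -> : (fun s => Im (a s * b s)) =
    (fun s => Re (a s) * Im (b s)) + (fun s => Im (a s) * Re (b s)).
  by apply/funext => s; rewrite ImM.
by apply: is_derive_eq h _; rewrite ImD !ImM /GRing.scale/=; ring.
Qed.

Lemma cderivD a b t v w : cderiv a t v -> cderiv b t w ->
  cderiv (fun s => a s + b s : C) t (v + w).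
Proof.
move=> [a1 a2] [b1 b2]; split.
  under eq_fun do rewrite raddfD; rewrite raddfD; exact: is_deriveD.
under eq_fun do rewrite raddfD; rewrite raddfD; exact: is_deriveD.
Qed.

Lemma cderiv_cst (c : C) t : cderiv (fun=> c) t 0.
Proof. by split; exact: is_derive_cst. Qed.

Lemma cderiv_real (f : R -> R) t (d : R) : is_derive t 1 f d ->
  cderiv (fun s => (f s)%:C : C) t (d%:C).
Proof. by move=> h; split => //=; exact: is_derive_cst. Qed.

Lemma cderiv_conj a t v : cderiv a t v -> cderiv (fun s => ((a s)^*)%C : C) t (v^*)%C.
Proof.
move=> [a1 a2]; split.
  by under eq_fun do rewrite ReJ; rewrite ReJ.
by under eq_fun do rewrite ImJ; rewrite ImJ; exact: is_deriveN.
Qed.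

Lemma cderiv_line (c v : C) t : cderiv (fun s => c + v * s%:C : C) t v.
Proof.
have h := cderivM (cderiv_cst v t) (cderiv_real (is_derive_id t 1)).
apply: cderiv_eq (cderivD (cderiv_cst c t) h) _.
by rewrite mul0r !add0r mulr1.
Qed.

End Curves.

(** * Integrals of complex functions over real segments *)

Section Integrals.
Variable R : realType.
Local Notation C := (cplane R).
Local Notation mu := (@lebesgue_measure R).
Implicit Types (a b c t : R) (f g F : R -> R).

(** Continuity is two-sided at the end points too. The functions integrated below are defined beyond
    the segment, and one-sided filters are thus avoided. *)
Definition cont_itv (T : topologicalType) a b (f : R -> T) :=
  forall t, a <= t <= b -> {for t, continuous f}.

Lemma cont_itv_within a b f : cont_itv a b f -> {within `[a, b], continuous f}.
Proof.
move=> h; apply: continuous_in_subspaceT => t /[!inE]/=.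
by rewrite in_itv/=; exact: h.
Qed.

Lemma cont_itv_integrable a b f : cont_itv a b f ->
  mu.-integrable `[a, b] (EFin \o f).
Proof.
move=> h; apply: continuous_compact_integrable; first exact: segment_compact.
exact: cont_itv_within.
Qed.

Lemma Rintegral_itv_ftc F f a b : a <= b ->
  (forall t, a <= t <= b -> is_derive t 1 F (f t)) -> cont_itv a b f ->
  \int[mu]_(t in `[a, b]) f t = F b - F a.
Proof.
rewrite le_eqVlt => /predU1P[<- _ _|ab dF cf].
  by rewrite set_itv1 Rintegral_set1 subrr.
have cF t : a <= t <= b -> {for t, continuous F}.
  by move=> /dF; exact: derivable_real_continuous.
rewrite /Rintegral (@continuous_FTC2 _ f F a b)//.
- exact: cont_itv_within.
- split.
  + by move=> t; rewrite in_itv/= => /andP[a_t tb]; have [] := dF t _; rewrite ?ltW.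
  + by apply: cvg_at_right_filter; apply: cF; rewrite lexx ltW.
  + by apply: cvg_at_left_filter; apply: cF; rewrite lexx ltW.
- move=> t; rewrite in_itv/= => /andP[a_t tb].
  by rewrite derive1E; have [] := dF t _; rewrite ?ltW.
Qed.

Lemma Rintegral_itv_cat f a b c : a <= b -> b <= c -> cont_itv a c f ->
  \int[mu]_(t in `[a, c]) f t =
  \int[mu]_(t in `[a, b]) f t + \int[mu]_(t in `[b, c]) f t.
Proof.
move=> ab bc cf; have := @Rintegral_itvB R f (BLeft a) (BRight c) b.
rewrite !bnd_simp => /(_ (cont_itv_integrable cf) ab bc).
rewrite Rintegral_itv_obnd_cbnd; last first.
  apply: integrableS (cont_itv_integrable cf) => //.
  by apply: subset_itvr; rewrite bnd_simp.
by move=> <-; rewrite addrCA subrr addr0.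
Qed.

Lemma Rintegral_itv_le f g a b : cont_itv a b f -> cont_itv a b g ->
  (forall t, a <= t <= b -> f t <= g t) ->
  \int[mu]_(t in `[a, b]) f t <= \int[mu]_(t in `[a, b]) g t.
Proof.
by move=> cf cg fg; apply: le_Rintegral => //; exact: cont_itv_integrable.
Qed.

Lemma Rintegral_itv_cst a b c : a <= b ->
  \int[mu]_(t in `[a, b]) c = c * (b - a).
Proof.
rewrite le_eqVlt => /predU1P[<-|ab].
  by rewrite set_itv1 Rintegral_set1 subrr mulr0.
by rewrite Rintegral_cst//= lebesgue_measure_itv/= lte_fin ab.
Qed.

Lemma Rintegral_itv_norm f a b M : a <= b -> cont_itv a b f ->
  (forall t, a <= t <= b -> `|f t| <= M) ->
  `|\int[mu]_(t in `[a, b]) f t| <= M * (b - a).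
Proof.
move=> ab cf fM; have cM c : cont_itv a b (fun=> c) by move=> t _; exact: cvg_cst.
rewrite ler_norml -mulNr -!(Rintegral_itv_cst _ ab); apply/andP; split;
  apply: Rintegral_itv_le; try exact: cM; try exact: cf;
  by move=> t /fM; rewrite ler_norml => /andP[].
Qed.

Definition cint a b (u : R -> C) : C :=
  (\int[mu]_(t in `[a, b]) Re (u t)) +i* (\int[mu]_(t in `[a, b]) Im (u t)).

Implicit Types (u v : R -> C).

Lemma cont_itv_Re a b u : cont_itv a b u -> cont_itv a b (fun t => Re (u t)).
Proof. by move=> h t /h; exact: cvg_Re. Qed.

Lemma cont_itv_Im a b u : cont_itv a b u -> cont_itv a b (fun t => Im (u t)).
Proof. by move=> h t /h; exact: cvg_Im. Qed.

Lemma cint_ftc u v a b : a <= b ->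
  (forall t, a <= t <= b -> cderiv v t (u t)) -> cont_itv a b u ->
  cint a b u = v b - v a.
Proof.
move=> ab dv cu; rewrite /cint.
have dR t : a <= t <= b -> is_derive t 1 (fun t => Re (v t)) (Re (u t)).
  by move=> /dv[].
have dI t : a <= t <= b -> is_derive t 1 (fun t => Im (v t)) (Im (u t)).
  by move=> /dv[].
rewrite (Rintegral_itv_ftc ab dR (cont_itv_Re cu)).
rewrite (Rintegral_itv_ftc ab dI (cont_itv_Im cu)).
by case: (v b) => ? ?; case: (v a).
Qed.

Lemma cintD u v a b : cont_itv a b u -> cont_itv a b v ->
  cint a b (fun t => u t + v t) = cint a b u + cint a b v.
Proof.
move=> cu cv; rewrite /cint.
under eq_Rintegral do rewrite ReD.
under [X in _ +i* X]eq_Rintegral do rewrite ImD.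
by rewrite !RintegralD//; apply: cont_itv_integrable;
  (apply: cont_itv_Re || apply: cont_itv_Im).
Qed.

Lemma cintZ u a b (k : C) : cont_itv a b u ->
  cint a b (fun t => k * u t) = k * cint a b u.
Proof.
move=> cu; rewrite /cint.
under eq_Rintegral do rewrite ReM.
under [X in _ +i* X]eq_Rintegral do rewrite ImM.
have iR := cont_itv_integrable (cont_itv_Re cu).
have iI := cont_itv_integrable (cont_itv_Im cu).
have iZ c f : mu.-integrable `[a, b] (EFin \o f) ->
    mu.-integrable `[a, b] (EFin \o (fun t => c * f t)).
  by move=> h; apply: (integrableZl _ c h).
rewrite RintegralB//; try exact: iZ.
rewrite RintegralD//; try exact: iZ.
by rewrite !RintegralZl//; case: k.
Qed.

Lemma cintN u a b : cont_itv a b u -> cint a b (fun t => - u t) = - cint a b u.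
Proof.
move=> cu; have := cintZ (-1) cu; rewrite mulN1r => <-.
by congr cint; apply/funext => t; rewrite mulN1r.
Qed.

Lemma cintB u v a b : cont_itv a b u -> cont_itv a b v ->
  cint a b (fun t => u t - v t) = cint a b u - cint a b v.
Proof.
move=> cu cv.
have cnv : cont_itv a b (fun t => - v t) by move=> t /cv; exact: cvgcN.
by rewrite (cintD cu cnv) cintN.
Qed.

Lemma cint_cat u a b c : a <= b -> b <= c -> cont_itv a c u ->
  cint a c u = cint a b u + cint b c u.
Proof.
move=> ab bc cu; rewrite /cint (Rintegral_itv_cat ab bc (cont_itv_Re cu)).
by rewrite (Rintegral_itv_cat ab bc (cont_itv_Im cu)).
Qed.

Lemma eq_cint u v a b : (forall t, a <= t <= b -> u t = v t) ->
  cint a b u = cint a b v.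
Proof.
move=> uv; rewrite /cint; congr (_ +i* _); apply: eq_Rintegral => t;
  by rewrite inE/= in_itv/= => /uv ->.
Qed.

(** The real and imaginary parts are bounded separately, whence the factor [2] in place of the sharp
    [1]; only the order of magnitude matters in what follows. *)
Lemma cint_norm u a b M : a <= b -> cont_itv a b u ->
  (forall t, a <= t <= b -> normc (u t) <= M) ->
  normc (cint a b u) <= 2 * (M * (b - a)).
Proof.
move=> ab cu uM; apply: le_trans (normc_le_ReIm _) _.
rewrite mulr_natl mulr2n; apply: lerD.
  apply: Rintegral_itv_norm => // [|t /uM]; first exact: cont_itv_Re.
  by apply: le_trans; exact: Re_le_normc.
apply: Rintegral_itv_norm => // [|t /uM]; first exact: cont_itv_Im.
by apply: le_trans; exact: Im_le_normc.
Qed.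

Lemma cint_cst (k : C) a b : a <= b -> cint a b (fun=> k) = k * (b - a)%:C.
Proof.
move=> ab; rewrite /cint !Rintegral_itv_cst//; case: k => x y.
by apply/eqP; rewrite eq_complex ReM ImM /= !mulr0 subr0 add0r !eqxx.
Qed.

End Integrals.

(** * Goursat's theorem on rectangles and local primitives *)

Section Goursat.
Variable R : realType.
Local Notation C := (cplane R).
Implicit Types (f F : C -> C) (x y a b : R).

Definition hint f a b y : C := cint a b (fun t => f (t +i* y)).
Definition vint f a b x : C := cint a b (fun t => f (x +i* t)).

(** The contour integral over the boundary, counterclockwise: ['i] is the velocity along the
    vertical sides, and the signs of the top and left sides account for their orientation. *)
Definition rect_int f x1 x2 y1 y2 : C :=
  hint f x1 x2 y1 - hint f x1 x2 y2 + 'i%C * (vint f y1 y2 x2 - vint f y1 y2 x1).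

Definition cont_rect f x1 x2 y1 y2 := forall x y,
  x1 <= x <= x2 -> y1 <= y <= y2 -> {for (x +i* y : C), continuous f}.

Lemma cderiv_horizontal y t : cderiv (fun t => t +i* y : C) t 1.
Proof. by split => /=; [exact: is_derive_id|exact: is_derive_cst]. Qed.

Lemma cderiv_vertical x t : cderiv (fun t => x +i* t : C) t ('i%C : C).
Proof. by split => /=; [exact: is_derive_cst|exact: is_derive_id]. Qed.

Lemma cont_horizontal f x1 x2 y1 y2 y : cont_rect f x1 x2 y1 y2 ->
  y1 <= y <= y2 -> cont_itv x1 x2 (fun t => f (t +i* y) : C).
Proof.
move=> h hy t ht; have ct := cderiv_continuous (cderiv_horizontal y t).
exact: continuous_comp ct (h _ _ ht hy).
Qed.

Lemma cont_vertical f x1 x2 y1 y2 x : cont_rect f x1 x2 y1 y2 ->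
  x1 <= x <= x2 -> cont_itv y1 y2 (fun t => f (x +i* t) : C).
Proof.
move=> h hx t ht; have ct := cderiv_continuous (cderiv_vertical x t).
exact: continuous_comp ct (h _ _ hx ht).
Qed.

Lemma cont_rectW f x1 x2 y1 y2 x1' x2' y1' y2' :
  x1 <= x1' -> x2' <= x2 -> y1 <= y1' -> y2' <= y2 ->
  cont_rect f x1 x2 y1 y2 -> cont_rect f x1' x2' y1' y2'.
Proof.
move=> h1 h2 h3 h4 h x y /andP[xa xb] /andP[ya yb]; apply: h.
  by rewrite (le_trans h1)//= (le_trans xb).
by rewrite (le_trans h3)//= (le_trans yb).
Qed.

Lemma rect_int_splitx f x1 x2 x3 y1 y2 : x1 <= x2 -> x2 <= x3 -> y1 <= y2 ->
  cont_rect f x1 x3 y1 y2 ->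
  rect_int f x1 x3 y1 y2 = rect_int f x1 x2 y1 y2 + rect_int f x2 x3 y1 y2.
Proof.
move=> x12 x23 y12 cf; rewrite /rect_int /hint.
rewrite (cint_cat x12 x23 (cont_horizontal cf _)) ?lexx//.
rewrite (cint_cat x12 x23 (cont_horizontal cf _)) ?lexx ?y12//.
by ring.
Qed.

Lemma rect_int_splity f x1 x2 y1 y2 y3 : y1 <= y2 -> y2 <= y3 -> x1 <= x2 ->
  cont_rect f x1 x2 y1 y3 ->
  rect_int f x1 x2 y1 y3 = rect_int f x1 x2 y1 y2 + rect_int f x1 x2 y2 y3.
Proof.
move=> y12 y23 x12 cf; rewrite /rect_int /vint.
rewrite (cint_cat y12 y23 (cont_vertical cf _)) ?lexx ?x12//.
rewrite (cint_cat y12 y23 (cont_vertical cf _)) ?lexx ?x12//.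
by ring.
Qed.

Lemma rect_intB f g x1 x2 y1 y2 : x1 <= x2 -> y1 <= y2 ->
  cont_rect f x1 x2 y1 y2 -> cont_rect g x1 x2 y1 y2 ->
  rect_int (fun z => f z - g z) x1 x2 y1 y2 =
  rect_int f x1 x2 y1 y2 - rect_int g x1 x2 y1 y2.
Proof.
move=> x12 y12 cf cg; rewrite /rect_int /hint /vint.
rewrite (cintB (cont_horizontal cf _) (cont_horizontal cg _)) ?lexx ?y12//.
rewrite (cintB (cont_horizontal cf _) (cont_horizontal cg _)) ?lexx ?y12//.
rewrite (cintB (cont_vertical cf _) (cont_vertical cg _)) ?lexx ?x12//.
rewrite (cintB (cont_vertical cf _) (cont_vertical cg _)) ?lexx ?x12//.
by ring.
Qed.

Lemma rect_int_norm f x1 x2 y1 y2 M : x1 <= x2 -> y1 <= y2 ->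
  cont_rect f x1 x2 y1 y2 ->
  (forall x y, x1 <= x <= x2 -> y1 <= y <= y2 -> normc (f (x +i* y)) <= M) ->
  normc (rect_int f x1 x2 y1 y2) <= 4 * (M * ((x2 - x1) + (y2 - y1))).
Proof.
move=> x12 y12 cf fM.
have h y : y1 <= y <= y2 -> normc (hint f x1 x2 y) <= 2 * (M * (x2 - x1)).
  move=> hy; apply: cint_norm => //; first exact: cont_horizontal cf hy.
  by move=> t ht; exact: fM.
have v x : x1 <= x <= x2 -> normc (vint f y1 y2 x) <= 2 * (M * (y2 - y1)).
  move=> hx; apply: cint_norm => //; first exact: cont_vertical cf hx.
  by move=> t ht; exact: fM.
have nB (z w : C) : normc (z - w) <= normc z + normc w.
  by rewrite -(normcN w); exact: le_normcD.
apply: le_trans (le_normcD _ _) _; rewrite normcM normc_i mul1r.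
have y1P : y1 <= y1 <= y2 by rewrite lexx.
have y2P : y1 <= y2 <= y2 by rewrite y12 lexx.
have x1P : x1 <= x1 <= x2 by rewrite lexx.
have x2P : x1 <= x2 <= x2 by rewrite x12 lexx.
have := nB (hint f x1 x2 y1) (hint f x1 x2 y2).
have := nB (vint f y1 y2 x2) (vint f y1 y2 x1).
have := h _ y1P; have := h _ y2P; have := v _ x1P; have := v _ x2P.
lra.
Qed.

Lemma rect_int_derive f F x1 x2 y1 y2 : x1 <= x2 -> y1 <= y2 ->
  cont_rect f x1 x2 y1 y2 ->
  (forall x y, x1 <= x <= x2 -> y1 <= y <= y2 ->
    is_derive (x +i* y : C) 1 F (f (x +i* y))) ->
  rect_int f x1 x2 y1 y2 = 0.
Proof.
move=> x12 y12 cf dF.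
have h y : y1 <= y <= y2 -> hint f x1 x2 y = F (x2 +i* y) - F (x1 +i* y).
  move=> hy; rewrite /hint.
  rewrite (@cint_ftc _ _ (fun t => F (t +i* y)))//; last exact: cont_horizontal cf hy.
  move=> t ht; have := cderiv_comp (cderiv_horizontal y t) (dF _ _ ht hy).
  by move/cderiv_eq; apply; rewrite mulr1.
have v x : x1 <= x <= x2 -> 'i%C * vint f y1 y2 x = F (x +i* y2) - F (x +i* y1).
  move=> hx; rewrite /vint -cintZ; last exact: cont_vertical cf hx.
  rewrite (@cint_ftc _ _ (fun t => F (x +i* t)))//.
    move=> t ht; have := cderiv_comp (cderiv_vertical x t) (dF _ _ hx ht).
    by move/cderiv_eq; apply; rewrite mulrC.
  move=> t ht; exact: cvgcM (cvg_cst _) (cont_vertical cf hx ht).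
rewrite /rect_int mulrBr !h ?v ?lexx ?x12 ?y12//.
by ring.
Qed.

Lemma normc_sum4 (a b c d : C) (M : R) : normc a < M -> normc b < M ->
  normc c < M -> normc d < M -> normc (a + b + c + d) < 4 * M.
Proof.
have := le_normcD (a + b + c) d; have := le_normcD (a + b) c.
have := le_normcD a b; lra.
Qed.

(** The boundary integrals of the four quarters add up to the whole. If every quarter had modulus
    below one fourth of it, the triangle inequality would be contradicted. *)
Lemma Goursat_step f x y A B : 0 <= A -> 0 <= B ->
  cont_rect f x (x + A) y (y + B) -> exists2 p : R * R,
    [/\ x <= p.1, p.1 + A / 2 <= x + A, y <= p.2 & p.2 + B / 2 <= y + B] &
    normc (rect_int f x (x + A) y (y + B)) <=
      4 * normc (rect_int f p.1 (p.1 + A / 2) p.2 (p.2 + B / 2)).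
Proof.
move=> A0 B0 cf; apply: contrapT => /forall2NP H.
have {}H u v : x <= u -> u + A / 2 <= x + A -> y <= v -> v + B / 2 <= y + B ->
    normc (rect_int f u (u + A / 2) v (v + B / 2)) <
    normc (rect_int f x (x + A) y (y + B)) / 4.
  move=> h1 h2 h3 h4; have [[]//|/negP] := H (u, v).
  by rewrite -ltNge /= => h; rewrite ltr_pdivlMr// mulrC.
have eA : x + A / 2 + A / 2 = x + A by lra.
have eB : y + B / 2 + B / 2 = y + B by lra.
have A2 : x + A / 2 <= x + A by lra.
have B2 : y + B / 2 <= y + B by lra.
have A1 : x <= x + A / 2 by lra.
have B1 : y <= y + B / 2 by lra.
have := rect_int_splitx A1 A2 (le_trans B1 B2) cf.
rewrite (rect_int_splity B1 B2 A1) ?(rect_int_splity B1 B2 A2); last 2 first.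
- by apply: cont_rectW cf.
- by apply: cont_rectW cf.
move=> E.
have h1 := H x y (lexx _) A2 (lexx _) B2.
have h2 := H (x + A / 2) y A1 _ (lexx _) B2.
have h3 := H x (y + B / 2) (lexx _) A2 B1 _.
have h4 := H (x + A / 2) (y + B / 2) A1 _ B1 _.
rewrite eA eB in h2 h3 h4.
have := normc_sum4 h1 (h3 (lexx _)) (h2 (lexx _)) (h4 (lexx _) (lexx _)).
by rewrite addrA in E; rewrite -E mulrC divfK// ltxx.
Qed.

Lemma Goursat_nested f x0 y0 A B : 0 <= A -> 0 <= B ->
  cont_rect f x0 (x0 + A) y0 (y0 + B) -> exists u v : nat -> R,
  [/\ u 0%N = x0, v 0%N = y0,
    (forall n, [/\ u n <= u n.+1, u n.+1 + A / 2 ^+ n.+1 <= u n + A / 2 ^+ n,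
      v n <= v n.+1 & v n.+1 + B / 2 ^+ n.+1 <= v n + B / 2 ^+ n]) &
    (forall n, normc (rect_int f x0 (x0 + A) y0 (y0 + B)) <=
      4 ^+ n * normc (rect_int f (u n) (u n + A / 2 ^+ n) (v n) (v n + B / 2 ^+ n)))].
Proof.
move=> A0 B0 cf.
pose inv (n : nat) (p : R * R) := [/\ x0 <= p.1, p.1 + A / 2 ^+ n <= x0 + A,
  y0 <= p.2 & p.2 + B / 2 ^+ n <= y0 + B].
pose nxt (n : nat) (p q : R * R) := [/\ p.1 <= q.1, q.1 + A / 2 ^+ n.+1 <= p.1 + A / 2 ^+ n,
  p.2 <= q.2 & q.2 + B / 2 ^+ n.+1 <= p.2 + B / 2 ^+ n].
pose J (n : nat) (p : R * R) :=
  normc (rect_int f p.1 (p.1 + A / 2 ^+ n) p.2 (p.2 + B / 2 ^+ n)).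
(* The invariant stands under the existential, so that the axiom of choice yields a successor for
   every pair; a pair without the invariant gets itself. *)
have step (n : nat) (p : R * R) : exists q, inv n p ->
    [/\ nxt n p q, inv n.+1 q & J n p <= 4 * J n.+1 q].
  have [[h1 h2 h3 h4]|h] := pselect (inv n p); last by exists p.
  have A2 : 0 <= A / 2 ^+ n by rewrite divr_ge0// exprn_ge0.
  have B2 : 0 <= B / 2 ^+ n by rewrite divr_ge0// exprn_ge0.
  have cf' : cont_rect f p.1 (p.1 + A / 2 ^+ n) p.2 (p.2 + B / 2 ^+ n).
    by apply: cont_rectW cf.
  have [q [q1 q2 q3 q4] qJ] := Goursat_step A2 B2 cf'.
  have eA k : k / 2 ^+ n / 2 = k / 2 ^+ n.+1 :> R by rewrite exprSr invfM mulrA.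
  rewrite !eA in q2 q4 qJ.
  by exists q => _; split => //; split; [exact: le_trans q1|exact: le_trans h2|
    exact: le_trans q3|exact: le_trans h4].
have [nx nxP] := choice (fun np : nat * (R * R) => step np.1 np.2).
pose s := fix s (n : nat) : R * R := if n is m.+1 then nx (m, s m) else (x0, y0).
have sP n : inv n (s n).
  elim: n => [|n IH]; first by rewrite /inv /= expr0 !divr1 !lexx.
  by have [] := nxP (n, s n) IH.
exists (fun n => (s n).1), (fun n => (s n).2); split => //.
  by move=> n; have [] := nxP (n, s n) (sP n).
elim=> [|n IH]; first by rewrite expr0 mul1r /= !divr1.
apply: le_trans IH _; rewrite exprSr -mulrA ler_pM2l ?exprn_gt0//.
by have [] := nxP (n, s n) (sP n).
Qed.

Lemma nested_sup (A : R) (u : nat -> R) : 0 <= A ->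
  (forall n, u n <= u n.+1) ->
  (forall n, u n.+1 + A / 2 ^+ n.+1 <= u n + A / 2 ^+ n) ->
  exists x, forall n, u n <= x <= u n + A / 2 ^+ n.
Proof.
move=> A0 h1 h2.
have ui : {homo u : m n / (m <= n)%N >-> m <= n}.
  by apply: homo_leq => // ? ? ?; exact: le_trans.
have di : {homo (fun n => u n + A / 2 ^+ n) : m n / (m <= n)%N >-> n <= m}.
  apply: (@homo_leq _ (fun n => u n + A / 2 ^+ n) (fun m n => n <= m)) => //.
    by move=> a b c ab bc; exact: le_trans ab.
have ub n m : u m <= u n + A / 2 ^+ n.
  have [mn|nm] := leqP m n.
    by apply: le_trans (ui _ _ mn) _; rewrite lerDl divr_ge0// exprn_ge0.
  apply: le_trans (di _ _ (ltnW nm)); by rewrite lerDl divr_ge0// exprn_ge0.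
exists (sup (range u)) => n; apply/andP; split.
  apply: ub_le_sup; last by exists n.
  by exists (u 0%N + A / 2 ^+ 0) => _ [m _ <-]; exact: ub.
by apply: ge_sup => [|_ [m _ <-]]; [exists (u 0%N), 0%N|exact: ub].
Qed.

Theorem Goursat f x1 x2 y1 y2 : x1 <= x2 -> y1 <= y2 ->
  (forall x y, x1 <= x <= x2 -> y1 <= y <= y2 -> derivable f (x +i* y : C) 1) ->
  rect_int f x1 x2 y1 y2 = 0.
Proof.
move=> x12 y12 df; set A := x2 - x1; set B := y2 - y1.
have A0 : 0 <= A by rewrite subr_ge0.
have B0 : 0 <= B by rewrite subr_ge0.
have eA : x2 = x1 + A by rewrite /A; lra.
have eB : y2 = y1 + B by rewrite /B; lra.
have cf : cont_rect f x1 (x1 + A) y1 (y1 + B).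
  by move=> x y hx hy; apply: derivable_continuous_at; apply: df; rewrite ?eA ?eB.
rewrite eA eB; have [u [v [u0 v0 uv uvJ]]] := Goursat_nested A0 B0 cf.
have [x hx] : exists x, forall n, u n <= x <= u n + A / 2 ^+ n.
  by apply: nested_sup => // n; have [] := uv n.
have [y hy] : exists y, forall n, v n <= y <= v n + B / 2 ^+ n.
  by apply: nested_sup => // n; have [] := uv n.
have /derivable_is_derive/is_derive_normcP dfz : derivable f (x +i* y : C) 1.
  apply: df.
    by have := hx 0%N; rewrite u0 expr0 divr1 eA.
  by have := hy 0%N; rewrite v0 expr0 divr1 eB.
set d := 'D_1 f _ in dfz.
set z : C := x +i* y in dfz.
apply/eqP; rewrite -normc_eq0 eq_le normc_ge0 andbT.
apply/ler_addgt0Pl => e e0; rewrite addr0.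
(* At stage [n] the integral is at most [4 * (e / K * s * (A + B) / 2 ^+ n)] with
   [s = (A + B + 1) / 2 ^+ n]. The factor [4 ^+ n] of the subdivision cancels both powers of [2],
   and this [K] leaves at most [e]. *)
pose K := 4 * (A + B + 1) ^+ 2.
have K0 : 0 < K.
  by rewrite mulr_gt0// exprn_gt0//; rewrite ltr_wpDl// addr_ge0.
have [r r0 hr] := dfz (e / K) (divr_gt0 e0 K0).
have [n hn] : exists n, (A + B + 1) / 2 ^+ n < r.
  have := @cvg_geometric R (A + B + 1) 2^-1.
  rewrite ger0_norm// invf_lt1// ltr1n => /(_ isT)/cvgrPdist_lt/(_ _ r0)[n _ h].
  exists n; have := h n (leqnn n); rewrite /= sub0r normrN exprVn.
  by apply: le_lt_trans; exact: ler_norm.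
apply: le_trans (uvJ n) _.
set s := (A + B + 1) / 2 ^+ n in hn.
have n2 : 0 < 2 ^+ n :> R by rewrite exprn_gt0.
have near_z a b : u n <= a <= u n + A / 2 ^+ n -> v n <= b <= v n + B / 2 ^+ n ->
    normc ((a +i* b) - z) <= s.
  move=> /andP[a1 a2] /andP[b1 b2].
  have /andP[x1' x2'] := hx n; have /andP[y1' y2'] := hy n.
  apply: le_trans (normc_le_ReIm _) _; rewrite /=.
  have : `|a - x| <= A / 2 ^+ n by rewrite ler_norml; apply/andP; split; lra.
  have : `|b - y| <= B / 2 ^+ n by rewrite ler_norml; apply/andP; split; lra.
  rewrite /s !mulrDl; have : 0 <= 1 / 2 ^+ n :> R by rewrite divr_ge0// ltW.
  lra.
(* The first order approximation of [f] has the primitive [Aff], so its boundary integral is [0] and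
   only the error of approximation contributes. *)
pose aff (w : C) : C := f z + d * (w - z).
pose Aff (w : C) : C := f z * w + d / 2 * ((w - z) * (w - z)).
have dAff (w : C) : is_derive w 1 Aff (aff w).
  have h1 := is_derivecM (is_derivec_cst w (f z)) (is_derivec_id w).
  have h2 := is_derivecB (is_derivec_id w) (is_derivec_cst w z).
  have h3 := is_derivecM (is_derivec_cst w (d / 2)) (is_derivecM h2 h2).
  by apply: is_derive_eq (is_derivecD h1 h3) _; rewrite /aff; field.
have caff (w : C) : {for w, continuous aff}.
  have h2 := is_derivecB (is_derivec_id w) (is_derivec_cst w z).
  have h3 := is_derivecM (is_derivec_cst w d) h2.
  exact: is_derive_continuous_at (is_derivecD (is_derivec_cst w (f z)) h3).
have An : u n <= u n + A / 2 ^+ n by have /andP[] := hx n; exact: le_trans.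
have Bn : v n <= v n + B / 2 ^+ n by have /andP[] := hy n; exact: le_trans.
have ui k : u 0%N <= u k /\ u k + A / 2 ^+ k <= u 0%N + A / 2 ^+ 0.
  by elim: k => // k []; have [? ? _ _] := uv k; lra.
have vi k : v 0%N <= v k /\ v k + B / 2 ^+ k <= v 0%N + B / 2 ^+ 0.
  by elim: k => // k []; have [_ _ ? ?] := uv k; lra.
have cfn : cont_rect f (u n) (u n + A / 2 ^+ n) (v n) (v n + B / 2 ^+ n).
  have [] := ui n; have [] := vi n.
  by rewrite u0 v0 expr0 !divr1 => *; apply: cont_rectW cf.
have caffn : cont_rect aff (u n) (u n + A / 2 ^+ n) (v n) (v n + B / 2 ^+ n).
  by move=> *; exact: caff.
have := rect_intB An Bn cfn caffn.
rewrite (rect_int_derive An Bn caffn (fun a b _ _ => dAff (a +i* b))).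
rewrite subr0 => <-.
have cE : cont_rect (fun w => f w - aff w) (u n) (u n + A / 2 ^+ n) (v n) (v n + B / 2 ^+ n).
  by move=> a b ha hb; exact: cvgcB (cfn _ _ ha hb) (caffn _ _ ha hb).
have s0 : 0 < s by rewrite divr_gt0// ltr_wpDl// addr_ge0.
have eM a b : u n <= a <= u n + A / 2 ^+ n -> v n <= b <= v n + B / 2 ^+ n ->
    normc (f (a +i* b) - aff (a +i* b)) <= e / K * s.
  move=> ha hb; rewrite /aff opprD addrA.
  apply: le_trans (hr _ (le_lt_trans (near_z _ _ ha hb) hn)) _.
  by rewrite ler_pM2l ?divr_gt0// near_z.
have := rect_int_norm An Bn cE eM.
rewrite -(ler_pM2l (_ : 0 < 4 ^+ n)) ?exprn_gt0// => /le_trans; apply.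
have -> : u n + A / 2 ^+ n - u n + (v n + B / 2 ^+ n - v n) = (A + B) / 2 ^+ n by ring.
have -> : 4 ^+ n * (4 * (e / K * s * ((A + B) / 2 ^+ n))) =
    e * (4 * (A + B + 1) * (A + B)) / K.
  have -> : 4 ^+ n = 2 ^+ n * 2 ^+ n :> R by rewrite -exprMn -natrM.
  by rewrite /s; field; rewrite !gt_eqF.
rewrite ler_pdivrMr// ler_pM2l// /K; nra.
Qed.

Lemma cint_ftc1 (u : R -> C) a b x : a < x -> x < b -> cont_itv a b u ->
  cderiv (fun y => cint a y u) x (u x).
Proof.
move=> ax xb cu; have xab : a <= x <= b by rewrite !ltW.
have [d1 e1] := continuous_FTC1_closed xb (cont_itv_integrable (cont_itv_Re cu)) ax
  (cont_itv_Re cu xab).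
have [d2 e2] := continuous_FTC1_closed xb (cont_itv_integrable (cont_itv_Im cu)) ax
  (cont_itv_Im cu xab).
have e1' := etrans (esym (derive1E _ _)) e1.
have e2' := etrans (esym (derive1E _ _)) e2.
split; last by exact: (DeriveDef d2 e2').
by exact: (DeriveDef d1 e1').
Qed.

(** A mean value inequality; the factor [2] is that of [cint_norm]. The end points come in either
    order because they will be coordinates of two arbitrary points. *)
Lemma cderiv_mvt (u v : R -> C) a b M :
  (forall t, Num.min a b <= t <= Num.max a b -> cderiv v t (u t) /\ normc (u t) <= M) ->
  cont_itv (Num.min a b) (Num.max a b) u ->
  normc (v b - v a) <= 2 * (M * `|b - a|).
Proof.
wlog ab : a b / a <= b => [H|].
  have [ab|ba] := leP a b; first by have := H _ _ ab; rewrite min_l// max_r.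
  by have := H _ _ (ltW ba); rewrite (min_l (ltW ba)) (max_r (ltW ba)) normcB distrC.
rewrite min_l// max_r// => h cu.
rewrite -(cint_ftc ab (fun t ht => proj1 (h t ht)) cu).
rewrite ger0_norm ?subr_ge0//; apply: cint_norm => // t /h[]//.
Qed.

(** Continuous partial derivatives that satisfy the Cauchy-Riemann equations give complex
    differentiability. The passage from [z] to [w] is horizontal at height [Im z], then vertical at
    abscissa [Re w]. *)
Lemma is_derive_of_partials f F (z : C) (r : R) : 0 < r ->
  (forall w, normc (w - z) < r ->
     [/\ cderiv (fun t => F (t +i* Im w)) (Re w) (f w),
         cderiv (fun t => F (Re w +i* t)) (Im w) ('i%C * f w) &
         {for w, continuous f}]) ->
  is_derive z 1 F (f z).
Proof.
move=> r0 h; apply/is_derive_normcP => e e0.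
have e4 : 0 < e / 4 by rewrite divr_gt0.
have [_ _ cfz] : _ := h z ltac:(by rewrite subrr normc0).
have /continuous_normcP/(_ _ e4)[r1 r10 h1] := cfz.
(* Points of the broken path are at distance at most the sum of the two coordinate gaps, hence at
   most twice the modulus of [w - z]; halving the radius keeps them in range. *)
exists (Num.min r r1 / 2); first by rewrite divr_gt0// lt_min r0.
move=> w wr.
have box s t : `|s - Re z| <= `|Re w - Re z| -> `|t - Im z| <= `|Im w - Im z| ->
    normc ((s +i* t : C) - z) < Num.min r r1.
  move=> hs ht; apply: le_lt_trans (normc_le_ReIm _) _.
  have -> : Re ((s +i* t : C) - z) = s - Re z by case: (z).
  have -> : Im ((s +i* t : C) - z) = t - Im z by case: (z).
  have := Re_le_normc (w - z); have := Im_le_normc (w - z); rewrite ReB ImB.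
  lra.
have mem (a b t : R) : Num.min a b <= t <= Num.max a b -> `|t - a| <= `|b - a|.
  have [ab|/ltW ab] := leP a b; rewrite ?(min_l ab, max_r ab, min_r ab, max_l ab).
    by move=> /andP[? ?]; rewrite !ger0_norm ?subr_ge0// lerD2r.
  by move=> /andP[? ?]; rewrite !ler0_norm ?subr_le0// lerN2 lerD2r.
have cvert s t : {for (s +i* t : C), continuous f} ->
    {for t, continuous (fun t => f (s +i* t) : C)}.
  by move=> c; exact: continuous_comp (cderiv_continuous (cderiv_vertical s t)) c.
have chor s t : {for (s +i* t : C), continuous f} ->
    {for s, continuous (fun s => f (s +i* t) : C)}.
  by move=> c; exact: continuous_comp (cderiv_continuous (cderiv_horizontal t s)) c.
(* [V] and [H] are [F] on the two legs of the path minus its linear approximation. Their derivatives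
   are small, and their increments add up to the remainder of [F]. *)
pose V (t : R) : C := F (Re w +i* t) - 'i%C * f z * t%:C.
pose H (t : R) : C := F (t +i* Im z) - f z * t%:C.
have hV : normc (V (Im w) - V (Im z)) <= 2 * (e / 4 * `|Im w - Im z|).
  apply: (@cderiv_mvt (fun t => 'i%C * (f (Re w +i* t) - f z))).
    move=> t /mem ht; have := box (Re w) t (lexx _) ht.
    rewrite lt_min => /andP[/h[_ d2 _] /h1 h2]; split; last first.
      by rewrite normcM normc_i mul1r ltW.
    have d3 := cderivM (cderiv_cst (- ('i%C * f z)) t) (cderiv_real (is_derive_id t 1)).
    have := cderivD d2 d3; rewrite /V => /(@cderiv_near _ _ (fun t => F (Re w +i* t) - 'i%C * f z * t%:C)).
    move=> d4; apply: cderiv_eq (d4 _) _; last by rewrite /=; ring.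
    by near=> s; rewrite mulNr.
  move=> t /mem ht; have := box (Re w) t (lexx _) ht.
  rewrite lt_min => /andP[/h[_ _ c3] _].
  apply: cvgcM; first exact: cvg_cst.
  by apply: cvgcB; [exact: cvert|exact: cvg_cst].
have hH : normc (H (Re w) - H (Re z)) <= 2 * (e / 4 * `|Re w - Re z|).
  apply: (@cderiv_mvt (fun t => f (t +i* Im z) - f z)).
    move=> t /mem ht; have := box t (Im z) ht; rewrite subrr normr0 normr_ge0 => /(_ isT).
    rewrite lt_min => /andP[/h[d2 _ _] /h1 h2]; split; last exact: ltW.
    have d3 := cderivM (cderiv_cst (- f z) t) (cderiv_real (is_derive_id t 1)).
    have := cderivD d2 d3; rewrite /H => /(@cderiv_near _ _ (fun t => F (t +i* Im z) - f z * t%:C)).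
    move=> d4; apply: cderiv_eq (d4 _) _; last by rewrite /=; ring.
    by near=> s; rewrite mulNr.
  move=> t /mem ht; have := box t (Im z) ht; rewrite subrr normr0 normr_ge0 => /(_ isT).
  rewrite lt_min => /andP[/h[_ _ c3] _].
  by apply: cvgcB; [exact: chor|exact: cvg_cst].
have -> : F w - F z - f z * (w - z) = (V (Im w) - V (Im z)) + (H (Re w) - H (Re z)).
  have wE : Re w +i* Im w = w by case: (w).
  have zE : Re z +i* Im z = z by case: (z).
  rewrite /V /H wE zE.
  have -> : w - z = (Re w)%:C - (Re z)%:C + 'i%C * ((Im w)%:C - (Im z)%:C).
    by rewrite [w in LHS]complexE [z in LHS]complexE; ring.
  by ring.
apply: le_trans (le_normcD _ _) _.
have := Re_le_normc (w - z); have := Im_le_normc (w - z); rewrite ReB ImB.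
move: hV hH; set N := normc (w - z); nra.
Unshelve. all: by end_near. Qed.

(** The integral from the corner [(x0, y0)] to [z] can be taken along either pair of sides, by
    Goursat's theorem. One choice shows the vertical derivative, the other one the horizontal
    derivative. *)
Theorem primitive_rect f x0 y0 x2 y2 :
  (forall z : C, x0 <= Re z < x2 -> y0 <= Im z < y2 -> derivable f z 1) ->
  exists F, forall z : C, x0 < Re z < x2 -> y0 < Im z < y2 -> is_derive z 1 F (f z).
Proof.
move=> df.
pose F (z : C) : C := hint f x0 (Re z) y0 + 'i%C * vint f y0 (Im z) (Re z).
have F2 x y : x0 <= x < x2 -> y0 <= y < y2 ->
    F (x +i* y) = 'i%C * vint f y0 y x0 + hint f x0 x y.
  move=> /andP[x01 x12] /andP[y01 y12].
  have := @Goursat f x0 x y0 y x01 y01.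
  have hd : forall a b, x0 <= a <= x -> y0 <= b <= y -> derivable f (a +i* b : C) 1.
    move=> a b /andP[a1 a2] /andP[b1 b2]; apply: df => /=.
      by rewrite a1 (le_lt_trans a2).
    by rewrite b1 (le_lt_trans b2).
  move=> /(_ hd); rewrite /rect_int /F /= => E.
  by apply/eqP; rewrite -subr_eq0 -E; apply/eqP; ring.
exists F => z /andP[xz1 xz2] /andP[yz1 yz2].
pose r := Num.min (Num.min (Re z - x0) (x2 - Re z)) (Num.min (Im z - y0) (y2 - Im z)).
have r0 : 0 < r by rewrite /r !lt_min !subr_gt0 xz1 xz2 yz1.
apply: (@is_derive_of_partials f F z r r0) => w wr.
have [a1 a2] : x0 < Re w < x2 /\ y0 < Im w < y2.
  have := Re_le_normc (w - z); have := Im_le_normc (w - z); rewrite ReB ImB.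
  rewrite !ler_norml => /andP[? ?] /andP[? ?].
  by move: wr; rewrite /r !lt_min => /andP[/andP[? ?] /andP[? ?]]; split; apply/andP; split; lra.
move: (a1) (a2) => /andP[b1 b2] /andP[b3 b4].
have wE : Re w +i* Im w = w by case: (w).
have [x3 b23] : exists x3, Re w < x3 < x2 by exists ((Re w + x2) / 2); rewrite !midf_lt.
have [y3 b43] : exists y3, Im w < y3 < y2 by exists ((Im w + y2) / 2); rewrite !midf_lt.
move: b23 b43 => /andP[b21 b22] /andP[b41 b42].
have cf : cont_rect f x0 x3 y0 y3.
  move=> x y /andP[h1 h2] /andP[h3 h4]; apply: derivable_continuous_at; apply: df => /=.
    by rewrite h1 (le_lt_trans h2).
  by rewrite h3 (le_lt_trans h4).
have hI : y0 <= Im w <= y3 by rewrite !ltW.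
have hR : x0 <= Re w <= x3 by rewrite !ltW.
split.
- have d := cint_ftc1 b1 b21 (cont_horizontal cf hI).
  have := cderivD (cderiv_cst ('i%C * vint f y0 (Im w) x0) (Re w)) d.
  rewrite add0r wE; apply: cderiv_near.
  have /nbhs_ballP[e /= e0 he] : \forall t \near Re w, x0 < t < x2.
    by apply: near_in_itvoo; rewrite in_itv/= b1.
  apply/nbhs_ballP; exists e => //= t /he /andP[t1 t2].
  by rewrite F2 ?(ltW t1)// (ltW b3).
- have d := cint_ftc1 b3 b41 (cont_vertical cf hR).
  have d1 := cderivM (cderiv_cst 'i%C (Im w)) d.
  have := cderivD (cderiv_cst (hint f x0 (Re w) y0) (Im w)) d1.
  by rewrite mul0r !add0r wE.
- by apply: derivable_continuous_at; apply: df; rewrite ?(ltW b1, ltW b3).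
Qed.

End Goursat.

(** * Measurability and Fubini's theorem in the plane *)

Section PlaneMeasure.
Variable R : realType.
Local Notation C := (cplane R).
Local Notation mu := (@lebesgue_measure R).
Local Notation plane := (measurableTypeR R * measurableTypeR R)%type.
Implicit Types (U A : set C).

Definition on_plane (T : Type) (f : C -> T) : plane -> T :=
  fun p => f (p.1 +i* p.2).

Lemma open_normcP U z : open U -> U z ->
  exists2 r : R, 0 < r & forall w, normc (w - z) < r -> U w.
Proof.
move=> oU Uz; have : nbhs z U by apply: open_nbhs_nbhs.
by move/nbhs_normcP.
Qed.

Lemma normcP_open U :
  (forall z, U z -> exists2 r : R, 0 < r & forall w, normc (w - z) < r -> U w) ->
  open U.
Proof.
move=> h; rewrite openE => z Uz; rewrite /interior.
by apply/nbhs_normcP; exact: h.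
Qed.

(** Measurability refers to the product structure: an open set is the countable union of the boxes
    with rational corners that it contains. *)
Lemma open_plane_measurable U : open U -> measurable (plane_set U).
Proof.
move=> oU.
pose box (q : (rat * rat) * (rat * rat)) : set plane :=
  `]ratr q.1.1, ratr q.1.2[%classic `*` `]ratr q.2.1, ratr q.2.2[%classic.
have -> : plane_set U = \bigcup_(q in [set q | box q `<=` plane_set U]) box q.
  apply/seteqP; split => [[x y] /= Uxy|p [q qU /qU]//].
  have [r r0 hr] := open_normcP oU Uxy.
  have r2 : 0 < r / 2 by rewrite divr_gt0.
  have pick (t : R) : exists q : rat * rat,
      t - r / 2 < ratr q.1 < t /\ t < ratr q.2 < t + r / 2.
    have lt1 : t - r / 2 < t by rewrite ltrBlDr ltrDl.
    have lt2 : t < t + r / 2 by rewrite ltrDl.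
    have [q1 h1] := rat_in_itvoo lt1; have [q2 h2] := rat_in_itvoo lt2.
    by exists (q1, q2); rewrite !in_itv/= in h1 h2.
  have [q1 [/andP[a1 a2] /andP[a3 a4]]] := pick x.
  have [q2 [/andP[b1 b2] /andP[b3 b4]]] := pick y.
  exists (q1, q2); last by split; rewrite /= in_itv/= ?a2 ?b2.
  move=> [u v] [] /=; rewrite !in_itv/= => /andP[u1 u2] /andP[v1 v2].
  apply: hr; apply: le_lt_trans (normc_le_ReIm _) _ => /=.
  rewrite [r]splitr; apply: ltrD; rewrite ltr_norml; apply/andP; split; lra.
rewrite bigcup_mkcond; apply: countable_bigcupT_measurable => // q.
case: ifPn => // _; exact: measurableX.
Qed.

Lemma measurable_on_plane U (f : C -> R) : open U ->
  (forall z, U z -> {for z, continuous f}) ->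
  measurable_fun (plane_set U) (on_plane f).
Proof.
move=> oU cf; apply: (measurability _ (measurable_realfun.RGenOpens.measurableE R)).
move=> _ [_ [a [b ->] <-]].
have -> : plane_set U `&` on_plane f @^-1` `]a, b[%classic =
   plane_set (U `&` f @^-1` `]a, b[%classic) by [].
apply: open_plane_measurable; rewrite openE => z [Uz fz].
apply: filterI; first exact: open_nbhs_nbhs.
by apply: (cf _ Uz); apply: open_nbhs_nbhs; split => //; exact: interval_open.
Qed.

Definition box_set a b c d : set C :=
  [set z | a <= Re z <= b /\ c <= Im z <= d].

Lemma compact_box a b c d : compact (box_set a b c d).
Proof.
have -> : box_set a b c d =
    (fun p : R * R => p.1 +i* p.2 : C) @` (`[a, b]%classic `*` `[c, d]%classic).
  apply/seteqP; split => [z [h1 h2]|_ [[x y] [/= h1 h2] <-]].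
    by exists (Re z, Im z); [split; rewrite /= in_itv/=|case: z {h1 h2}].
  by rewrite !in_itv/= in h1 h2.
apply: continuous_compact; last by apply: compact_setX; exact: segment_compact.
apply: continuous_subspaceT => p; apply: (@cvg_complex _ _ (nbhs p)).
  exact: cvg_fst.
exact: cvg_snd.
Qed.

Lemma compact_continuous_bounded (K : set C) (f : C -> C) : compact K ->
  (forall z, K z -> {for z, continuous f}) ->
  exists2 M : R, 0 < M & forall z, K z -> normc (f z) <= M.
Proof.
move=> cK cf; have [->|K0] := eqVneq K set0; first by exists 1.
have [| |c _ h] := @compact_EVT_max _ R (fun z => normc (f z)) K _ cK.
- exact/set0P.
- by apply: continuous_in_subspaceT => z /[!inE] /cf h; apply: (@cvg_normc _ _ (nbhs z)).
exists (normc (f c) + 1); first by rewrite ltr_wpDl// normc_ge0.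
by move=> z Kz; apply: le_trans (h z _) _; rewrite ?inE// lerDl.
Qed.

Lemma continuous_complexR (f : C -> R) z :
  {for z, continuous f} -> {for z, continuous (fun z => (f z)%:C : C)}.
Proof. by move=> h; apply: (@cvg_realC _ _ (nbhs z)). Qed.

Lemma compact_continuous_boundedR (K : set C) (f : C -> R) : compact K ->
  (forall z, K z -> {for z, continuous f}) ->
  exists2 M : R, 0 < M & forall z, K z -> `|f z| <= M.
Proof.
move=> cK cf; have [|M M0 h] := @compact_continuous_bounded K (fun z => (f z)%:C) cK.
  by move=> z /cf; exact: continuous_complexR.
by exists M => // z /h; rewrite normc_real.
Qed.

Lemma plane_box_measurable a b c d : measurable (plane_set (box_set a b c d)).
Proof.
have -> : plane_set (box_set a b c d) = `[a, b]%classic `*` `[c, d]%classic.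
  by apply/seteqP; split => [[x y] /= []|[x y] /= []]; rewrite /box_set/= !in_itv/=.
exact: measurableX.
Qed.

Lemma area_box_lty a b c d : (area R (plane_set (box_set a b c d)) < +oo)%E.
Proof.
have -> : plane_set (box_set a b c d) = `[a, b]%classic `*` `[c, d]%classic.
  by apply/seteqP; split => [[x y] /= []|[x y] /= []]; rewrite /box_set/= !in_itv/=.
have -> : area R (`[a, b]%classic `*` `[c, d]%classic) =
  (mu `[a, b]%classic * mu `[c, d]%classic)%E by exact: product_measure1E.
rewrite !lebesgue_measure_itv/=.
by do 2 case: ifP => _; rewrite ?mul0e ?mule0// -!EFinB -EFinM ltry.
Qed.

Lemma integrable_box (f : C -> R) a b c d :
  (forall z, {for z, continuous f}) ->
  (area R).-integrable (plane_set (box_set a b c d)) (EFin \o on_plane f).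
Proof.
move=> cf; apply: measurable_bounded_integrable.
- exact: plane_box_measurable.
- exact: area_box_lty.
- apply: (@measurable_funS _ _ _ _ setT) => //.
  have -> : [set: plane] = plane_set [set: C] by [].
  by apply: measurable_on_plane; [exact: openT|move=> *; exact: cf].
- have [M M0 h] := compact_continuous_boundedR (compact_box (a:=a) (b:=b) (c:=c) (d:=d)) (fun z _ => cf z).
  exists M; split; first exact: num_real.
  by move=> N MN p /h /le_trans; apply; exact: ltW.
Qed.

Lemma area_box_iterated (f : C -> R) a b c d : a <= b -> c <= d ->
  (forall z, {for z, continuous f}) ->
  Rintegral (area R) (plane_set (box_set a b c d)) (on_plane f) =
    \int[mu]_(x in `[a, b]) \int[mu]_(y in `[c, d]) f (x +i* y) /\
  Rintegral (area R) (plane_set (box_set a b c d)) (on_plane f) =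
    \int[mu]_(y in `[c, d]) \int[mu]_(x in `[a, b]) f (x +i* y).
Proof.
move=> ab cd cf; have mB := plane_box_measurable a b c d.
have iB := @integrable_box f a b c d cf.
have chor y : cont_itv a b (fun t => f (t +i* y)).
  by move=> t _; exact: continuous_comp (cderiv_continuous (cderiv_horizontal y t)) (cf _).
have cver x : cont_itv c d (fun t => f (x +i* t)).
  by move=> t _; exact: continuous_comp (cderiv_continuous (cderiv_vertical x t)) (cf _).
(* Fubini's theorem is applied on the whole plane to [f] extended by [0] outside the box; its
   marginals are the integrals over the sides, extended by [0] likewise. *)
pose g : plane -> \bar R := (EFin \o on_plane f) \_ (plane_set (box_set a b c d)).
have ig : (mu \x mu)%E.-integrable setT g by apply/(integrable_mkcond _ mB).
have gE x y : g (x, y) = if (a <= x <= b) && (c <= y <= d) then (f (x +i* y))%:E else 0%E.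
  rewrite /g /patch; congr (if _ then _ else _).
  by apply/idP/andP => [/set_mem[]//|[h1 h2]]; exact: mem_set.
have FE (x : R) : fubini_F mu g x =
    ((EFin \o (fun x => \int[mu]_(y in `[c, d]) f (x +i* y))) \_ `[a, b]%classic) x.
  rewrite /fubini_F /patch; case: ifPn => [|nx].
    rewrite inE/= in_itv/= => xab; rewrite /Rintegral fineK; last first.
      by apply: integrable_fin_num => //; exact: cont_itv_integrable (cver x).
    rewrite [RHS]integral_mkcond; apply: eq_integral => y _.
    rewrite gE xab /= /patch; congr (if _ then _ else _).
    by apply/idP/idP; rewrite inE/= in_itv.
  rewrite -[RHS](integral0 mu setT); apply: eq_integral => y _.
  rewrite gE; case: ifPn => // /andP[xab _].
  by move: nx; rewrite notin_setE/= in_itv/= xab.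
have GE (y : R) : fubini_G mu g y =
    ((EFin \o (fun y => \int[mu]_(x in `[a, b]) f (x +i* y))) \_ `[c, d]%classic) y.
  rewrite /fubini_G /patch; case: ifPn => [|ny].
    rewrite inE/= in_itv/= => ycd; rewrite /Rintegral fineK; last first.
      by apply: integrable_fin_num => //; exact: cont_itv_integrable (chor y).
    rewrite [RHS]integral_mkcond; apply: eq_integral => x _.
    rewrite gE ycd andbT /= /patch; congr (if _ then _ else _).
    by apply/idP/idP; rewrite inE/= in_itv.
  rewrite -[RHS](integral0 mu setT); apply: eq_integral => x _.
  rewrite gE; case: ifPn => // /andP[_ ycd].
  by move: ny; rewrite notin_setE/= in_itv/= ycd.
have E : Rintegral (area R) (plane_set (box_set a b c d)) (on_plane f) =
    fine (\int[(mu \x mu)%E]_z g z)%E.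
  by rewrite /Rintegral integral_mkcond.
split; rewrite E.
  rewrite -(integral12_prod_meas1 ig) /Rintegral; congr fine.
  rewrite [RHS]integral_mkcond; apply: eq_integral => x _; exact: FE.
rewrite -(integral21_prod_meas1 ig) /Rintegral; congr fine.
rewrite [RHS]integral_mkcond; apply: eq_integral => y _; exact: GE.
Qed.

Lemma area_integral_box_support (f : C -> R) a b c d :
  (forall z, f z != 0 -> box_set a b c d z) ->
  Rintegral (area R) setT (on_plane f) =
  Rintegral (area R) (plane_set (box_set a b c d)) (on_plane f).
Proof.
move=> h; rewrite [RHS]Rintegral_mkcond; apply: eq_Rintegral => p _.
rewrite /patch; case: ifPn => // /negP; rewrite inE => np.
by apply/eqP; apply: contra_notT np => /h.
Qed.

Lemma Rintegral_itv_Fubini (f : C -> R) a b c d : a <= b -> c <= d ->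
  (forall z, {for z, continuous f}) ->
  \int[mu]_(x in `[a, b]) \int[mu]_(y in `[c, d]) f (x +i* y) =
  \int[mu]_(y in `[c, d]) \int[mu]_(x in `[a, b]) f (x +i* y).
Proof.
by move=> ab cd cf; have [e1 e2] := area_box_iterated ab cd cf; exact: etrans (esym e1) e2.
Qed.

Lemma cint_Fubini (u : C -> C) a b c d : a <= b -> c <= d ->
  (forall z, {for z, continuous u}) ->
  cint a b (fun x => cint c d (fun y => u (x +i* y))) =
  cint c d (fun y => cint a b (fun x => u (x +i* y))).
Proof.
move=> ab cd cu; rewrite /cint /=.
have e1 := Rintegral_itv_Fubini ab cd (fun z => cvg_Re (cu z)).
have e2 := Rintegral_itv_Fubini ab cd (fun z => cvg_Im (cu z)).
by rewrite e1 e2.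
Qed.

End PlaneMeasure.

(** * Pointwise continuity of complex-valued functions *)

Section Continuity.
Variables (R : realType) (T : topologicalType).
Local Notation C := (cplane R).
Implicit Types (f g : T -> C) (x : T).

Lemma contc_cst (c : C) x : {for x, continuous (fun _ : T => c)}.
Proof. exact: cvg_cst. Qed.

Lemma contcD f g x : {for x, continuous f} -> {for x, continuous g} ->
  {for x, continuous (fun t => f t + g t : C)}.
Proof. by move=> hf hg; exact: cvgcD hf hg. Qed.

Lemma contcB f g x : {for x, continuous f} -> {for x, continuous g} ->
  {for x, continuous (fun t => f t - g t : C)}.
Proof. by move=> hf hg; exact: cvgcB hf hg. Qed.

Lemma contcM f g x : {for x, continuous f} -> {for x, continuous g} ->
  {for x, continuous (fun t => f t * g t : C)}.
Proof. by move=> hf hg; exact: cvgcM hf hg. Qed.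

Lemma contcV f x : f x != 0 -> {for x, continuous f} ->
  {for x, continuous (fun t => (f t)^-1 : C)}.
Proof. by move=> h hf; exact: cvgcV h hf. Qed.

Lemma contcX f n x : {for x, continuous f} -> {for x, continuous (fun t => f t ^+ n : C)}.
Proof. by move=> hf; exact: cvgcX hf. Qed.

Lemma contc_conj f x : {for x, continuous f} ->
  {for x, continuous (fun t => ((f t)^*)%C : C)}.
Proof. by move=> hf; exact: cvg_conj hf. Qed.

Lemma contc_real (f : T -> R) x : {for x, continuous f} ->
  {for x, continuous (fun t => (f t)%:C : C)}.
Proof. by move=> hf; exact: cvg_realC hf. Qed.

Lemma contc_Re f x : {for x, continuous f} -> {for x, continuous (fun t => Re (f t))}.
Proof. by move=> hf; exact: cvg_Re hf. Qed.

Lemma contc_Im f x : {for x, continuous f} -> {for x, continuous (fun t => Im (f t))}.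
Proof. by move=> hf; exact: cvg_Im hf. Qed.

Lemma contc_normc f x : {for x, continuous f} -> {for x, continuous (fun t => normc (f t))}.
Proof. by move=> hf; exact: cvg_normc hf. Qed.

Lemma cont_comp (U V : topologicalType) (h : T -> U) (k : U -> V) x :
  {for x, continuous h} -> {for h x, continuous k} ->
  {for x, continuous (fun t => k (h t))}.
Proof. by move=> hh hk; exact: continuous_comp hh hk. Qed.

End Continuity.

Arguments contc_cst {R T} c x.

(** * Cauchy kernels, circles and Cauchy's formula for functions with continuous derivative *)

Section Kernels.
Variable R : realType.
Local Notation C := (cplane R).
Implicit Types (a b t : R) (w z p : C) (f F : C -> C) (phi zeta : R -> C).

Lemma cont_itv_bounded phi a b : cont_itv a b phi ->
  exists2 M : R, 0 < M & forall t, a <= t <= b -> normc (phi t) <= M.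
Proof.
move=> h; have [ab|ba] := leP a b; last first.
  by exists 1 => // t /andP[h1 h2]; have := le_trans h1 h2; rewrite leNgt ba.
have [|c _ hc] := @EVT_max R (fun t => normc (phi t)) a b ab.
  by apply: cont_itv_within => t /h; apply: cvg_normc.
exists (normc (phi c) + 1); first by rewrite ltr_wpDl// normc_ge0.
by move=> t ht; apply: le_trans (hc t _) _; rewrite ?in_itv// lerDl.
Qed.

Lemma cont_itv_kernel phi zeta a b w n : cont_itv a b phi -> cont_itv a b zeta ->
  (forall t, a <= t <= b -> zeta t != w) ->
  cont_itv a b (fun t => phi t / (zeta t - w) ^+ n : C).
Proof.
move=> cp cz zw t ht; apply: cvgcM; first exact: cp.
apply: cvgcV; first by rewrite expf_neq0// subr_eq0 zw.
by apply: cvgcX; apply: cvgcB; [exact: cz|exact: cvg_cst].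
Qed.

(** Meant for inverses [u] of [zeta - w] and [v] of [zeta - w'], with [h = w' - w]: it is the first
    order expansion of the [n]th power of the kernel. The constant depends only on [B] and [n], so
    the remainder is uniform in [zeta]. *)
Lemma inv_pow_remainder (B : R) n : 0 <= B -> exists2 K : R, 0 <= K &
  forall u v h : C, v - u = h * (u * v) -> normc u <= B -> normc v <= B ->
  normc (v ^+ n - u ^+ n - n%:R * h * u ^+ n.+1) <= K * normc h ^+ 2.
Proof.
move=> B0; elim: n => [|n [K K0 IH]].
  by exists 0 => // u v h _ _ _; rewrite !expr0 subrr mul0r mul0r subr0 normc0 mul0r.
exists (B * K + n.+1%:R * B ^+ n.+3).
  by apply: addr_ge0; apply: mulr_ge0 => //; exact: exprn_ge0.
move=> u v h e uB vB.
have -> : v ^+ n.+1 - u ^+ n.+1 - n.+1%:R * h * u ^+ n.+2 =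
    v * (v ^+ n - u ^+ n - n%:R * h * u ^+ n.+1) +
    n.+1%:R * (h ^+ 2 * u ^+ n.+2 * v).
  have -> : v ^+ n.+1 - u ^+ n.+1 - n.+1%:R * h * u ^+ n.+2 =
    v * (v ^+ n - u ^+ n - n%:R * h * u ^+ n.+1)
    + (v - u) * (u ^+ n + n%:R * h * u ^+ n.+1) + n%:R * h * u ^+ n.+2 -
     n.+1%:R * h * u ^+ n.+2 by rewrite !exprS; ring.
  rewrite -natr1 -addrA -addrA; congr (_ + _).
  have -> : (v - u) * (u ^+ n + n%:R * h * u ^+ n.+1) +
    (n%:R * h * u ^+ n.+2 - (n%:R + 1) * h * u ^+ n.+2) =
    (v - u) * n%:R * h * u ^+ n.+1 + u ^+ n * ((v - u) - h * (u * u)).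
    by rewrite !exprS; ring.
  have -> : (v - u) - h * (u * u) = h * u * (v - u) by rewrite {1}e; ring.
  by rewrite e !exprS; ring.
apply: le_trans (le_normcD _ _) _; rewrite mulrDl; apply: lerD.
  rewrite normcM -[leRHS]mulrA; apply: ler_pM => //; try exact: normc_ge0.
  exact: IH.
rewrite normcM.
have -> : normc (n.+1%:R : C) = n.+1%:R.
  by rewrite -(rmorph_nat (real_complex R)) normc_real ger0_norm.
rewrite -[leRHS]mulrA ler_wpM2l// -mulrA normcM normcX mulrC.
rewrite ler_wpM2r ?exprn_ge0 ?normc_ge0// normcM normcX [B ^+ n.+3]exprSr.
apply: ler_pM; rewrite ?exprn_ge0 ?normc_ge0//.
by rewrite lerXn2r// nnegrE normc_ge0.
Qed.

(** Differentiation under the integral sign: the quadratic remainder of [inv_pow_remainder] is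
    uniform along the curve and can be integrated. *)
Lemma kernel_derive phi zeta a b w n (d : R) : a <= b -> 0 < d ->
  cont_itv a b phi -> cont_itv a b zeta ->
  (forall t, a <= t <= b -> d <= normc (zeta t - w)) ->
  is_derive w 1 (fun w => cint a b (fun t => phi t / (zeta t - w) ^+ n : C))
    (n%:R * cint a b (fun t => phi t / (zeta t - w) ^+ n.+1)).
Proof.
move=> ab d0 cp cz hd; have [M M0 hM] := cont_itv_bounded cp.
have B0 : 0 <= 2 / d by rewrite divr_ge0// ltW.
have [K K0 hK] := inv_pow_remainder n B0.
apply/is_derive_normcP => e e0.
pose L := 2 * (M * K * (b - a)) + 1.
have L0 : 0 < L.
  by rewrite ltr_wpDl// mulr_ge0// mulr_ge0 ?subr_ge0// mulr_ge0// ltW.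
(* Within [d / 2] of [w] the curve is still at distance [d / 2], so both inverses are at most
   [2 / d]. [L] bounds the coefficient of the quadratic error; its summand [1] makes it positive. *)
exists (Num.min (d / 2) (e / L)); first by rewrite lt_min !divr_gt0.
move=> v; rewrite lt_min => /andP[vd ve].
have nz t : a <= t <= b -> zeta t - w != 0.
  by move=> /hd; rewrite -normc_gt0; exact: lt_le_trans.
have hv t : a <= t <= b -> d / 2 <= normc (zeta t - v).
  move=> /hd h; have := normc_triangle (zeta t) w v; move: vd; lra.
have nzv t : a <= t <= b -> zeta t - v != 0.
  by move=> /hv; rewrite -normc_gt0; apply: lt_le_trans; rewrite divr_gt0.
have cw m : cont_itv a b (fun t => phi t / (zeta t - w) ^+ m : C).
  by apply: cont_itv_kernel => // t /nz; rewrite subr_eq0.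
have cv m : cont_itv a b (fun t => phi t / (zeta t - v) ^+ m : C).
  by apply: cont_itv_kernel => // t /nzv; rewrite subr_eq0.
have cwn : cont_itv a b (fun t => (n%:R * (v - w)) * (phi t / (zeta t - w) ^+ n.+1) : C).
  by move=> t ht; apply: contcM; [exact: contc_cst|exact: cw].
have cvw : cont_itv a b (fun t => phi t / (zeta t - v) ^+ n - phi t / (zeta t - w) ^+ n : C).
  by move=> t ht; exact: cvgcB (cv n t ht) (cw n t ht).
rewrite mulrAC -(cintB (cv n) (cw n)) -(cintZ _ (cw n.+1)) -(cintB cvw cwn).
apply: (@le_trans _ _ (2 * (M * (K * normc (v - w) ^+ 2) * (b - a)))).
  apply: (cint_norm ab).
    by move=> t ht; exact: cvgcB (cvw t ht) (cwn t ht).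
  move=> t ht.
  have -> : phi t / (zeta t - v) ^+ n - phi t / (zeta t - w) ^+ n -
      n%:R * (v - w) * (phi t / (zeta t - w) ^+ n.+1) =
    phi t * ((zeta t - v)^-1 ^+ n - (zeta t - w)^-1 ^+ n -
      n%:R * (v - w) * (zeta t - w)^-1 ^+ n.+1).
    by rewrite !exprVn; ring.
  rewrite normcM; apply: ler_pM; rewrite ?normc_ge0 ?hM//.
  apply: hK.
  - by field; rewrite nz// nzv.
  - rewrite normcV -[2 / d]invf_div lef_pV2 ?posrE ?normc_gt0 ?nz ?divr_gt0//.
    by apply: le_trans (hd t ht); rewrite ler_pdivrMr// ler_peMr ?ler1n// ltW.
  - by rewrite normcV -[2 / d]invf_div lef_pV2 ?posrE ?normc_gt0 ?nzv ?divr_gt0 ?hv.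
have hL : L * normc (v - w) <= e by rewrite mulrC -ler_pdivlMr// ltW.
have := normc_ge0 (v - w); move: hL; rewrite /L; set x := normc (v - w); nra.
Qed.

Lemma const_of_derive0 f p (r : R) z : (forall w, normc (w - p) < r -> is_derive w 1 f (0 : C)) ->
  normc (z - p) < r -> f z = f p.
Proof.
move=> h zr.
have d (t : R) : 0 <= t <= 1 -> cderiv (fun t => f (p + (z - p) * t%:C)) t 0.
  move=> /andP[t0 t1]; have := cderiv_comp (cderiv_line p (z - p) t) (h (p + (z - p) * t%:C) _).
  rewrite mul0r; apply; rewrite addrC addKr normcM normc_real ger0_norm//.
  by apply: le_lt_trans zr; rewrite ler_piMr ?normc_ge0.
have c0 : @cont_itv R C 0 1 (fun=> 0) by move=> t ht; exact: contc_cst.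
have := cint_ftc ler01 d c0.
rewrite cint_cst// mul0r mulr1 mulr0 addr0 [in p + _]addrC subrK.
by move=> /esym/eqP; rewrite subr_eq0 => /eqP.
Qed.

Definition expi (t : R) : C := cos t +i* sin t.

Lemma cderiv_expi t : cderiv expi t ('i%C * expi t).
Proof.
split; rewrite ?ReM ?ImM /=; rewrite !mul0r !mul1r ?sub0r ?add0r.
  exact: is_derive_cos.
exact: is_derive_sin.
Qed.

Lemma normc_expi t : normc (expi t) = 1.
Proof. by rewrite /normc /= cos2Dsin2 sqrtr1. Qed.

Definition circle p (rho : R) (t : R) : C := p + rho%:C * expi t.
Definition circle' (rho : R) (t : R) : C := 'i%C * (rho%:C * expi t).

Lemma cderiv_circle p rho t : cderiv (circle p rho) t (circle' rho t).
Proof.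
have := cderivD (cderiv_cst p t) (cderivM (cderiv_cst (rho%:C) t) (cderiv_expi t)).
by rewrite mul0r !add0r mulrCA.
Qed.

Lemma circleE p rho t : circle p rho t - p = rho%:C * expi t.
Proof. by rewrite /circle addrC addKr. Qed.

Lemma normc_circle p rho t : 0 <= rho -> normc (circle p rho t - p) = rho.
Proof. by move=> r0; rewrite circleE normcM normc_real normc_expi mulr1 ger0_norm. Qed.

Lemma circle_dist p rho t w : 0 <= rho ->
  rho - normc (w - p) <= normc (circle p rho t - w).
Proof.
move=> r0; have := normc_triangle (circle p rho t) p w.
by rewrite normc_circle// lerBlDr.
Qed.

Lemma circle_period p rho : circle p rho (2 * pi) = circle p rho 0.
Proof. by rewrite /circle /expi mulr_natl cos2pi sin2pi cos0 sin0. Qed.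

Lemma cont_circle p rho t : {for t, continuous (circle p rho)}.
Proof. exact: cderiv_continuous (cderiv_circle p rho t). Qed.

Lemma cont_circle' rho t : {for t, continuous (circle' rho)}.
Proof.
apply: contcM; first exact: contc_cst.
apply: contcM; first exact: contc_cst.
exact: cderiv_continuous (cderiv_expi t).
Qed.

Let pi2_ge0 : 0 <= 2 * pi :> R.
Proof. by rewrite mulr_ge0// pi_ge0. Qed.

(** The derivative in [w] is the integral of the derivative of a periodic function, hence [0]. So
    the value is that at the centre, where the integrand is the constant ['i]. *)
Lemma circle_winding p rho w : 0 < rho -> normc (w - p) < rho ->
  cint 0 (2 * pi) (fun t => circle' rho t / (circle p rho t - w) ^+ 1) =
  'i%C * (2 * pi)%:C.
Proof.
move=> r0 wr.
pose N (w : C) : C := cint 0 (2 * pi) (fun t => circle' rho t / (circle p rho t - w) ^+ 1).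
have cc a b : cont_itv a b (circle p rho) by move=> t _; exact: cont_circle.
have cc' a b : cont_itv a b (circle' rho) by move=> t _; exact: cont_circle'.
have dN z : normc (z - p) < rho -> is_derive z 1 N (0 : C).
  move=> zr; have d0 : 0 < rho - normc (z - p) by rewrite subr_gt0.
  have zP t : 0 <= t <= 2 * pi -> rho - normc (z - p) <= normc (circle p rho t - z).
    by move=> _; exact/circle_dist/ltW.
  have h := kernel_derive 1 pi2_ge0 d0 (cc' _ _) (cc _ _) zP.
  apply: is_derive_eq h _; rewrite mul1r.
  have nz t : circle p rho t - z != 0.
    by rewrite -normc_gt0; apply: lt_le_trans (circle_dist p t z (ltW r0)).
  rewrite (@cint_ftc _ _ (fun t => - (circle p rho t - z)^-1 : C) _ _ pi2_ge0).
  - by rewrite circle_period subrr.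
  - move=> t _.
    have d1 := cderivD (cderiv_circle p rho t) (cderiv_cst (- z) t).
    have d2 := is_derivecN (is_derivec_inv (nz t)).
    apply: cderiv_eq (cderiv_comp d1 d2) _.
    by rewrite addr0 opprK mulrC.
  - by apply: cont_itv_kernel => // t _; rewrite -subr_eq0.
rewrite -/(N w) (const_of_derive0 dN wr) /N.
rewrite (eq_cint (v := fun=> 'i%C)) ?cint_cst// ?subr0//.
move=> t _; rewrite expr1 circleE /circle' mulfK//.
by rewrite -normc_gt0 normcM normc_real normc_expi mulr1 ger0_norm ?(ltW r0).
Qed.

(** The homotopy parameter only makes sense in [[0, 1]], while [cint_Fubini] asks for continuity on
    the whole plane; clamping extends the integrand continuously. *)
Definition clamp01 (s : R) : R := Num.max 0 (Num.min s 1).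

Lemma clamp01P s : 0 <= clamp01 s <= 1.
Proof. by rewrite /clamp01 le_max lexx/= ge_max ler01 ge_min lexx orbT. Qed.

Lemma clamp01_id s : 0 <= s <= 1 -> clamp01 s = s.
Proof. by move=> /andP[s0 s1]; rewrite /clamp01 min_l// max_r. Qed.

Lemma cont_clamp01 s : {for s, continuous clamp01}.
Proof.
apply: (@continuous_max _ R (fun=> 0) (fun s => Num.min s 1) s); first exact: cvg_cst.
by apply: (@continuous_min _ R (fun s => s) (fun=> 1) s); [exact: cvg_id|exact: cvg_cst].
Qed.

(* Homotopy: the integral of [f (w + s (zeta - w))] over the circle vanishes for
   every [s] in [0, 1]; integrating over [s] under the other integral gives
   [F zeta - F w]. *)
Lemma cauchy_C1 f F p (r rho : R) w : 0 < rho -> rho < r -> normc (w - p) < rho ->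
  (forall z, normc (z - p) < r -> is_derive z 1 F (f z)) ->
  (forall z, normc (z - p) < r -> {for z, continuous f}) ->
  F w * ('i%C * (2 * pi)%:C) =
    cint 0 (2 * pi) (fun t => F (circle p rho t) * circle' rho t / (circle p rho t - w) ^+ 1).
Proof.
move=> r0 rr wr dF cf.
have inD (s t : R) : 0 <= s <= 1 -> normc (w + (circle p rho t - w) * s%:C - p) < r.
  move=> /andP[s0 s1].
  have -> : w + (circle p rho t - w) * s%:C - p =
    (1 - s)%:C * (w - p) + s%:C * (circle p rho t - p) by rewrite rmorphB rmorph1; ring.
  apply: le_lt_trans (le_normcD _ _) _; rewrite !normcM !normc_real.
  rewrite normc_circle ?(ltW r0)// !ger0_norm ?subr_ge0//.
  have := normc_ge0 (w - p); nra.
pose u (z : C) : C := f (w + (circle p rho (Im z) - w) * (clamp01 (Re z))%:C) * circle' rho (Im z).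
have cu z : {for z, continuous u}.
  have cI : {for z, continuous (fun z : C => Im z)} by apply: contc_Im; exact: cvg_id.
  have cR : {for z, continuous (fun z : C => Re z)} by apply: contc_Re; exact: cvg_id.
  apply: contcM; last exact: (cont_comp cI (@cont_circle' rho (Im z))).
  have cc := cont_comp cR (@cont_clamp01 (Re z)).
  have cA := contcD (contc_cst w z)
    (contcM (contcB (cont_comp cI (@cont_circle p rho (Im z))) (contc_cst w z)) (contc_real cc)).
  by apply: cont_comp cA (cf _ _); apply: inD; exact: clamp01P.
have nz t : circle p rho t - w != 0.
  by rewrite -normc_gt0; apply: lt_le_trans (circle_dist p t w (ltW r0)); rewrite subr_gt0.
have dl s t : 0 <= s <= 1 -> cderiv (fun s => F (w + (circle p rho t - w) * s%:C)) s
    (f (w + (circle p rho t - w) * s%:C) * (circle p rho t - w)).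
  by move=> hs; exact: cderiv_comp (cderiv_line w _ s) (dF _ (inD s t hs)).
have := cint_Fubini ler01 pi2_ge0 cu.
have -> : cint 0 1 (fun x => cint 0 (2 * pi) (fun y => u (x +i* y))) = 0.
  rewrite (eq_cint (v := fun=> 0)) ?cint_cst ?mul0r// => s hs; rewrite /u /=.
  rewrite (clamp01_id hs); have [->|s0] := eqVneq s 0.
    rewrite (eq_cint (v := fun t => f w * circle' rho t)); last first.
      by move=> t _; rewrite mulr0 addr0.
    rewrite cintZ; last by move=> t _; exact: cont_circle'.
    rewrite (@cint_ftc _ _ (circle p rho) _ _ pi2_ge0).
    - by rewrite circle_period subrr mulr0.
    - by move=> t _; exact: cderiv_circle.
    - by move=> t _; exact: cont_circle'.
  have s0' : s%:C != 0 :> C by rewrite -normc_gt0 normc_real normr_gt0.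
  rewrite (@cint_ftc _ _ (fun t => (s%:C)^-1 * F (w + (circle p rho t - w) * s%:C)) _ _ pi2_ge0).
  - by rewrite circle_period subrr.
  - move=> t _.
    have d1 := cderivD (cderiv_circle p rho t) (cderiv_cst (- w) t).
    have d2 := cderivM d1 (cderiv_cst (s%:C) t).
    have d3 := cderivD (cderiv_cst w t) d2.
    have d4 := cderivM (cderiv_cst ((s%:C)^-1) t) (cderiv_comp d3 (dF _ (inD s t hs))).
    by apply: cderiv_eq d4 _; field.
  - move=> t _; apply: contcM; last exact: cont_circle'.
    have cA := contcD (contc_cst w t)
      (contcM (contcB (@cont_circle p rho t) (contc_cst w t)) (contc_cst s%:C t)).
    exact: cont_comp cA (cf _ (inD s t hs)).
rewrite (@eq_cint _ (fun y => cint 0 1 (fun x => u (x +i* y)))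
  (fun t => F (circle p rho t) * circle' rho t / (circle p rho t - w) ^+ 1 -
    F w * (circle' rho t / (circle p rho t - w) ^+ 1))); last first.
  move=> t _; rewrite /u /=.
  rewrite (eq_cint (v := fun s => circle' rho t / (circle p rho t - w) *
     (f (w + (circle p rho t - w) * s%:C) * (circle p rho t - w)))); last first.
    by move=> s hs; rewrite (clamp01_id hs); field.
  have cs : cont_itv 0 1 (fun s => f (w + (circle p rho t - w) * s%:C) * (circle p rho t - w)).
    move=> s hs; apply: contcM; last exact: contc_cst.
    exact: cont_comp (cderiv_continuous (cderiv_line _ _ s)) (cf _ (inD s t hs)).
  rewrite cintZ// (cint_ftc ler01 (fun s hs => dl s t hs) cs).
  by rewrite mulr1 mulr0 addr0 [w + _]addrC subrK expr1; field.
have ck : cont_itv 0 (2 * pi) (fun t => circle' rho t / (circle p rho t - w) ^+ 1 : C).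
  apply: cont_itv_kernel => t _; [exact: cont_circle'|exact: cont_circle|].
  by rewrite -subr_eq0.
have cFz : cont_itv 0 (2 * pi) (fun t => F (circle p rho t) * circle' rho t / (circle p rho t - w) ^+ 1 : C).
  apply: cont_itv_kernel => t _; [|exact: cont_circle|by rewrite -subr_eq0].
  apply: contcM; last exact: cont_circle'.
  apply: (cont_comp (@cont_circle p rho t)).
  apply: is_derive_continuous_at; apply: dF.
  by rewrite normc_circle// ltW.
have cFw : cont_itv 0 (2 * pi) (fun t => F w * (circle' rho t / (circle p rho t - w) ^+ 1) : C).
  by move=> t ht; apply: contcM; [exact: contc_cst|exact: ck].
rewrite (cintB cFz cFw) (cintZ _ ck) circle_winding//.
by move=> /esym/eqP; rewrite subr_eq0 => /eqP ->.
Qed.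

End Kernels.

(** * Holomorphic functions: Cauchy's formula, Taylor expansion, zeros, uniform limits *)

Section Holomorphic.
Variable R : realType.
Local Notation C := (cplane R).
Implicit Types (w z p : C) (f g : C -> C) (r rho : R).

Definition cder (f : C -> C) : C -> C := fun z => 'D_1 f z.

Lemma near_disc z p r : normc (z - p) < r -> \forall w \near z, normc (w - p) < r.
Proof.
move=> zr; apply/nbhs_normcP; exists (r - normc (z - p)); first by rewrite subr_gt0.
move=> w wz; have := normc_triangle w p z; lra.
Qed.

Let pi2_ge0 : 0 <= 2 * pi :> R.
Proof. by rewrite mulr_ge0// pi_ge0. Qed.

Let twopii_neq0 : 'i%C * (2 * pi)%:C != 0 :> C.
Proof.
rewrite -normc_gt0 normcM normc_i mul1r normc_real ger0_norm ?pi2_ge0//.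
by rewrite mulr_gt0// pi_gt0.
Qed.

Definition cauchy_density f p rho (t : R) : C :=
  f (circle p rho t) * circle' rho t / ('i%C * (2 * pi)%:C).

Definition cauchy_transform (phi : R -> C) p rho n w : C :=
  cint 0 (2 * pi) (fun t => phi t / (circle p rho t - w) ^+ n).

Lemma cont_on_circle f p rho r : 0 < rho -> rho < r ->
  (forall z, normc (z - p) < r -> {for z, continuous f}) ->
  forall a b, cont_itv a b (fun t => f (circle p rho t)).
Proof.
move=> r0 rr cf a b t _; apply: (cont_comp (@cont_circle R p rho t)).
by apply: cf; rewrite normc_circle// ltW.
Qed.

Lemma cont_cauchy_density f p rho r : 0 < rho -> rho < r ->
  (forall z, normc (z - p) < r -> {for z, continuous f}) ->
  forall a b, cont_itv a b (cauchy_density f p rho).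
Proof.
move=> r0 rr cf a b t ht; apply: contcM; last exact: contc_cst.
by apply: contcM; [exact: (cont_on_circle r0 rr cf ht)|exact: cont_circle'].
Qed.

Lemma circle_neq p rho w t : normc (w - p) < rho -> circle p rho t != w.
Proof.
move=> wr; rewrite -subr_eq0 -normc_gt0.
have rho0 : 0 <= rho by rewrite (le_trans (normc_ge0 _) (ltW wr)).
by apply: lt_le_trans (circle_dist p t w rho0); rewrite subr_gt0.
Qed.

Lemma cauchy_transform_derive phi p rho n w :
  (forall a b, cont_itv a b phi) -> normc (w - p) < rho ->
  is_derive w 1 (cauchy_transform phi p rho n)
    (n%:R * cauchy_transform phi p rho n.+1 w).
Proof.
move=> cp wr; have d0 : 0 < rho - normc (w - p) by rewrite subr_gt0.
have rho0 : 0 <= rho by rewrite (le_trans (normc_ge0 _) (ltW wr)).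
apply: (kernel_derive n pi2_ge0 d0 (cp _ _)).
  by move=> t _; exact: cont_circle.
by move=> t _; exact: circle_dist.
Qed.

Lemma cauchy_formula_C1 f g p r rho w : 0 < rho -> rho < r -> normc (w - p) < rho ->
  (forall z, normc (z - p) < r -> is_derive z 1 f (g z)) ->
  (forall z, normc (z - p) < r -> {for z, continuous g}) ->
  f w = cauchy_transform (cauchy_density f p rho) p rho 1 w.
Proof.
move=> r0 rr wr dF cg; have := cauchy_C1 r0 rr wr dF cg.
have cf z : normc (z - p) < r -> {for z, continuous f}.
  by move=> /dF; exact: is_derive_continuous_at.
have ck : cont_itv 0 (2 * pi)
    (fun t => f (circle p rho t) * circle' rho t / (circle p rho t - w) ^+ 1 : C).
  apply: cont_itv_kernel => t ht; [|exact: cont_circle|exact: circle_neq].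
  by apply: contcM; [exact: (cont_on_circle r0 rr cf ht)|exact: cont_circle'].
move=> E; rewrite /cauchy_transform -[LHS](mulfK twopii_neq0) E mulrC -cintZ//.
by apply: eq_cint => t _; rewrite /cauchy_density; ring.
Qed.

(** Cauchy's formula is so far available only for functions with a continuous derivative, which [f]
    is not known to be. Its primitive [F] is one, with derivative [f]. Differentiating the Cauchy
    integral of [F] under the integral sign represents [f] and then [f'], and the latter integral is
    differentiable again. *)
Lemma derivable_cder_local f p r : 0 < r ->
  (forall z, normc (z - p) < r -> derivable f z 1) -> derivable (cder f) p 1.
Proof.
move=> r0 df.
(* The square of half-side [r / 4] lies inside the disc of radius [r], so [primitive_rect] applies
   to it; it contains the disc of radius [r / 4]. *)
have r4 : 0 < r / 4 by rewrite divr_gt0.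
have [F dF] : exists F, forall z : C, Re p - r / 4 < Re z < Re p + r / 4 ->
    Im p - r / 4 < Im z < Im p + r / 4 -> is_derive z 1 F (f z).
  apply: primitive_rect => z /andP[a1 a2] /andP[b1 b2]; apply: df.
  apply: le_lt_trans (normc_le_ReIm _) _; rewrite ReB ImB.
  have : `|Re z - Re p| <= r / 4 by rewrite ler_norml; apply/andP; split; lra.
  have : `|Im z - Im p| <= r / 4 by rewrite ler_norml; apply/andP; split; lra.
  by lra.
have dF' z : normc (z - p) < r / 4 -> is_derive z 1 F (f z).
  move=> zr; have := Re_le_normc (z - p); have := Im_le_normc (z - p).
  rewrite ReB ImB !ler_norml => /andP[? ?] /andP[? ?].
  by apply: dF; apply/andP; split; lra.
have cf z : normc (z - p) < r / 4 -> {for z, continuous f}.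
  by move=> zr; apply: derivable_continuous_at; apply: df; lra.
have r8 : 0 < r / 8 by rewrite divr_gt0.
have r84 : r / 8 < r / 4 by lra.
set phi := cauchy_density F p (r / 8).
have cphi a b : cont_itv a b phi.
  apply: (cont_cauchy_density r8 r84) => z /dF'; exact: is_derive_continuous_at.
have FE z : normc (z - p) < r / 8 -> F z = cauchy_transform phi p (r / 8) 1 z.
  by move=> zr; exact: cauchy_formula_C1 r8 r84 zr dF' cf.
have fE z : normc (z - p) < r / 8 -> f z = cauchy_transform phi p (r / 8) 2 z.
  move=> zr; have d1 := cauchy_transform_derive 1 cphi zr.
  rewrite mul1r in d1.
  have d2 : is_derive z 1 F (cauchy_transform phi p (r / 8) 2 z).
    by apply: is_derive_near d1; near=> w; rewrite FE//; near: w; exact: near_disc.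
  by have := dF' z ltac:(lra) => /is_derive_val <-; have := is_derive_val d2.
have dfE z : normc (z - p) < r / 8 -> cder f z = 2%:R * cauchy_transform phi p (r / 8) 3 z.
  move=> zr; apply: is_derive_val.
  apply: is_derive_near (cauchy_transform_derive 2 cphi zr).
  by near=> w; rewrite fE//; near: w; exact: near_disc.
have pr : normc (p - p) < r / 8 by rewrite subrr normc0.
have d3 := is_derivecM (is_derivec_cst p (2%:R : C)) (cauchy_transform_derive 3 cphi pr).
apply: (is_derive_derivable (is_derive_near _ d3)).
by near=> w; rewrite dfE//; near: w; exact: near_disc.
Unshelve. all: by end_near. Qed.

Lemma holomorphic_cder (U : set C) f : open U -> holomorphic_on U f ->
  holomorphic_on U (cder f).
Proof.
move=> oU hf z Uz; have [r r0 hr] := open_normcP oU Uz.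
by apply: (derivable_cder_local r0) => w /hr /hf.
Qed.

Lemma open_disc p r : open [set z : C | normc (z - p) < r].
Proof. by apply: normcP_open => z zr; exact/nbhs_normcP/near_disc. Qed.

Lemma holomorphic_is_derive (U : set C) f z : holomorphic_on U f -> U z ->
  is_derive z 1 f (cder f z).
Proof. by move=> hf /hf; exact: derivable_is_derive. Qed.

Lemma holomorphic_continuous (U : set C) f z : holomorphic_on U f -> U z ->
  {for z, continuous f}.
Proof. by move=> hf /hf; exact: derivable_continuous_at. Qed.

Lemma cauchy_formula f p r rho w : 0 < rho -> rho < r -> normc (w - p) < rho ->
  (forall z, normc (z - p) < r -> derivable f z 1) ->
  f w = cauchy_transform (cauchy_density f p rho) p rho 1 w.
Proof.
move=> r0 rr wr df.
have dF z : normc (z - p) < r -> is_derive z 1 f (cder f z).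
  by move=> /df; exact: derivable_is_derive.
have cg z : normc (z - p) < r -> {for z, continuous (cder f)}.
  move=> zr; apply: derivable_continuous_at.
  exact: (holomorphic_cder (@open_disc p r) df).
exact: (cauchy_formula_C1 r0 rr wr dF cg).
Qed.

Lemma iter_cder_cauchy f p r rho n w : 0 < rho -> rho < r ->
  (forall z, normc (z - p) < r -> derivable f z 1) -> normc (w - p) < rho ->
  iter n cder f w = (n`!)%:R * cauchy_transform (cauchy_density f p rho) p rho n.+1 w.
Proof.
move=> r0 rr df; set phi := cauchy_density f p rho.
have cphi a b : cont_itv a b phi.
  by apply: (cont_cauchy_density r0 rr) => z /df; exact: derivable_continuous_at.
elim: n w => [|n IH] w wr; first by rewrite mul1r; exact: cauchy_formula r0 rr wr df.
rewrite iterS; apply: is_derive_val.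
have d := is_derivecM (is_derivec_cst w ((n`!)%:R : C)) (cauchy_transform_derive n.+1 cphi wr).
apply: is_derive_near; last first.
  by apply: is_derive_eq d _; rewrite mul0r add0r mulrA -natrM mulnC -factS.
by near=> v; rewrite IH//; near: v; exact: near_disc.
Unshelve. all: by end_near. Qed.

(** The [m]th remainder is the Cauchy transform, over the circle of radius [r / 2], of the density
    divided by the [m]th power of [zeta - p]. One constant [M] serves for all [m]: this makes a
    comparison of the remainders as [m] grows possible. *)
Theorem taylor f p r : 0 < r ->
  (forall z, normc (z - p) < r -> derivable f z 1) ->
  exists2 M : R, 0 <= M & forall m, exists h : C -> C,
  [/\ forall w, normc (w - p) < r / 2 -> derivable h w 1,
      h p = iter m cder f p / (m`!)%:R,
      forall w, normc (w - p) < r / 2 ->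
        f w = \sum_(k < m) iter k cder f p / (k`!)%:R * (w - p) ^+ k + (w - p) ^+ m * h w &
      forall w, normc (w - p) < r / 4 -> normc (h w) <= M / (r / 2) ^+ m].
Proof.
move=> r0 df; pose rho := r / 2.
have rho0 : 0 < rho by rewrite divr_gt0.
have rr : rho < r by rewrite /rho; lra.
set phi := cauchy_density f p rho.
have cphi a b : cont_itv a b phi.
  by apply: (cont_cauchy_density rho0 rr) => z /df; exact: derivable_continuous_at.
have pp : normc (p - p) < rho by rewrite subrr normc0.
have [M M0 hM] := cont_itv_bounded (cphi 0 (2 * pi)).
pose phim m (t : R) : C := phi t / (circle p rho t - p) ^+ m.
have cphim m a b : cont_itv a b (phim m).
  by apply: cont_itv_kernel => // t _; [exact: cont_circle|exact: circle_neq].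
have cker m w : normc (w - p) < rho -> cont_itv 0 (2 * pi)
    (fun t => phim m t / (circle p rho t - w) ^+ 1 : C).
  move=> wr; apply: cont_itv_kernel => t ht; [exact: cphim ht|exact: cont_circle|exact: circle_neq].
pose h m := cauchy_transform (phim m) p rho 1.
have hp m : h m p = iter m cder f p / (m`!)%:R.
  rewrite (iter_cder_cauchy m rho0 rr df pp) mulrAC mulfV ?mul1r; last first.
    by rewrite pnatr_eq0 -lt0n fact_gt0.
  apply: eq_cint => t _; rewrite /phim /= [in LHS]expr1 exprSr.
  by rewrite invfM mulrA mulrAC.
(* The identity [1 / (zeta - w) = 1 / (zeta - p) + (w - p) / ((zeta - p) * (zeta - w))], integrated
   against the density. *)
have hS m w : normc (w - p) < rho -> h m w = h m p + (w - p) * h m.+1 w.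
  move=> wr; rewrite /h /cauchy_transform -(cintZ _ (cker m.+1 w wr)).
  rewrite -cintD; [|exact: cker|]; last first.
    by move=> t ht; apply: contcM; [exact: contc_cst|exact: cker].
  apply: eq_cint => t _; rewrite /phim !expr1 exprS.
  have z1 : circle p rho t - p != 0 by rewrite subr_eq0 circle_neq.
  have z2 : circle p rho t - w != 0 by rewrite subr_eq0 circle_neq.
  by field; rewrite z2 z1 expf_neq0.
exists (2 * (M * (4 / r) * (2 * pi))).
  by rewrite mulr_ge0// mulr_ge0// mulr_ge0 ?divr_ge0// ltW.
move=> m; exists (h m); split => //.
- move=> w wr; exact: is_derive_derivable (cauchy_transform_derive 1 (cphim m) wr).
- elim: m => [|m IH] w wr.
    rewrite big_ord0 add0r expr0 mul1r (cauchy_formula rho0 rr wr df).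
    by apply: eq_cint => t _; rewrite /phim expr0 divr1.
  by rewrite IH// big_ord_recr/= -addrA -hp (hS m w wr) exprSr; congr (_ + _); ring.
- move=> w wr; have wr' : normc (w - p) < rho by rewrite /rho; lra.
  have r4 : 0 < r / 4 by rewrite divr_gt0.
  have -> : 2 * (M * (4 / r) * (2 * pi)) / (r / 2) ^+ m =
     2 * (M * (4 / r) / rho ^+ m * (2 * pi - 0)) by rewrite subr0 /rho; ring.
  apply: (cint_norm pi2_ge0 (cker m w wr')) => t ht.
  rewrite /phim; move: (phi t) (hM t ht) => x xM.
  rewrite !normcM !normcV !normcX expr1 normc_circle ?(ltW rho0)//.
  rewrite mulrAC ler_pM2r ?invr_gt0 ?exprn_gt0//.
  apply: ler_pM; rewrite ?normc_ge0 ?invr_ge0 ?normc_ge0//.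
  rewrite -[4 / r]invf_div lef_pV2 ?posrE//.
    by apply: le_trans (circle_dist p t w (ltW rho0)); rewrite /rho; lra.
  by rewrite normc_gt0 subr_eq0 circle_neq.
Qed.

(** If all derivatives vanished at [p], then [f] would equal its Taylor remainders; at distance
    [r / 8] these are at most [M / 4 ^+ m], and [f] would vanish there too. *)
Theorem zero_of_finite_order f p r : 0 < r ->
  (forall z, normc (z - p) < r -> derivable f z 1) ->
  (forall z, normc (z - p) < r -> z != p -> f z != 0) ->
  exists m (h : C -> C), [/\ h p != 0,
    forall w, normc (w - p) < r / 2 -> derivable h w 1 &
    forall w, normc (w - p) < r / 2 -> f w = (w - p) ^+ m * h w].
Proof.
move=> r0 df nz; have [M M0 tay] := taylor r0 df.
have [exm|nex] := pselect (exists m, iter m cder f p != 0).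
  case: (ex_minnP exm) => m cm mmin.
  have [h [dh hp hE _]] := tay m; exists m, h; split => //.
    by rewrite hp mulf_neq0// invr_eq0 pnatr_eq0 -lt0n fact_gt0.
  move=> w /hE ->; rewrite big1 ?add0r// => -[k /= km] _.
  suff -> : iter k cder f p = 0 by rewrite mul0r mul0r.
  by apply/eqP/negPn/negP => /mmin; rewrite leqNgt km.
have f0 k : iter k cder f p = 0.
  by apply/eqP/negPn/negP => h; apply: nex; exists k.
pose z := p + (r / 8)%:C.
have zp : normc (z - p) = r / 8 by rewrite /z addrC addKr normc_real ger0_norm// divr_ge0// ltW.
have zr : normc (z - p) < r by rewrite zp; lra.
have fz : f z != 0.
  by apply: nz => //; rewrite -subr_eq0 -normc_eq0 zp gt_eqF// divr_gt0.
have bound m : normc (f z) <= M * 2^-1 ^+ m.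
  have [h [_ _ hE hM]] := tay m.
  rewrite hE ?zp; last by lra.
  rewrite big1 ?add0r => [|k _]; last by rewrite f0 mul0r mul0r.
  rewrite normcM normcX zp; apply: le_trans (ler_wpM2l _ (hM z _)) _.
  - by rewrite exprn_ge0// divr_ge0// ltW.
  - by rewrite zp; lra.
  have -> : (r / 8) ^+ m * (M / (r / 2) ^+ m) = M * (4^-1) ^+ m.
    rewrite mulrCA -expr_div_n; congr (_ * _ ^+ _).
    by field; rewrite gt_eqF.
  apply: ler_wpM2l => //; rewrite lerXn2r ?nnegrE ?invr_ge0//; lra.
have := @cvg_geometric R M 2^-1.
rewrite ger0_norm// invf_lt1// ltr1n => /(_ isT)/cvgrPdist_lt/(_ (normc (f z))).
rewrite normc_gt0 => /(_ fz)[n _ /(_ n (leqnn n))] /=.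
rewrite sub0r normrN => h; have := bound n; rewrite leNgt.
by rewrite (le_lt_trans (ler_norm _) h).
Qed.

(** Integration of [f' - f' p] along the segment from [b] to [a]. An estimate for two moving points
    is what the inversion of a boundary arc requires. *)
Lemma strict_derivative f p r (kappa : R) : 0 < r -> 0 < kappa ->
  (forall z, normc (z - p) < r -> derivable f z 1) ->
  exists2 d : R, 0 < d <= r & forall a b, normc (a - p) < d -> normc (b - p) < d ->
    normc (f a - f b - cder f p * (a - b)) <= kappa * normc (a - b).
Proof.
move=> r0 k0 df; have dc := holomorphic_cder (@open_disc p r) df.
have cc : {for p, continuous (cder f)}.
  by apply: derivable_continuous_at; apply: dc; rewrite /= subrr normc0.
(* Half of [kappa] makes up for the factor [2] of [cint_norm]. *)
have k2 : 0 < kappa / 2 by rewrite divr_gt0.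
have /continuous_normcP/(_ _ k2)[d d0 hd] := cc.
exists (Num.min d r); first by rewrite lt_min d0 r0 ge_min lexx orbT.
move=> a b; rewrite !lt_min => /andP[ad ar] /andP[bd br].
have seg (s t : R) : 0 <= t <= 1 -> normc (a - p) < s -> normc (b - p) < s ->
    normc (b + (a - b) * t%:C - p) < s.
  move=> /andP[t0 t1] h1 h2.
  have -> : b + (a - b) * t%:C - p = (1 - t)%:C * (b - p) + t%:C * (a - p).
    by rewrite rmorphB rmorph1; ring.
  apply: le_lt_trans (le_normcD _ _) _; rewrite !normcM !normc_real.
  rewrite (ger0_norm t0) (@ger0_norm _ (1 - t)) ?subr_ge0//.
  by have [t2|t2] := leP t (1 / 2); nra.
pose u (t : R) : C := (cder f (b + (a - b) * t%:C) - cder f p) * (a - b).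
pose v (t : R) : C := f (b + (a - b) * t%:C) - cder f p * (a - b) * t%:C.
have dv t : 0 <= t <= 1 -> cderiv v t (u t).
  move=> ht; have d1 := cderiv_comp (cderiv_line b (a - b) t)
    (derivable_is_derive (df _ (seg r t ht ar br))).
  have d2 := cderivM (cderiv_cst (- (cder f p * (a - b))) t) (cderiv_real (is_derive_id t 1)).
  have d3 := cderivD d1 d2.
  have -> : v = fun s => f (b + (a - b) * s%:C) + - (cder f p * (a - b)) * s%:C.
    by apply/funext => s; rewrite /v mulNr.
  by apply: cderiv_eq d3 _; rewrite mul0r add0r mulr1; exact: (esym (mulrBl _ _ _)).
have cu : cont_itv 0 1 u.
  move=> t ht; apply: contcM; last exact: contc_cst.
  apply: contcB; last exact: contc_cst.
  apply: (cont_comp (cderiv_continuous (cderiv_line b (a - b) t))).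
  by apply: derivable_continuous_at; apply: dc; exact: seg.
have := cint_ftc ler01 dv cu.
have -> : v 1 - v 0 = f a - f b - cder f p * (a - b).
  by rewrite /v !mulr1 !mulr0 subr0 addr0 [b + _]addrC subrK; ring.
move=> <-; apply: le_trans (cint_norm (M := kappa / 2 * normc (a - b)) ler01 cu _) _.
  move=> t ht; rewrite normcM ler_wpM2r ?normc_ge0// ltW// hd//; exact: seg.
by rewrite subr0 mulr1 mulrA mulrCA divff// mulr1.
Qed.

(** Weierstrass: the limit is continuous, Cauchy's formula passes to it, and a Cauchy integral is
    differentiable. *)
Lemma uniform_limit_derivable (fn : nat -> C -> C) f p r : 0 < r ->
  (forall n z, normc (z - p) < r -> derivable (fn n) z 1) ->
  (forall e : R, 0 < e -> exists n, forall z, normc (z - p) < r -> normc (fn n z - f z) <= e) ->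
  forall z, normc (z - p) < r / 2 -> derivable f z 1.
Proof.
move=> r0 dfn unif.
have cf z : normc (z - p) < r -> {for z, continuous f}.
  move=> zr; apply/continuous_normcP => e e0.
  have e4 : 0 < e / 4 by rewrite divr_gt0.
  have [n hn] := unif _ e4.
  have /continuous_normcP/(_ _ e4)[d d0 hd] := derivable_continuous_at (dfn n z zr).
  have /nbhs_normcP[d1 d10 hd1] := near_disc zr.
  exists (Num.min d d1); first by rewrite lt_min d0.
  move=> w; rewrite lt_min => /andP[/hd h1 /hd1 /hn h2].
  have h3 := hn _ zr; have := normc_triangle (f w) (f z) (fn n w).
  have := normc_triangle (fn n w) (f z) (fn n z).
  by rewrite normcB in h2; lra.
have rho0 : 0 < r / 2 by rewrite divr_gt0.
have rr : r / 2 < r by lra.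
set rho := r / 2 in rho0 rr *.
have cphi a b : cont_itv a b (cauchy_density f p rho) by apply: (cont_cauchy_density rho0 rr) => z; exact: cf.
have fE z : normc (z - p) < rho -> f z = cauchy_transform (cauchy_density f p rho) p rho 1 z.
  move=> zr; apply/eqP; rewrite -subr_eq0 -normc_eq0 eq_le normc_ge0 andbT.
  pose d := rho - normc (z - p).
  have d0 : 0 < d by rewrite subr_gt0.
  (* The size of the Cauchy integral at [z] of a function bounded by [1] on the circle, [d] being a
     lower bound of the distance from [z] to the circle. *)
  pose K := 2 * (rho / (2 * pi) / d * (2 * pi - 0)).
  have pi0 : 0 < 2 * pi :> R by rewrite mulr_gt0// pi_gt0.
  have K0 : 0 <= K.
    by rewrite /K subr0 mulr_ge0// mulr_ge0// divr_ge0 ?(ltW d0)// divr_ge0// ltW.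
  apply/ler_addgt0Pl => e e0; rewrite addr0.
  have e1 : 0 < e / (K + 1) by rewrite divr_gt0// ltr_wpDl.
  have [n hn] := unif _ e1.
  have cfn w : normc (w - p) < r -> {for w, continuous (fn n)}.
    by move=> wr; exact: derivable_continuous_at (dfn n w wr).
  have cphin a b : cont_itv a b (cauchy_density (fn n) p rho).
    by apply: (cont_cauchy_density rho0 rr) => u; exact: cfn.
  have ck g : (forall a b, cont_itv a b (cauchy_density g p rho)) -> cont_itv 0 (2 * pi)
      (fun t => cauchy_density g p rho t / (circle p rho t - z) ^+ 1 : C).
    move=> cg; apply: cont_itv_kernel => t ht; [exact: cg ht|exact: cont_circle|exact: circle_neq].
  have -> : f z - cauchy_transform (cauchy_density f p rho) p rho 1 z =
    (f z - fn n z) + (cauchy_transform (cauchy_density (fn n) p rho) p rho 1 z -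
     cauchy_transform (cauchy_density f p rho) p rho 1 z).
    by rewrite -(cauchy_formula rho0 rr zr (dfn n)); ring.
  rewrite -(cintB (ck _ cphin) (ck _ cphi)).
  have zr' : normc (z - p) < r by apply: lt_trans rr.
  apply: le_trans (le_normcD _ _) _.
  have h1 : normc (f z - fn n z) <= e / (K + 1) by rewrite normcB; exact: hn.
  have h2 : normc (cint 0 (2 * pi) (fun t : R =>
      cauchy_density (fn n) p rho t / (circle p rho t - z) ^+ 1 -
      cauchy_density f p rho t / (circle p rho t - z) ^+ 1)) <=
      2 * (e / (K + 1) * rho / (2 * pi) / d * (2 * pi - 0)).
    apply: (cint_norm pi2_ge0).
      by move=> t ht; exact: cvgcB (ck _ cphin t ht) (ck _ cphi t ht).
    move=> t ht; rewrite -mulrBl /cauchy_density -!mulrBl !normcM !normcV !normcM.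
    rewrite normc_i !normc_real normc_expi mul1r mulr1 expr1 mul1r.
    rewrite (ger0_norm (ltW rho0)) (ger0_norm pi2_ge0).
    apply: ler_pM; rewrite ?invr_ge0 ?normc_ge0//.
    - by rewrite !mulr_ge0 ?invr_ge0 ?normc_ge0// ltW.
    - rewrite ler_pM2r ?invr_gt0// ler_pM2r//; apply: hn.
      by rewrite normc_circle// ltW.
    - rewrite lef_pV2 ?posrE//; first exact: circle_dist (ltW rho0).
      by rewrite normc_gt0 subr_eq0 circle_neq.
  apply: le_trans (lerD h1 h2) _.
  have -> : e / (K + 1) + 2 * (e / (K + 1) * rho / (2 * pi) / d * (2 * pi - 0)) =
     e / (K + 1) * (1 + K) by rewrite /K; ring.
  by rewrite [1 + K]addrC divfK// gt_eqF// ltr_wpDl.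
move=> z zr; apply: (is_derive_derivable (is_derive_near _ (cauchy_transform_derive 1 cphi zr))).
by near=> w; rewrite -fE//; near: w; exact: near_disc.
Unshelve. all: by end_near. Qed.

End Holomorphic.

(** * Partial derivatives of complex functions of two real variables *)

Section PartialDerivatives.
Variable R : realType.
Local Notation C := (cplane R).
Implicit Types (z a b : C) (V W : C -> C).

Definition pderiv V z a b :=
  cderiv (fun t => V (t +i* Im z)) (Re z) a /\
  cderiv (fun t => V (Re z +i* t)) (Im z) b.

Lemma complex_eta z : Re z +i* Im z = z. Proof. by case: z. Qed.

Lemma near_horizontal z (Q : set C) : (\forall w \near z, Q w) ->
  \forall t \near Re z, Q (t +i* Im z).
Proof.
move=> /nbhs_normcP[r r0 h]; apply/nbhs_ballP; exists r => //= t; rewrite /ball/= => tr.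
apply: h; apply: le_lt_trans (normc_le_ReIm _) _.
by rewrite ReB ImB /= subrr normr0 addr0 distrC.
Qed.

Lemma near_vertical z (Q : set C) : (\forall w \near z, Q w) ->
  \forall t \near Im z, Q (Re z +i* t).
Proof.
move=> /nbhs_normcP[r r0 h]; apply/nbhs_ballP; exists r => //= t; rewrite /ball/= => tr.
apply: h; apply: le_lt_trans (normc_le_ReIm _) _.
by rewrite ReB ImB /= subrr normr0 add0r distrC.
Qed.

Lemma pderiv_eq V z a b a' b' : pderiv V z a b -> a = a' -> b = b' -> pderiv V z a' b'.
Proof. by move=> h <- <-. Qed.

Lemma pderiv_near V W z a b : (\forall w \near z, V w = W w) ->
  pderiv V z a b -> pderiv W z a b.
Proof.
move=> VW [h1 h2]; split.
  exact: cderiv_near (near_horizontal VW) h1.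
exact: cderiv_near (near_vertical VW) h2.
Qed.

Lemma pderivM V W z a b a' b' : pderiv V z a b -> pderiv W z a' b' ->
  pderiv (fun w => V w * W w : C) z (a * W z + V z * a') (b * W z + V z * b').
Proof.
move=> [h1 h2] [h3 h4]; split; [have := cderivM h1 h3|have := cderivM h2 h4];
  by rewrite complex_eta.
Qed.

Lemma pderivD V W z a b a' b' : pderiv V z a b -> pderiv W z a' b' ->
  pderiv (fun w => V w + W w : C) z (a + a') (b + b').
Proof. by move=> [h1 h2] [h3 h4]; split; apply: cderivD. Qed.

Lemma pderiv_cst (c : C) z : pderiv (fun=> c) z 0 0.
Proof. by split; exact: cderiv_cst. Qed.

Lemma pderiv_conj V z a b : pderiv V z a b ->
  pderiv (fun w => ((V w)^*)%C : C) z (a^*)%C (b^*)%C.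
Proof. by move=> [h1 h2]; split; exact: cderiv_conj. Qed.

Lemma pderiv_holomorphic V z a : is_derive z 1 V a -> pderiv V z a ('i%C * a).
Proof.
rewrite -{1}(complex_eta z) => h; split.
  by have := cderiv_comp (cderiv_horizontal (Im z) (Re z)) h; rewrite mulr1.
by have := cderiv_comp (cderiv_vertical (Re z) (Im z)) h; rewrite mulrC.
Qed.

Lemma pderiv_real_comp (phi : R -> R) V z a b (d : R) : pderiv V z a b ->
  is_derive (Re (V z)) 1 phi d ->
  pderiv (fun w => (phi (Re (V w)))%:C : C) z ((d * Re a)%:C) ((d * Re b)%:C).
Proof.
rewrite -{2}(complex_eta z) => -[[h1 _] [h2 _]] hp.
have d1 := is_derive1_comp hp h1; have d2 := is_derive1_comp hp h2.
by split; [exact: (cderiv_real d1)|exact: (cderiv_real d2)].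
Qed.

Lemma cderiv_unique (u : R -> C) t (v w : C) : cderiv u t v -> cderiv u t w -> v = w.
Proof.
move=> [[_ h1] [_ h2]] [[_ h3] [_ h4]].
by rewrite -(complex_eta v) -(complex_eta w) -h1 -h2 -h3 -h4.
Qed.

Lemma pderiv_near0 V z a b : (\forall w \near z, V w = 0) -> pderiv V z a b ->
  a = 0 /\ b = 0.
Proof.
move=> V0 h; have := pderiv_near V0 h => -[h1 h2].
by have [h3 h4] := pderiv_cst 0 z; split; [exact: cderiv_unique h1 h3|exact: cderiv_unique h2 h4].
Qed.

End PartialDerivatives.

(** * Complex area integrals and Stokes' formula with compact support *)

Section ComplexAreaIntegral.
Variable R : realType.
Local Notation C := (cplane R).
Local Notation mu := (@lebesgue_measure R).
Implicit Types (A U K : set C) (f g : C -> C).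

Definition cintegrable A f :=
  (area R).-integrable (plane_set A) (EFin \o on_plane (fun z => Re (f z))) /\
  (area R).-integrable (plane_set A) (EFin \o on_plane (fun z => Im (f z))).

(** Integrals over varying open sets become integrals over the plane, where a continuous function
    with compact support in the open set stays continuous. *)
Definition zext (T : zmodType) A (f : C -> T) : C -> T :=
  fun z => if z \in A then f z else 0.

Lemma zextT (T : zmodType) A (f : C -> T) z : A z -> zext A f z = f z.
Proof. by move=> h; rewrite /zext mem_set. Qed.

Lemma zextN (T : zmodType) A (f : C -> T) z : ~ A z -> zext A f z = 0.
Proof. by move=> h; rewrite /zext memNset. Qed.

Lemma Re_zext A f : (fun z => Re (zext A f z)) = zext A (fun z => Re (f z)).
Proof. by apply/funext => z; rewrite /zext; case: ifP. Qed.

Lemma Im_zext A f : (fun z => Im (zext A f z)) = zext A (fun z => Im (f z)).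
Proof. by apply/funext => z; rewrite /zext; case: ifP. Qed.

Lemma on_plane_zext A (f : C -> R) : on_plane (zext A f) = (on_plane f) \_ (plane_set A).
Proof.
apply/funext => p; rewrite /on_plane /zext /patch.
by have [h|h] := pselect (A (p.1 +i* p.2)); [rewrite !mem_set|rewrite !memNset].
Qed.

Lemma area_integral_zext A f : area_integral setT (zext A f) = area_integral A f.
Proof.
rewrite /area_integral; congr (_ +i* _).
  have -> : (fun p : measurableTypeR R * measurableTypeR R => Re (zext A f (p.1 +i* p.2)))
     = on_plane (fun z => Re (zext A f z)) by [].
  by rewrite Re_zext on_plane_zext [RHS]Rintegral_mkcond.
have -> : (fun p : measurableTypeR R * measurableTypeR R => Im (zext A f (p.1 +i* p.2)))
   = on_plane (fun z => Im (zext A f z)) by [].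
by rewrite Im_zext on_plane_zext [RHS]Rintegral_mkcond.
Qed.

Lemma integrable_zext A (f : C -> R) : measurable (plane_set A) ->
  (area R).-integrable (plane_set A) (EFin \o on_plane f) <->
  (area R).-integrable setT (EFin \o on_plane (zext A f)).
Proof.
move=> mA; rewrite on_plane_zext; rewrite (integrable_mkcond _ mA).
by rewrite restrict_EFin.
Qed.

Lemma cintegrable_zext A f : measurable (plane_set A) ->
  cintegrable A f <-> cintegrable setT (zext A f).
Proof.
move=> mA; rewrite /cintegrable Re_zext Im_zext.
by rewrite !(integrable_zext _ mA).
Qed.

Lemma area_integralD A f g : measurable (plane_set A) -> cintegrable A f ->
  cintegrable A g ->
  area_integral A (fun z => f z + g z) = area_integral A f + area_integral A g.
Proof.
move=> mA [f1 f2] [g1 g2]; rewrite /area_integral.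
under eq_Rintegral do rewrite ReD.
under [X in _ +i* X]eq_Rintegral do rewrite ImD.
by rewrite !RintegralD.
Qed.

Lemma cintegrableD A f g : measurable (plane_set A) -> cintegrable A f ->
  cintegrable A g -> cintegrable A (fun z => f z + g z).
Proof.
move=> mA [f1 f2] [g1 g2]; split.
  have -> : EFin \o on_plane (fun z => Re (f z + g z)) =
     ((EFin \o on_plane (fun z => Re (f z))) \+ (EFin \o on_plane (fun z => Re (g z))))%E.
    by apply/funext => p /=; rewrite /on_plane ReD EFinD.
  exact: integrableD.
have -> : EFin \o on_plane (fun z => Im (f z + g z)) =
   ((EFin \o on_plane (fun z => Im (f z))) \+ (EFin \o on_plane (fun z => Im (g z))))%E.
  by apply/funext => p /=; rewrite /on_plane ImD EFinD.
exact: integrableD.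
Qed.

Lemma integrable_lin A (u v : C -> R) (a b : R) : measurable (plane_set A) ->
  (area R).-integrable (plane_set A) (EFin \o on_plane u) ->
  (area R).-integrable (plane_set A) (EFin \o on_plane v) ->
  (area R).-integrable (plane_set A) (EFin \o on_plane (fun z => a * u z + b * v z)).
Proof.
move=> mA iu iv.
have -> : EFin \o on_plane (fun z => a * u z + b * v z) =
   ((fun p => a%:E * (EFin \o on_plane u) p) \+ (fun p => b%:E * (EFin \o on_plane v) p))%E.
  by apply/funext => p /=; rewrite /on_plane EFinD !EFinM.
by apply: integrableD => //; apply: integrableZl.
Qed.

Lemma Rintegral_lin A (u v : C -> R) (a b : R) : measurable (plane_set A) ->
  (area R).-integrable (plane_set A) (EFin \o on_plane u) ->
  (area R).-integrable (plane_set A) (EFin \o on_plane v) ->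
  Rintegral (area R) (plane_set A) (on_plane (fun z => a * u z + b * v z)) =
  a * Rintegral (area R) (plane_set A) (on_plane u) +
  b * Rintegral (area R) (plane_set A) (on_plane v).
Proof.
move=> mA iu iv; rewrite /on_plane RintegralD//.
- by rewrite !RintegralZl.
- by apply: (integrableZl mA a iu).
- by apply: (integrableZl mA b iv).
Qed.

Lemma cintegrableZ A f (c : C) : measurable (plane_set A) -> cintegrable A f ->
  cintegrable A (fun z => c * f z).
Proof.
move=> mA [f1 f2]; split.
  have -> : (fun z => Re (c * f z)) = (fun z => Re c * Re (f z) + (- Im c) * Im (f z)).
    by apply/funext => z; rewrite ReM mulNr.
  exact: integrable_lin.
have -> : (fun z => Im (c * f z)) = (fun z => Im c * Re (f z) + Re c * Im (f z)).
  by apply/funext => z; rewrite ImM addrC.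
exact: integrable_lin.
Qed.

Lemma area_integralZ A f (c : C) : measurable (plane_set A) -> cintegrable A f ->
  area_integral A (fun z => c * f z) = c * area_integral A f.
Proof.
move=> mA [f1 f2]; rewrite /area_integral.
have e1 := Rintegral_lin (Re c) (- Im c) mA f1 f2.
have e2 := Rintegral_lin (Im c) (Re c) mA f1 f2.
have -> : (fun p : measurableTypeR R * measurableTypeR R => Re (c * f (p.1 +i* p.2))) =
    on_plane (fun z => Re c * Re (f z) + (- Im c) * Im (f z)).
  by apply/funext => z; rewrite /on_plane ReM mulNr.
have -> : (fun p : measurableTypeR R * measurableTypeR R => Im (c * f (p.1 +i* p.2))) =
    on_plane (fun z => Im c * Re (f z) + Re c * Im (f z)).
  by apply/funext => z; rewrite /on_plane ImM addrC.
rewrite e1 e2; apply/eqP; rewrite eq_complex ReM ImM /=.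
by rewrite mulNr !eqxx /= addrC.
Qed.

Lemma eq_area_integral A f g : (forall z, A z -> f z = g z) ->
  area_integral A f = area_integral A g.
Proof.
move=> h; rewrite /area_integral; congr (_ +i* _); apply: eq_Rintegral => p;
  by rewrite inE => /h ->.
Qed.

Lemma measurable_plane_setT : measurable (plane_set (setT : set C)).
Proof. by rewrite (_ : plane_set _ = setT). Qed.

Lemma compact_in_box K : compact K -> exists2 M : R, 0 < M & K `<=` box_set (- M) M (- M) M.
Proof.
move=> cK; have [M M0 h] := compact_continuous_bounded cK (fun z _ => @cvg_id C (nbhs z)).
exists M => // z /h zM; split; rewrite -ler_norml; apply: le_trans zM.
  exact: Re_le_normc.
exact: Im_le_normc.
Qed.

Lemma closed_compactC K : compact K -> closed K.
Proof. by apply: compact_closed; exact: norm_hausdorff. Qed.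

Lemma near_notin_compact K z : compact K -> ~ K z -> \forall w \near z, ~ K w.
Proof.
move=> cK Kz; have oK : open (~` K) by apply: closed_openC; exact: closed_compactC.
by apply: open_nbhs_nbhs.
Qed.

Lemma near_zext (T : zmodType) U (f : C -> T) z : open U -> U z ->
  \forall w \near z, f w = zext U f w.
Proof.
move=> oU Uz; have : nbhs z U by exact: open_nbhs_nbhs.
by apply: filterS => w Uw; rewrite zextT.
Qed.

Lemma near_zext0 (T : zmodType) U K (f : C -> T) z : compact K -> ~ K z ->
  (forall w, U w -> ~ K w -> f w = 0) -> \forall w \near z, zext U f w = 0.
Proof.
move=> cK Kz f0; apply: filterS (near_notin_compact cK Kz) => w Kw.
by rewrite /zext; case: ifPn => //; rewrite inE => /f0 -> .
Qed.

Lemma cont_zext U K f z : open U -> compact K -> K `<=` U ->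
  (forall w, U w -> {for w, continuous f}) ->
  (forall w, U w -> ~ K w -> f w = 0) -> {for z, continuous (zext U f)}.
Proof.
move=> oU cK KU cf f0; have [Uz|nUz] := pselect (U z).
  have h := near_zext f oU Uz; have := cf z Uz.
  rewrite /prop_for /continuous_at (zextT f Uz) => c.
  exact: cvg_trans (near_eq_cvg h) c.
have h := near_zext0 cK (fun Kz => nUz (KU _ Kz)) f0.
rewrite /prop_for /continuous_at (zextN f nUz).
apply/(@cvg_normcP R C (nbhs z)) => e e0; apply: filterS h => w ->.
by rewrite subrr normc0.
Qed.

Lemma integrable_compact_support (f : C -> R) K :
  (forall z, {for z, continuous f}) -> compact K -> (forall z, ~ K z -> f z = 0) ->
  (area R).-integrable setT (EFin \o on_plane f).
Proof.
move=> cf cK f0; have [M M0 hM] := compact_in_box cK.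
have := @integrable_box R f (- M) M (- M) M cf.
rewrite (integrable_zext _ (plane_box_measurable _ _ _ _)).
suff -> : zext (box_set (- M) M (- M) M) f = f by [].
apply/funext => z; rewrite /zext; case: ifPn => //; rewrite notin_setE => nz.
by rewrite f0// => /hM.
Qed.

Lemma cintegrable_zext_compact U K f : open U -> compact K -> K `<=` U ->
  (forall w, U w -> {for w, continuous f}) ->
  (forall w, U w -> ~ K w -> f w = 0) -> cintegrable setT (zext U f).
Proof.
move=> oU cK KU cf f0.
have c z := cont_zext (z := z) oU cK KU cf f0.
have h z : ~ K z -> zext U f z = 0.
  by move=> Kz; rewrite /zext; case: ifPn => //; rewrite inE => /f0 ->.
split; apply: (integrable_compact_support _ cK).
- by move=> z; exact: contc_Re (c z).
- by move=> z /h ->.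
- by move=> z; exact: contc_Im (c z).
- by move=> z /h ->.
Qed.

(** Fubini's theorem is used in the order that integrates each partial derivative first along its
    own variable: the inner integral is a difference of values of [V] outside its support. *)
Lemma Stokes_box (V A B : C -> C) (M : R) : 0 < M ->
  (forall z, pderiv V z (A z) (B z)) ->
  (forall z, {for z, continuous A}) -> (forall z, {for z, continuous B}) ->
  (forall z, V z != 0 -> box_set (- M) M (- M) M z) ->
  area_integral setT A = 0 /\ area_integral setT B = 0.
Proof.
move=> M0 dV cA cB V0.
(* The margin puts the edges of the larger box strictly outside the support, so that [V] vanishes on
   them. *)
pose N := M + 1.
have NN : - N <= N by rewrite /N; lra.
have V0' z : ~ box_set (- M) M (- M) M z -> V z = 0.
  by move=> h; apply/eqP; apply: contra_notT h; exact: V0.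
have nb z : ~ box_set (- M) M (- M) M z -> \forall w \near z, V w = 0.
  move=> h; apply: filterS (near_notin_compact (compact_box (a:=_) (b:=_) (c:=_) (d:=_)) h) => w.
  exact: V0'.
have MN z : box_set (- M) M (- M) M z -> box_set (- N) N (- N) N z.
  by move=> [/andP[? ?] /andP[? ?]]; split; rewrite /N; apply/andP; split; lra.
have A0 z : A z != 0 -> box_set (- N) N (- N) N z.
  by apply: contra_neqP => h; have [-> _] := pderiv_near0 (nb z (fun k => h (MN _ k))) (dV z).
have B0 z : B z != 0 -> box_set (- N) N (- N) N z.
  by apply: contra_neqP => h; have [_ ->] := pderiv_near0 (nb z (fun k => h (MN _ k))) (dV z).
have edge (z : C) : `|Re z| = N \/ `|Im z| = N -> V z = 0.
  move=> h; apply: V0' => -[]; rewrite -!ler_norml => h1 h2.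
  by case: h => h3; move: h1 h2; rewrite h3 /N; lra.
have N0 : `|N| = N by rewrite ger0_norm// /N; lra.
have NN0 : `|- N| = N by rewrite normrN.
have hx (y : R) : cint (- N) N (fun x => A (x +i* y)) = 0.
  rewrite (@cint_ftc _ _ (fun x => V (x +i* y)))//.
  - by rewrite !edge ?subrr//=; left.
  - by move=> t _; have [+ _] := dV (t +i* y).
  - move=> t _; exact: cont_comp (cderiv_continuous (cderiv_horizontal y t)) (cA _).
have hy (x : R) : cint (- N) N (fun y => B (x +i* y)) = 0.
  rewrite (@cint_ftc _ _ (fun y => V (x +i* y)))//.
  - by rewrite !edge ?subrr//=; right.
  - by move=> t _; have [_ +] := dV (x +i* t).
  - move=> t _; exact: cont_comp (cderiv_continuous (cderiv_vertical x t)) (cB _).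
have hxR (y : R) : \int[mu]_(x in `[(- N), N]) Re (A (x +i* y)) = 0.
  exact: (congr1 (@complex.Re R) (hx y)).
have hxI (y : R) : \int[mu]_(x in `[(- N), N]) Im (A (x +i* y)) = 0.
  exact: (congr1 (@complex.Im R) (hx y)).
have hyR (x : R) : \int[mu]_(y in `[(- N), N]) Re (B (x +i* y)) = 0.
  exact: (congr1 (@complex.Re R) (hy x)).
have hyI (x : R) : \int[mu]_(y in `[(- N), N]) Im (B (x +i* y)) = 0.
  exact: (congr1 (@complex.Im R) (hy x)).
have cint0 : \int[mu]_(x in `[(- N), N]) (0 : R) = 0.
  by rewrite Rintegral_itv_cst// mul0r.
have [A1 A2] : Rintegral (area R) setT (on_plane (fun z => Re (A z))) = 0 /\
    Rintegral (area R) setT (on_plane (fun z => Im (A z))) = 0.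
  split; rewrite (@area_integral_box_support R _ (- N) N (- N) N).
  - have [_ ->] := area_box_iterated NN NN (fun z => contc_Re (cA z)).
    by under eq_Rintegral => y _ do rewrite hxR.
  - by move=> z; apply: contra_neqP => h; apply/eqP/negPn/negP => h2; apply: h; apply: A0;
      apply: contraNneq h2 => ->.
  - have [_ ->] := area_box_iterated NN NN (fun z => contc_Im (cA z)).
    by under eq_Rintegral => y _ do rewrite hxI.
  - by move=> z; apply: contra_neqP => h; apply/eqP/negPn/negP => h2; apply: h; apply: A0;
      apply: contraNneq h2 => ->.
have [B1 B2] : Rintegral (area R) setT (on_plane (fun z => Re (B z))) = 0 /\
    Rintegral (area R) setT (on_plane (fun z => Im (B z))) = 0.
  split; rewrite (@area_integral_box_support R _ (- N) N (- N) N).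
  - have [-> _] := area_box_iterated NN NN (fun z => contc_Re (cB z)).
    by under eq_Rintegral => y _ do rewrite hyR.
  - by move=> z; apply: contra_neqP => h; apply/eqP/negPn/negP => h2; apply: h; apply: B0;
      apply: contraNneq h2 => ->.
  - have [-> _] := area_box_iterated NN NN (fun z => contc_Im (cB z)).
    by under eq_Rintegral => y _ do rewrite hyI.
  - by move=> z; apply: contra_neqP => h; apply/eqP/negPn/negP => h2; apply: h; apply: B0;
      apply: contraNneq h2 => ->.
rewrite /area_integral; have -> : plane_set (setT : set C) = setT by [].
by split; apply/eqP; rewrite eq_complex /=; apply/andP; split; apply/eqP.
Qed.

(** [A + i B] is twice the derivative of [V] in the conjugate variable, which is [0] for a
    holomorphic factor. All applications below multiply a cutoff by such factors. *)
Theorem Stokes_compact U K (V A B : C -> C) : open U -> compact K -> K `<=` U ->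
  (forall z, U z -> pderiv V z (A z) (B z)) ->
  (forall z, U z -> {for z, continuous A}) ->
  (forall z, U z -> {for z, continuous B}) ->
  (forall z, U z -> ~ K z -> V z = 0) ->
  area_integral U (fun z => A z + 'i%C * B z) = 0 /\
  (forall z, U z -> ~ K z -> A z = 0 /\ B z = 0).
Proof.
move=> oU cK KU dV cA cB V0.
have AB0 z : U z -> ~ K z -> A z = 0 /\ B z = 0.
  move=> Uz Kz; apply: (pderiv_near0 _ (dV z Uz)).
  have h1 : nbhs z U by exact: open_nbhs_nbhs.
  have h2 := near_notin_compact cK Kz.
  near=> w; apply: V0; by near: w.
split => //.
have A0 z : U z -> ~ K z -> A z = 0 by move=> h1 h2; have [] := AB0 z h1 h2.
have B0 z : U z -> ~ K z -> B z = 0 by move=> h1 h2; have [] := AB0 z h1 h2.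
have [M M0 hM] := compact_in_box cK.
have dVe z : pderiv (zext U V) z (zext U A z) (zext U B z).
  have [Uz|nUz] := pselect (U z).
    rewrite !zextT//; apply: pderiv_near (dV z Uz); exact: near_zext.
  rewrite !zextN//; apply: pderiv_near (pderiv_cst 0 z).
  have := near_zext0 cK (fun Kz => nUz (KU _ Kz)) V0.
  by apply: filterS => w ->.
have [] := Stokes_box M0 dVe (fun z => cont_zext (z := z) oU cK KU cA A0)
  (fun z => cont_zext (z := z) oU cK KU cB B0) _.
  move=> z; apply: contra_neqP => nz.
  by rewrite /zext; case: ifPn => //; rewrite inE => /V0; apply => /hM.
rewrite !area_integral_zext => e1 e2.
have mU := open_plane_measurable oU.
have iA : cintegrable U A by apply/(cintegrable_zext _ mU); exact: cintegrable_zext_compact A0.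
have iB : cintegrable U B by apply/(cintegrable_zext _ mU); exact: cintegrable_zext_compact B0.
rewrite area_integralD//; last exact: cintegrableZ.
by rewrite area_integralZ// e1 e2 mulr0 addr0.
Unshelve. all: by end_near. Qed.

End ComplexAreaIntegral.

(** * Limits under the area integral and a negligible set *)

Section Limits.
Variable R : realType.
Local Notation C := (cplane R).
Local Notation mu := (@lebesgue_measure R).
Implicit Types (U N : set C).

Definition cmeasurable (f : C -> C) :=
  measurable_fun setT (on_plane (fun z => Re (f z))) /\
  measurable_fun setT (on_plane (fun z => Im (f z))).

Lemma measurable_zext U (f : C -> R) : open U ->
  (forall z, U z -> {for z, continuous f}) ->
  measurable_fun setT (on_plane (zext U f)).
Proof.
move=> oU cf; rewrite on_plane_zext.
apply/(measurable_restrictT _ (open_plane_measurable oU)).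
exact: measurable_on_plane.
Qed.

Lemma cmeasurable_zext U (f : C -> C) : open U ->
  (forall z, U z -> {for z, continuous f}) -> cmeasurable (zext U f).
Proof.
move=> oU cf; rewrite /cmeasurable Re_zext Im_zext.
by split; apply: measurable_zext => // z /cf; [exact: contc_Re|exact: contc_Im].
Qed.

Lemma Rintegral_dominated (fn : nat -> C -> R) (f g : C -> R) N :
  (forall n, measurable_fun setT (on_plane (fn n))) ->
  measurable_fun setT (on_plane f) ->
  (area R).-negligible (plane_set N) ->
  (forall z, ~ N z -> fn n z @[n --> \oo] --> f z) ->
  (area R).-integrable setT (EFin \o on_plane g) ->
  (forall n z, `|fn n z| <= g z) ->
  (area R).-integrable setT (EFin \o on_plane f) /\
  Rintegral (area R) setT (on_plane (fn n)) @[n --> \oo] -->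
    Rintegral (area R) setT (on_plane f).
Proof.
move=> mfn mf nN cfn ig fg.
have [| | | | |if_ _ cv] := @dominated_convergence _ _ R (area R) setT measurableT
  (fun n => EFin \o on_plane (fn n)) (EFin \o on_plane f) (EFin \o on_plane g).
- by move=> n; exact/measurable_EFinP.
- exact/measurable_EFinP.
- apply: negligibleS nN => p /= h; rewrite /plane_set /=.
  apply: contrapT => Np; apply: h => _.
  apply: cvg_EFin; first by near=> n.
  exact: cfn.
- exact: ig.
- by apply: aeW => p n _; rewrite /= lee_fin; exact: fg.
split => //; rewrite /Rintegral; apply: fine_cvg.
rewrite fineK; first exact: cv.
by apply: integrable_fin_num.
Unshelve. all: by end_near. Qed.

Lemma area_integral_dominated (fn : nat -> C -> C) (f : C -> C) (g : C -> R) N :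
  (forall n, cmeasurable (fn n)) -> cmeasurable f ->
  (area R).-negligible (plane_set N) ->
  (forall z, ~ N z -> fn n z @[n --> \oo] --> f z) ->
  (area R).-integrable setT (EFin \o on_plane g) ->
  (forall n z, normc (fn n z) <= g z) ->
  cintegrable setT f /\
  (area_integral setT (fn n) : C) @[n --> \oo] --> (area_integral setT f : C).
Proof.
move=> mfn [mf1 mf2] nN cfn ig fg.
have [i1 c1] := Rintegral_dominated (fun n => (mfn n).1) mf1 nN
  (fun z h => cvg_Re (cfn z h)) ig (fun n z => le_trans (Re_le_normc _) (fg n z)).
have [i2 c2] := Rintegral_dominated (fun n => (mfn n).2) mf2 nN
  (fun z h => cvg_Im (cfn z h)) ig (fun n z => le_trans (Im_le_normc _) (fg n z)).
split; first by split.
by apply: cvg_complex; [exact: c1|exact: c2].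
Qed.

Lemma Rintegral_Fatou (fn : nat -> C -> R) (f : C -> R) (M : R) :
  (forall n, measurable_fun setT (on_plane (fn n))) ->
  measurable_fun setT (on_plane f) ->
  (forall n z, 0 <= fn n z) -> (forall z, 0 <= f z) ->
  (forall n, (area R).-integrable setT (EFin \o on_plane (fn n))) ->
  (forall n, Rintegral (area R) setT (on_plane (fn n)) <= M) ->
  (forall z, fn n z @[n --> \oo] --> f z) ->
  (area R).-integrable setT (EFin \o on_plane f).
Proof.
move=> mfn mf fn0 f0 ifn fM cv.
apply/integrableP; split; first exact/measurable_EFinP.
have := @fatou _ _ R (area R) setT measurableT (fun n => EFin \o on_plane (fn n)).
have h1 n : measurable_fun setT (EFin \o on_plane (fn n)) by exact/measurable_EFinP.
have h2 n (p : measurableTypeR R * measurableTypeR R) : setT p ->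
  (0 <= (EFin \o on_plane (fn n)) p)%E by move=> _; rewrite /= lee_fin; exact: fn0.
move=> /(_ h1 h2) F.
apply: (@le_lt_trans _ _ M%:E); last exact: ltry.
have -> : (\int[area R]_x `|(EFin \o on_plane f) x|)%E =
    (\int[area R]_x limn_einf (fun n => (EFin \o on_plane (fn n)) x))%E.
  apply: eq_integral => p _; rewrite gee0_abs; last by rewrite /= lee_fin; exact: f0.
  have c : (on_plane (fn n) p)%:E @[n --> \oo] --> (on_plane f p)%:E.
    apply: cvg_EFin; first by near=> n.
    exact: cv.
  rewrite is_cvg_limn_einfE; first by apply/esym/cvg_lim.
  by apply/cvg_ex; eexists; exact: c.
apply: le_trans F _; rewrite limn_einf_lim.
apply: lime_le; first exact: is_cvg_einfs.
near=> n; rewrite /einfs; apply: ereal_inf_le.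
exists (\int[area R]_x (EFin \o on_plane (fn n)) x)%E; first by exists n => //=.
rewrite -(@fineK _ (\int[area R]_x (EFin \o on_plane (fn n)) x)%E) ?lee_fin ?fM//.
by apply: integrable_fin_num.
Unshelve. all: by end_near. Qed.

(** Each point is alone in some interval with rational ends, and the pair of ends determines the
    point. *)
Lemma countable_isolated (S : set R) :
  (forall s, S s -> exists2 r : R, 0 < r & forall t, S t -> `|t - s| < r -> t = s) ->
  countable S.
Proof.
move=> iso.
have pick (s : R) : exists q : rat * rat, S s ->
    [/\ ratr q.1 < s, s < ratr q.2 & forall t, S t -> ratr q.1 < t < ratr q.2 -> t = s].
  have [Ss|nS] := pselect (S s); last by exists (0, 0).
  have [r r0 hr] := iso s Ss.
  have lt1 : s - r < s by rewrite ltrBlDr ltrDl.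
  have lt2 : s < s + r by rewrite ltrDl.
  have [q1 h1] := rat_in_itvoo lt1; have [q2 h2] := rat_in_itvoo lt2.
  rewrite !in_itv/= in h1 h2; move: h1 h2 => /andP[a1 a2] /andP[b1 b2].
  exists (q1, q2) => _; split => //= t St /andP[c1 c2]; apply: hr => //.
  by rewrite ltr_norml; apply/andP; split; lra.
have [q hq] := choice pick.
apply/countable_injP; exists (fun s => pickle (q s)) => s t; rewrite !inE => Ss St.
move=> /(pcan_inj pickleK) e; have [h1 h2 h3] := hq s Ss; have [k1 k2 k3] := hq t St.
by apply: k3 => //; rewrite -e h1.
Qed.

Lemma mem_xsectionE (T1 T2 : Type) (A : set (T1 * T2)) x y : xsection A x y -> A (x, y).
Proof. by rewrite /xsection /= inE. Qed.

Lemma mem_ysectionE (T1 T2 : Type) (A : set (T1 * T2)) x y : ysection A y x -> A (x, y).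
Proof. by rewrite /ysection /= inE. Qed.

Lemma is_derive_isolated_zero (f : R -> R) (t d : R) : is_derive t 1 f d -> d != 0 -> f t = 0 ->
  exists2 r : R, 0 < r & forall s, f s = 0 -> `|s - t| < r -> s = t.
Proof.
move=> /is_derive_realP h d0 ft.
have d2 : 0 < `|d| / 2 by rewrite divr_gt0// normr_gt0.
have [r r0 hr] := h _ d2; exists r => // s fs /hr.
rewrite fs ft subrr sub0r normrN normrM => k.
apply/eqP; rewrite -subr_eq0 -normr_eq0; apply/eqP.
have := normr_ge0 (s - t); move: k; set x := `|s - t|; nra.
Qed.

(* On the zero set of [Re P] the derivatives [dtaun n (Re P)] do not tend to [1]. *)
Lemma negligible_Re_zero U (P : C -> C) : open U -> holomorphic_on U P ->
  (area R).-negligible (plane_set [set z | [/\ U z, Re (P z) = 0 & cder P z != 0]]).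
Proof.
move=> oU hP; have hP' := holomorphic_cder oU hP.
have mU := open_plane_measurable oU.
pose g := on_plane (zext U (fun z => Re (P z))).
pose gR := on_plane (zext U (fun z => Re (cder P z))).
pose gI := on_plane (zext U (fun z => Im (cder P z))).
have mg : measurable_fun setT g.
  by apply: measurable_zext => // z Uz; exact: contc_Re (holomorphic_continuous hP Uz).
have mgR : measurable_fun setT gR.
  by apply: measurable_zext => // z Uz; exact: contc_Re (holomorphic_continuous hP' Uz).
have mgI : measurable_fun setT gI.
  by apply: measurable_zext => // z Uz; exact: contc_Im (holomorphic_continuous hP' Uz).
(* The horizontal derivative of [Re P] is [Re P'] and the vertical one is [- Im P']. Hence the
   horizontal sections of [NR] and the vertical sections of [NI] consist of isolated points: they
   are countable, and both sets have area [0]. *)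
pose NR := plane_set U `&` (g @^-1` [set 0]) `&` ~` (gR @^-1` [set 0]).
pose NI := plane_set U `&` (g @^-1` [set 0]) `&` ~` (gI @^-1` [set 0]).
have mpre (k : measurableTypeR R * measurableTypeR R -> R) : measurable_fun setT k ->
    measurable (k @^-1` [set 0]).
  by move=> mk; rewrite -[X in measurable X]setTI; apply: mk.
have mNR : measurable NR.
  apply: measurableI; first by apply: measurableI => //; exact: mpre.
  by apply: measurableC; exact: mpre.
have mNI : measurable NI.
  apply: measurableI; first by apply: measurableI => //; exact: mpre.
  by apply: measurableC; exact: mpre.
have NRE x y : NR (x, y) -> [/\ U (x +i* y), Re (P (x +i* y)) = 0 & Re (cder P (x +i* y)) != 0].
  move=> [[/= Uxy]]; rewrite /g /gR /on_plane /= !zextT// => h1 h2; split => //.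
  by apply/eqP => h3; apply: h2.
have NIE x y : NI (x, y) -> [/\ U (x +i* y), Re (P (x +i* y)) = 0 & Im (cder P (x +i* y)) != 0].
  move=> [[/= Uxy]]; rewrite /g /gI /on_plane /= !zextT// => h1 h2; split => //.
  by apply/eqP => h3; apply: h2.
have NI0 : area R NI = 0%E.
  have -> : area R NI = (\int[mu]_x (mu \o xsection NI) x)%E by [].
  rewrite -[RHS](integral0 mu setT); apply: eq_integral => x _.
  apply: countable_lebesgue_measure0; apply: countable_isolated => y.
  move=> hxy; have [Uxy P0 P'0] := NIE _ _ (mem_xsectionE hxy).
  have [[h _] _] : cderiv (fun t => P (x +i* t)) y ('i%C * cder P (x +i* y)) /\ True.
    split=> //; have := cderiv_comp (cderiv_vertical x y) (holomorphic_is_derive hP Uxy).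
    by rewrite mulrC.
  have [|//|r r0 hr] := is_derive_isolated_zero h.
    by rewrite ReM /= mul0r mul1r sub0r oppr_eq0.
  exists r => // t ht; have [_ + _] := NIE _ _ (mem_xsectionE ht); exact: hr.
have NR0 : area R NR = 0%E.
  have -> : area R NR = (\int[area R]_z (\1_NR z)%:E)%E.
    by rewrite integral_indic// setIT.
  have mi : measurable_fun setT (fun z => (\1_NR z)%:E : \bar R).
    by apply/measurable_EFinP; exact: measurable_indic.
  have i0 z : (0 <= (\1_NR z)%:E :> \bar R)%E by rewrite lee_fin.
  have -> := @fubini_tonelli2 _ _ _ _ R mu mu _ mi i0.
  rewrite -[RHS](integral0 mu setT); apply: eq_integral => y _; rewrite /fubini_G.
  have -> : (\int[mu]_x (\1_NR (x, y))%:E)%E = (\int[mu]_x (\1_(ysection NR y) x)%:E)%E.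
    apply: eq_integral => x _; rewrite !indicE.
    suff -> : ((x, y) \in NR) = (x \in ysection NR y) :> bool by [].
    by apply/idP/idP => /set_mem h; apply: mem_set; [exact: mem_set|exact: mem_ysectionE].
  rewrite integral_indic//; last exact: measurable_ysection.
  rewrite setIT; apply: countable_lebesgue_measure0; apply: countable_isolated => x.
  move=> hxy; have [Uxy P0 P'0] := NRE _ _ (mem_ysectionE hxy).
  have [[h _] _] : cderiv (fun t => P (t +i* y)) x (cder P (x +i* y)) /\ True.
    split=> //; have := cderiv_comp (cderiv_horizontal y x) (holomorphic_is_derive hP Uxy).
    by rewrite mulr1.
  have [//|//|r r0 hr] := is_derive_isolated_zero h.
  exists r => // t ht; have [_ + _] := NRE _ _ (mem_ysectionE ht); exact: hr.
have nU : (area R).-negligible (NR `|` NI).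
  by apply: negligibleU; apply/negligibleP.
apply: negligibleS nU.
move=> [x y] [/= Uxy P0 P'0].
have [e|ne] := eqVneq (Re (cder P (x +i* y))) 0; [right|left].
  split; first by split=> //; rewrite /g /on_plane /= zextT.
  rewrite /= /gI /on_plane /= zextT// => e2; move: P'0.
  by rewrite -[X in X != 0]complex_eta e e2 eqxx.
  split; first by split=> //; rewrite /g /on_plane /= zextT.
  by rewrite /= /gR /on_plane /= zextT//; exact/eqP.
Qed.

End Limits.

(** * Pointwise continuity of real-valued functions *)

Section RealContinuity.
Variables (R : realType) (T : topologicalType).
Implicit Types (f g : T -> R) (x : T).

Lemma contrM f g x : {for x, continuous f} -> {for x, continuous g} ->
  {for x, continuous (fun t => f t * g t)}.
Proof. by move=> hf hg; exact: cvgM hf hg. Qed.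

Lemma contrD f g x : {for x, continuous f} -> {for x, continuous g} ->
  {for x, continuous (fun t => f t + g t)}.
Proof. by move=> hf hg; exact: cvgD hf hg. Qed.

End RealContinuity.

(** * Truncations of the identity near zero *)

Section Cutoffs.
Variable R : realType.
Implicit Types (f : R -> R) (t s x : R).

Lemma is_derive_quadratic f t (d K : R) : 0 <= K ->
  (forall h, `|f (t + h) - f t - d * h| <= K * h ^+ 2) -> is_derive t 1 f d.
Proof.
move=> K0 hf; apply/is_derive_realP => e e0.
exists (e / (K + 1)); first by rewrite divr_gt0// ltr_wpDl.
move=> s hs; have := hf (s - t); rewrite [t + _]addrC subrK => /le_trans; apply.
rewrite -real_normK ?num_real// expr2 mulrA ler_wpM2r ?normr_ge0//.
have h1 : (K + 1) * `|s - t| <= e by rewrite mulrC -ler_pdivlMr ?ltr_wpDl// ltW.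
by have := normr_ge0 (s - t); nra.
Qed.

(** The square makes the positive part continuously differentiable. One continuous derivative is all
    that Stokes' formula requires, so every cutoff is built from this function. *)
Definition sqp x := (Num.max x 0) ^+ 2.

Lemma is_derive_sqp x : is_derive x 1 sqp (2 * Num.max x 0).
Proof.
apply: (@is_derive_quadratic _ _ _ 1) => // h; rewrite /sqp mul1r ler_norml.
have [x0|x0] := leP x 0; have [y0|y0] := leP (x + h) 0; apply/andP; split; nra.
Qed.

Lemma cont_pospart x : {for x, continuous (fun x => Num.max x 0)}.
Proof. by apply: (@continuous_max _ R (fun x => x) (fun=> 0) x); [exact: cvg_id|exact: cvg_cst]. Qed.

(* [tau] vanishes on [-1, 1] and [dtau] tends to [1] at infinity, so [taun n]
   below approximates the identity by functions vanishing near [0]. *)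
Definition tau t := t * (sqp (t ^+ 2 - 1) / (1 + sqp (t ^+ 2 - 1))).
Definition dtau t := let q := Num.max (t ^+ 2 - 1) 0 in
  q ^+ 2 / (1 + q ^+ 2) + 4 * t ^+ 2 * q / (1 + q ^+ 2) ^+ 2.

Lemma is_derive_tau t : is_derive t 1 tau (dtau t).
Proof.
have d1 : is_derive t 1 (fun t => t ^+ 2 - 1) (2 * t).
  have h := is_deriveB (is_deriveM (is_derive_id t 1) (is_derive_id t 1))
    (is_derive_cst (1 : R) t 1).
  have -> : (fun t : R => t ^+ 2 - 1) = (fun t => t * t - 1) by [].
  by apply: is_derive_eq h _; rewrite /GRing.scale/= subr0 mulr1 mulr_natl mulr2n.
have d2 := @is_derive1_comp R sqp (fun t => t ^+ 2 - 1) t _ _ (is_derive_sqp _) d1.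
set q := Num.max (t ^+ 2 - 1) 0 in d2.
have d3 := is_deriveD (is_derive_cst (1 : R) t 1) d2.
have q1 : 1 + q ^+ 2 != 0 by rewrite gt_eqF// ltr_pwDl// sqr_ge0.
have d4 := @is_deriveV R (fun t => 1 + sqp (t ^+ 2 - 1)) t _ 1 q1 d3.
have d5 := is_deriveM d2 d4.
have d6 := is_deriveM (is_derive_id t 1) d5.
apply: is_derive_eq d6 _; rewrite /GRing.scale/= /dtau -/q add0r.
have -> : ((sqp \o (fun t0 : R => t0 ^+ 2 - 1)) * (fun y : R => (1 + sqp (y ^+ 2 - 1))^-1)) t =
  q ^+ 2 / (1 + q ^+ 2) by [].
by rewrite /sqp -/q; field.
Qed.

Lemma tau_small t : `|t| <= 1 -> tau t = 0 /\ dtau t = 0.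
Proof.
move=> t1; have q0 : Num.max (t ^+ 2 - 1) 0 = 0.
  by apply: max_r; rewrite subr_le0 -real_normK ?num_real// expr_le1// ltW.
by rewrite /tau /dtau /sqp q0 expr0n !mul0r !mulr0 mul0r addr0.
Qed.

Lemma dtau_bound t : 0 <= dtau t <= 4.
Proof.
rewrite /dtau; set q := Num.max _ _.
have q0 : 0 <= q by rewrite le_max lexx orbT.
have D0 : 0 < 1 + q ^+ 2 by rewrite ltr_pwDl// sqr_ge0.
(* Either [q] is [0] or [t ^+ 2 = q + 1]; this makes [dtau t] a rational function of [q] alone, to
   be bounded for [q >= 0]. *)
have tq : t ^+ 2 * q = (q + 1) * q.
  by rewrite /q; have [h|h] := leP (t ^+ 2 - 1) 0; [rewrite !mulr0|ring].
rewrite -[4 * t ^+ 2 * q]mulrA tq; apply/andP; split.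
  by rewrite addr_ge0// divr_ge0 ?sqr_ge0 ?mulr_ge0 ?addr_ge0 ?exprn_ge0// ltW.
have -> : q ^+ 2 / (1 + q ^+ 2) + 4 * ((q + 1) * q) / (1 + q ^+ 2) ^+ 2 =
   (q ^+ 2 * (1 + q ^+ 2) + 4 * ((q + 1) * q)) / (1 + q ^+ 2) ^+ 2.
  by field; rewrite gt_eqF.
rewrite ler_pdivrMr ?exprn_gt0//; move: (sqr_ge0 (q - 1)) (sqr_ge0 (q ^+ 2 - 1)) q0.
move: (sqr_ge0 q); clear; nra.
Qed.

(** The decay at infinity becomes, after rescaling by [n + 1], a convergence of [dtaun n t] to [1]
    for fixed nonzero [t]. The constant is not sharp. *)
Lemma dtau_limit t : `|dtau t - 1| * t ^+ 2 <= 12.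
Proof.
rewrite /dtau; set q := Num.max _ _.
have q0 : 0 <= q by rewrite le_max lexx orbT.
have D0 : 0 < 1 + q ^+ 2 by rewrite ltr_pwDl// sqr_ge0.
have tq : t ^+ 2 * q = (q + 1) * q.
  by rewrite /q; have [h|h] := leP (t ^+ 2 - 1) 0; [rewrite !mulr0|ring].
have tq' : t ^+ 2 <= q + 1 by rewrite -lerBlDr le_max lexx.
rewrite -[4 * t ^+ 2 * q]mulrA tq.
have -> : q ^+ 2 / (1 + q ^+ 2) + 4 * ((q + 1) * q) / (1 + q ^+ 2) ^+ 2 - 1 =
   (4 * ((q + 1) * q) - (1 + q ^+ 2)) / (1 + q ^+ 2) ^+ 2.
  by field; rewrite gt_eqF.
rewrite normrM normfV (@ger0_norm _ ((1 + q ^+ 2) ^+ 2)) ?exprn_ge0 ?(ltW D0)//.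
rewrite mulrAC ler_pdivrMr ?exprn_gt0//.
have h1 : `|4 * ((q + 1) * q) - (1 + q ^+ 2)| <= 9 * (1 + q ^+ 2).
  by rewrite ler_norml; apply/andP; split; have := sqr_ge0 (q - 1); nra.
apply: (@le_trans _ _ (9 * (1 + q ^+ 2) * (q + 1))).
  by apply: ler_pM => //; exact: sqr_ge0.
rewrite [12 * _]mulrC expr2 -[leRHS]mulrA [leLHS](_ : _ = (1 + q ^+ 2) * (9 * (q + 1))); last by ring.
by rewrite ler_pM2l//; have := sqr_ge0 (q - 1); nra.
Qed.

Lemma tau_le t : `|tau t| <= `|t|.
Proof.
have q0 : 0 <= sqp (t ^+ 2 - 1) by exact: sqr_ge0.
rewrite /tau normrM ler_piMr// ger0_norm ?divr_ge0// ?addr_ge0//.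
by rewrite ler_pdivrMr ?ltr_pwDl// mul1r lerDr.
Qed.

Lemma tau_limit t : `|tau t - t| <= 2.
Proof.
rewrite /tau /sqp; set q := Num.max _ _.
have q0 : 0 <= q by rewrite le_max lexx orbT.
have D0 : 0 < 1 + q ^+ 2 by rewrite ltr_pwDl// sqr_ge0.
have tq' : t ^+ 2 <= q + 1 by rewrite -lerBlDr le_max lexx.
have -> : t * (q ^+ 2 / (1 + q ^+ 2)) - t = - t / (1 + q ^+ 2) by field; rewrite gt_eqF.
rewrite normrM normrN normfV (ger0_norm (ltW D0)) ler_pdivrMr//.
move: tq'; rewrite -real_normK ?num_real//; have := normr_ge0 t; set x := `|t|.
move: (sqr_ge0 (q - 1)) (sqr_ge0 (x - 1)); nra.
Qed.

Lemma cont_dtau t : {for t, continuous dtau}.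
Proof.
have cq : {for t, continuous (fun t : R => Num.max (t ^+ 2 - 1) 0)}.
  apply: (@cont_comp _ _ _ (fun t : R => t ^+ 2 - 1) (fun x => Num.max x 0)).
    by apply: cvgB; [exact: exprn_continuous|exact: cvg_cst].
  exact: cont_pospart.
have cq2 : {for t, continuous (fun t : R => 1 + (Num.max (t ^+ 2 - 1) 0) ^+ 2)}.
  apply: cvgD; first exact: cvg_cst.
  apply: (@cont_comp _ _ _ (fun t : R => Num.max (t ^+ 2 - 1) 0) (fun x : R => x ^+ 2)) => //.
  exact: exprn_continuous.
have nz : 1 + (Num.max (t ^+ 2 - 1) 0) ^+ 2 != 0 by rewrite gt_eqF// ltr_pwDl// sqr_ge0.
rewrite /dtau; apply: cvgD; apply: cvgM.
- apply: (@cont_comp _ _ _ (fun t : R => Num.max (t ^+ 2 - 1) 0) (fun x : R => x ^+ 2)) => //.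
  exact: exprn_continuous.
- exact: cvgV.
- apply: cvgM => //; apply: cvgM; first exact: cvg_cst.
  exact: exprn_continuous.
- apply: cvgV; first by rewrite expf_neq0.
  apply: (@cont_comp _ _ _ (fun t : R => 1 + (Num.max (t ^+ 2 - 1) 0) ^+ 2) (fun x : R => x ^+ 2)) => //.
  exact: exprn_continuous.
Qed.

Definition taun (n : nat) t := tau (n.+1%:R * t) / n.+1%:R.
Definition dtaun (n : nat) t := dtau (n.+1%:R * t).

Lemma is_derive_taun n t : is_derive t 1 (taun n) (dtaun n t).
Proof.
have d1 : is_derive t 1 (fun t => n.+1%:R * t) (n.+1%:R : R).
  have h := is_deriveM (is_derive_cst (n.+1%:R : R) t 1) (is_derive_id t 1).
  by apply: is_derive_eq h _; rewrite /GRing.scale/= mulr0 addr0 mulr1.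
have d2 := is_derive1_comp (is_derive_tau (n.+1%:R * t)) d1.
have d3 := is_deriveM d2 (is_derive_cst (n.+1%:R^-1 : R) t 1).
apply: is_derive_eq d3 _; rewrite /GRing.scale/= mulr0 add0r mulrCA mulVf ?mulr1//.
Qed.

Lemma cont_dtaun n t : {for t, continuous (dtaun n)}.
Proof.
apply: (@cont_comp _ _ _ (fun t : R => n.+1%:R * t) dtau); last exact: cont_dtau.
by apply: cvgM; [exact: cvg_cst|exact: cvg_id].
Qed.

Lemma taun_small n t : `|t| < n.+1%:R^-1 -> taun n t = 0 /\ dtaun n t = 0.
Proof.
move=> h; rewrite /taun /dtaun; have [|-> ->] := @tau_small (n.+1%:R * t).
  by rewrite normrM ger0_norm// mulrC -ler_pdivlMr// mul1r ltW.
by rewrite mul0r.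
Qed.

Lemma taun_le n t : `|taun n t| <= `|t|.
Proof.
rewrite /taun normrM normfV (@ger0_norm _ n.+1%:R)// ler_pdivrMr//.
by apply: le_trans (tau_le _) _; rewrite normrM ger0_norm// mulrC.
Qed.

Lemma dtaun_bound n t : 0 <= dtaun n t <= 4.
Proof. exact: dtau_bound. Qed.

Lemma cvg_harmonic_bound (u : nat -> R) (l K : R) : 0 <= K ->
  (forall n, `|u n - l| <= K / n.+1%:R) -> u n @[n --> \oo] --> l.
Proof.
move=> K0 h; apply/cvgrPdist_lt => e e0.
have eK : 0 < e / (K + 1) by rewrite divr_gt0// ltr_wpDl.
have /cvgrPdist_lt/(_ _ eK)[N _ hN] := @cvg_harmonic R.
exists N => // n Nn; have := hN n Nn; rewrite /= sub0r normrN /harmonic /= ger0_norm ?invr_ge0//.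
rewrite ltr_pdivlMr ?ltr_wpDl// => h1; rewrite distrC; apply: le_lt_trans (h n) _.
apply: le_lt_trans h1; rewrite mulrC ler_pM2l ?invr_gt0// lerDl//.
Qed.

Lemma taun_cvg t : taun n t @[n --> \oo] --> t.
Proof.
apply: (@cvg_harmonic_bound _ _ 2) => // n.
have -> : taun n t - t = (tau (n.+1%:R * t) - n.+1%:R * t) / n.+1%:R.
  by rewrite /taun mulrBl [n.+1%:R * t]mulrC mulfK.
by rewrite normrM normfV (@ger0_norm _ n.+1%:R)// ler_pM2r ?invr_gt0// tau_limit.
Qed.

Lemma dtaun_cvg t : t != 0 -> dtaun n t @[n --> \oo] --> (1 : R).
Proof.
move=> t0; have t2 : 0 < t ^+ 2 by rewrite exprn_even_gt0.
apply: (@cvg_harmonic_bound _ _ (12 / t ^+ 2)); first by rewrite divr_ge0// ltW.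
move=> n; rewrite /dtaun; have := dtau_limit (n.+1%:R * t).
rewrite exprMn mulrA => h; rewrite ler_pdivlMr// ler_pdivlMr//; apply: le_trans h.
rewrite ler_pM2r// ler_wpM2l ?normr_ge0// expr2 ler_peMl//.
by rewrite ler1n.
Qed.

End Cutoffs.

(** * The energy estimate for a holomorphic function whose real part vanishes at the boundary *)

Section EnergyEstimate.
Variable R : realType.
Local Notation C := (cplane R).
Variables (U : set C) (P : C -> C) (W Wx Wy : C -> R).
Hypotheses (oU : open U) (hP : holomorphic_on U P).
Hypothesis dW : forall z, U z -> pderiv (fun w => (W w)%:C : C) z ((Wx z)%:C) ((Wy z)%:C).
Hypothesis cW : forall z, U z -> {for z, continuous W}.
Hypothesis cWx : forall z, U z -> {for z, continuous Wx}.
Hypothesis cWy : forall z, U z -> {for z, continuous Wy}.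
Hypothesis W01 : forall z, U z -> 0 <= W z <= 1.
(** The two ends of [U] are treated together: near a removed pole the weight [W] is [0], and near
    the outer boundary [Re P] is small. In both cases [W * taun n (Re P)] vanishes. *)
Hypothesis W_boundary : forall e : R, 0 < e -> exists K : set C,
  [/\ compact K, K `<=` U & forall z, U z -> ~ K z -> W z = 0 \/ `|Re (P z)| < e].
Variable K0 : set C.
Hypotheses (cK0 : compact K0) (K0U : K0 `<=` U).
Hypothesis gradW0 : forall z, U z -> ~ K0 z -> Wx z = 0 /\ Wy z = 0.

Definition gradW (z : C) : C := (Wx z)%:C + 'i%C * (Wy z)%:C.

Let P' := cder P.
Let hP' : holomorphic_on U P'. Proof. exact: holomorphic_cder. Qed.

Lemma conjcE (w : C) : (w^*)%C = (Re w)%:C - 'i%C * (Im w)%:C :> C.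
Proof.
case: w => x y; apply/eqP; rewrite eq_complex ReB ImB ReM ImM /=.
by apply/andP; split; apply/eqP; ring.
Qed.

(* Twice the [dbar]-derivative of [W * taun n (Re P) * f], which has compact
   support since [W] cuts off the poles: the integral is [0]. *)
Definition energy_integrand (n : nat) (f : C -> C) (z : C) : C :=
  gradW z * (taun n (Re (P z)))%:C * f z +
  (W z)%:C * (dtaun n (Re (P z)))%:C * (P' z)^*%C * f z.

Lemma taun_support n : exists K : set C,
  [/\ compact K, K `<=` U & forall z, U z -> ~ K z ->
    W z * taun n (Re (P z)) = 0 /\ W z * dtaun n (Re (P z)) = 0].
Proof.
have [|K [cK KU hK]] := @W_boundary (n.+1%:R^-1); first by rewrite invr_gt0.
exists K; split => // z Uz Kz; have [->|/taun_small[-> ->]] := hK z Uz Kz.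
  by rewrite !mul0r.
by rewrite !mulr0.
Qed.

Lemma cont_ReP z : U z -> {for z, continuous (fun w => Re (P w))}.
Proof. by move=> Uz; exact: contc_Re (holomorphic_continuous hP Uz). Qed.

Lemma cont_taun n z : U z -> {for z, continuous (fun w => (taun n (Re (P w)))%:C : C)}.
Proof.
move=> Uz; apply: contc_real; apply: (cont_comp (cont_ReP Uz)).
exact: derivable_real_continuous (is_derive_taun n _).
Qed.

Lemma cont_dtaunP n z : U z -> {for z, continuous (fun w => (dtaun n (Re (P w)))%:C : C)}.
Proof.
move=> Uz; apply: contc_real; apply: (cont_comp (cont_ReP Uz)); exact: cont_dtaun.
Qed.

Lemma energy_identity n f : holomorphic_on U f ->
  area_integral U (energy_integrand n f) = 0.
Proof.
move=> hf; have hf' := holomorphic_cder oU hf.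
have [K [cK KU hK]] := taun_support n.
pose T (z : C) : C := (taun n (Re (P z)))%:C.
pose D (z : C) : C := (dtaun n (Re (P z)))%:C.
pose V (z : C) : C := (W z)%:C * T z * f z.
pose A (z : C) : C := ((Wx z)%:C * T z + (W z)%:C * (D z * (Re (P' z))%:C)) * f z +
  (W z)%:C * T z * cder f z.
pose B (z : C) : C := ((Wy z)%:C * T z + (W z)%:C * (D z * (Re ('i%C * P' z))%:C)) * f z +
  (W z)%:C * T z * ('i%C * cder f z).
have dV z : U z -> pderiv V z (A z) (B z).
  move=> Uz; have dP := pderiv_holomorphic (holomorphic_is_derive hP Uz).
  have dT := pderiv_real_comp dP (is_derive_taun n (Re (P z))).
  have := pderivM (pderivM (dW Uz) dT) (pderiv_holomorphic (holomorphic_is_derive hf Uz)).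
  have CM (x y : R) : (x * y)%:C = x%:C * y%:C :> C by rewrite rmorphM.
  by move=> h; apply: pderiv_eq h _ _; rewrite /A /B /T /D CM.
have cT z : U z -> {for z, continuous T} by exact: cont_taun.
have cD z : U z -> {for z, continuous D} by exact: cont_dtaunP.
have cWc z : U z -> {for z, continuous (fun z => (W z)%:C : C)}.
  by move=> Uz; exact: contc_real (cW Uz).
have cf z : U z -> {for z, continuous f} by exact: holomorphic_continuous.
have cf' z : U z -> {for z, continuous (cder f)} by exact: holomorphic_continuous.
have cP' z : U z -> {for z, continuous P'} by exact: holomorphic_continuous.
have cA z : U z -> {for z, continuous A}.
  move=> Uz; apply: contcD.
    apply: contcM (cf z Uz); apply: contcD.
      exact: contcM (contc_real (cWx Uz)) (cT z Uz).
    apply: contcM (cWc z Uz) _; apply: contcM (cD z Uz) _.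
    exact: contc_real (contc_Re (cP' z Uz)).
  exact: contcM (contcM (cWc z Uz) (cT z Uz)) (cf' z Uz).
have cB z : U z -> {for z, continuous B}.
  move=> Uz; apply: contcD.
    apply: contcM (cf z Uz); apply: contcD.
      exact: contcM (contc_real (cWy Uz)) (cT z Uz).
    apply: contcM (cWc z Uz) _; apply: contcM (cD z Uz) _.
    apply: contc_real; apply: contc_Re.
    exact: contcM (contc_cst 'i%C z) (cP' z Uz).
  apply: contcM (contcM (cWc z Uz) (cT z Uz)) _.
  exact: contcM (contc_cst 'i%C z) (cf' z Uz).
have V0 z : U z -> ~ K z -> V z = 0.
  move=> Uz Kz; rewrite /V /T -rmorphM /=.
  by have [-> _] := hK z Uz Kz; rewrite mul0r.
have [<- _] := Stokes_compact oU cK KU dV cA cB V0.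
apply: eq_area_integral => z Uz; rewrite /energy_integrand /A /B -/(T z) -/(D z) /gradW conjcE.
have -> : Re ('i%C * P' z) = - Im (P' z) by rewrite ReM /= mul0r mul1r sub0r.
have i2 : 'i%C * 'i%C = -1 :> C by rewrite -expr2 sqr_i.
rewrite rmorphN /=.
have -> : (W z)%:C * T z * ('i%C * cder f z) = 'i%C * ((W z)%:C * T z * cder f z) by ring.
rewrite [in RHS]mulrDr ['i%C * ('i%C * _)]mulrA i2.
by ring.
Qed.

Lemma cont_gradW z : U z -> {for z, continuous gradW}.
Proof.
move=> Uz; apply: contcD; first exact: contc_real (cWx Uz).
exact: contcM (contc_cst 'i%C z) (contc_real (cWy Uz)).
Qed.

Lemma gradW_eq0 z : U z -> ~ K0 z -> gradW z = 0.
Proof. by move=> Uz /(gradW0 Uz)[e1 e2]; rewrite /gradW e1 e2 mulr0 addr0. Qed.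

Let mU := open_plane_measurable oU.

Lemma integrable_gradient_term (f : C -> C) : holomorphic_on U f ->
  (area R).-integrable setT (EFin \o on_plane
    (zext U (fun z => normc (gradW z) * `|Re (P z)| * normc (f z)))).
Proof.
move=> hf; pose g (z : C) : C := (normc (gradW z) * `|Re (P z)| * normc (f z))%:C.
have cg z : U z -> {for z, continuous g}.
  move=> Uz; apply: contc_real; apply: contrM (contc_normc (holomorphic_continuous hf Uz)).
  apply: contrM; first exact: contc_normc (cont_gradW Uz).
  apply: (cont_comp (cont_ReP Uz)); exact: norm_continuous.
have g0 z : U z -> ~ K0 z -> g z = 0.
  by move=> Uz Kz; rewrite /g gradW_eq0// normc0 !mul0r.
have [h _] := cintegrable_zext_compact oU cK0 K0U cg g0.
by rewrite Re_zext in h.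
Qed.

(** In [energy_identity] with [f = P'] the second term is [W * dtaun * |P'|^2], which is
    nonnegative, and the first is bounded by the integrable [G], independent of [n], since [taun] is
    at most the identity in modulus and [gradW] has compact support. Fatou's lemma gives the
    integrability of the limit. *)
Lemma W_energy_integrable :
  (area R).-integrable setT (EFin \o on_plane
    (zext U (fun z => W z * normc (P' z) ^+ 2))).
Proof.
pose a z := Re (P z).
pose h n z := zext U (fun z => W z * dtaun n (a z) * normc (P' z) ^+ 2) z.
(* Where [Re P] is [0] all the [dtaun] vanish, so the limit carries an indicator. It differs from
   the wanted function only on the set of [negligible_Re_zero]. *)
pose hl z := zext U (fun z => W z * (a z != 0)%:R * normc (P' z) ^+ 2) z.
pose G := zext U (fun z => normc (gradW z) * `|a z| * normc (P' z)).
have iG : (area R).-integrable setT (EFin \o on_plane G) by exact: integrable_gradient_term.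
have cP' z : U z -> {for z, continuous P'} by exact: holomorphic_continuous.
have cn z : U z -> {for z, continuous (fun z => normc (P' z) ^+ 2)}.
  move=> Uz; apply: (@cont_comp _ _ _ (fun z => normc (P' z)) (fun x : R => x ^+ 2)).
    exact: contc_normc (cP' z Uz).
  exact: exprn_continuous.
have chn n z : U z -> {for z, continuous (fun z => W z * dtaun n (a z) * normc (P' z) ^+ 2)}.
  move=> Uz; apply: contrM (cn z Uz); apply: contrM; first exact: cW.
  by apply: (cont_comp (cont_ReP Uz)); exact: cont_dtaun.
have key n : (area R).-integrable setT (EFin \o on_plane (h n)) /\
    Rintegral (area R) setT (on_plane (h n)) <= Rintegral (area R) setT (on_plane G).
  have [K [cK KU hK]] := taun_support n.
  pose g1 (z : C) : C := gradW z * (taun n (a z))%:C * P' z.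
  pose g2 (z : C) : C := (W z * dtaun n (a z) * normc (P' z) ^+ 2)%:C.
  have cg1 z : U z -> {for z, continuous g1}.
    move=> Uz; apply: contcM (cP' z Uz).
    by apply: contcM; [exact: cont_gradW|exact: cont_taun].
  have cg2 z : U z -> {for z, continuous g2}.
    by move=> Uz; apply: contc_real; exact: chn.
  have i1 : cintegrable setT (zext U g1).
    apply: (cintegrable_zext_compact oU cK0 K0U cg1) => z Uz Kz.
    by rewrite /g1 gradW_eq0// !mul0r.
  have i2 : cintegrable setT (zext U g2).
    apply: (cintegrable_zext_compact oU cK KU cg2) => z Uz Kz.
    by rewrite /g2; have [_ ->] := hK z Uz Kz; rewrite mul0r.
  have E : area_integral setT (zext U g1) + area_integral setT (zext U g2) = 0.
    rewrite !area_integral_zext -area_integralD//; try exact/cintegrable_zext.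
    rewrite -(energy_identity n hP'); apply: eq_area_integral => z Uz.
    rewrite /energy_integrand /g1 /g2; congr (_ + _).
    rewrite -!mulrA [(P' z)^*%C * _]mulrC.
    have -> : P' z * (P' z)^*%C = (normc (P' z) ^+ 2)%:C.
      by rewrite sqr_normcE; case: (P' z) => x y; apply/eqP; rewrite eq_complex /=;
        apply/andP; split; apply/eqP; ring.
    by rewrite !rmorphM.
  have ih : (area R).-integrable setT (EFin \o on_plane (h n)).
    by have [ih _] := i2; rewrite Re_zext in ih.
  split => //.
  have E2 : Rintegral (area R) setT (on_plane (h n)) =
      - Rintegral (area R) setT (on_plane (fun z => Re (zext U g1 z))).
    have := congr1 (@complex.Re R) E; rewrite ReD /= /area_integral /= => /eqP.
    rewrite addrC addr_eq0 => /eqP <-; apply: eq_Rintegral => p _.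
    by rewrite /on_plane /h /zext; case: ifP.
  have [i1R _] := i1.
  rewrite E2; apply: le_trans (ler_norm _) _; rewrite normrN.
  apply: le_trans (le_normr_Rintegral measurableT i1R) _.
  apply: le_Rintegral => //.
    exact: (integrable_norm i1R).
  move=> p _ /=; rewrite /on_plane /G /zext; case: ifPn => [|_]; last by rewrite normr0.
  rewrite inE => Up; apply: le_trans (Re_le_normc _) _.
  rewrite /g1 !normcM normc_real ler_wpM2r ?normc_ge0// ler_wpM2l ?normc_ge0//.
  exact: taun_le.
have W0 z : U z -> 0 <= W z by move=> /W01/andP[].
have hl_int : (area R).-integrable setT (EFin \o on_plane hl).
  apply: (@Rintegral_Fatou R h hl (Rintegral (area R) setT (on_plane G))).
  - by move=> n; apply: measurable_zext => // z; exact: chn.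
  - have -> : hl = fun z => (zext U a z != 0)%:R * zext U (fun z => W z * normc (P' z) ^+ 2) z.
      apply/funext => z; rewrite /hl /zext; case: ifP => _; last by rewrite mulr0.
      by ring.
    apply: measurable_funM; last first.
      apply: measurable_zext => // z Uz; apply: contrM (cn z Uz); exact: cW.
    have ma : measurable_fun setT (on_plane (zext U a)).
      by apply: measurable_zext => // z; exact: cont_ReP.
    have -> : (fun x : measurableTypeR R * measurableTypeR R => (zext U a (x.1 +i* x.2) != 0)%:R) =
       \1_(~` (on_plane (zext U a) @^-1` [set 0])) :> (_ -> R).
      apply/funext => p; rewrite indicE.
      suff -> : (zext U a (p.1 +i* p.2) != 0) =
        (p \in ~` (on_plane (zext U a) @^-1` [set 0])) :> bool by [].
      by apply/idP/idP => [/eqP h1|/set_mem h1]; [exact: mem_set|exact/eqP].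
    apply: measurable_indic; apply: measurableC.
    by rewrite -[X in measurable X]setTI; apply: ma.
  - move=> n z; rewrite /h /zext; case: ifPn => //; rewrite inE => Uz.
    have /andP[d0 _] := dtaun_bound n (a z).
    by rewrite mulr_ge0 ?sqr_ge0// mulr_ge0// W0.
  - move=> z; rewrite /hl /zext; case: ifPn => //; rewrite inE => Uz.
    by rewrite mulr_ge0 ?sqr_ge0// mulr_ge0 ?W0 ?ler0n.
  - by move=> n; have [] := key n.
  - by move=> n; have [] := key n.
  - move=> z; rewrite /h /hl /zext; case: ifPn => [|_]; last exact: cvg_cst.
    rewrite inE => Uz; apply: cvgM; last exact: cvg_cst.
    apply: cvgM; first exact: cvg_cst.
    have [->|nz] := eqVneq (a z) 0; last exact: dtaun_cvg.
    have -> : (fun n => dtaun n 0) = (fun=> 0 : R).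
      by apply/funext => n; have [|_ ->] := @taun_small R n 0; rewrite ?normr0 ?invr_gt0.
    exact: cvg_cst.
have mt : measurable_fun setT (on_plane (zext U (fun z => W z * normc (P' z) ^+ 2))).
  by apply: measurable_zext => // z Uz; apply: contrM (cn z Uz); exact: cW.
have /integrableP[mh fh] := hl_int.
apply/integrableP; split; first exact/measurable_EFinP.
rewrite (_ : (\int[area R]_x _)%E = (\int[area R]_x `|(EFin \o on_plane hl) x|)%E)//.
apply: ge0_ae_eq_integral => //.
- by apply: measurableT_comp => //; exact/measurable_EFinP.
- exact: measurableT_comp.
apply: negligibleS (negligible_Re_zero oU hP) => p /= hp.
apply: contrapT => Np; apply: hp => _; congr (`|_|%:E).
rewrite /on_plane /hl /zext; case: ifPn => //; rewrite inE => Up.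
have [az|nz] := eqVneq (a (p.1 +i* p.2)) 0; last by rewrite mulr1.
have [->|nz] := eqVneq (P' (p.1 +i* p.2)) 0; first by rewrite normc0 expr0n !mulr0.
by exfalso; apply: Np.
Qed.

(** Almost everywhere [dtaun n (Re P)] tends to [1] or [P'] vanishes, and [taun n (Re P)] tends to
    [Re P]: [energy_identity] passes to the limit term by term. *)
Theorem energy_limit f : holomorphic_on U f ->
  (area R).-integrable setT (EFin \o on_plane (zext U (fun z => W z * normc (f z) ^+ 2))) ->
  cintegrable U (fun z => (W z)%:C * (P' z)^*%C * f z) /\
  area_integral U (fun z => (W z)%:C * (P' z)^*%C * f z) =
  - area_integral U (fun z => gradW z * (Re (P z))%:C * f z).
Proof.
move=> hf if2.
have cf z : U z -> {for z, continuous f} by exact: holomorphic_continuous.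
have cP' z : U z -> {for z, continuous P'} by exact: holomorphic_continuous.
have cWc z : U z -> {for z, continuous (fun z => (W z)%:C : C)}.
  by move=> Uz; exact: contc_real (cW Uz).
pose l1 (z : C) : C := gradW z * (Re (P z))%:C * f z.
pose l2 (z : C) : C := (W z)%:C * (P' z)^*%C * f z.
have cl1 z : U z -> {for z, continuous l1}.
  move=> Uz; apply: contcM (cf z Uz).
  exact: contcM (cont_gradW Uz) (contc_real (cont_ReP Uz)).
have cl2 z : U z -> {for z, continuous l2}.
  move=> Uz; apply: contcM (cf z Uz).
  exact: contcM (cWc z Uz) (contc_conj (cP' z Uz)).
(* The dominating function. Its factor [4] is the bound of [dtaun], and the product of the moduli of
   [P'] and [f] is at most the sum of their squares. *)
pose g z := zext U (fun z => normc (gradW z) * `|Re (P z)| * normc (f z)) z +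
  (4 * zext U (fun z => W z * normc (P' z) ^+ 2) z + 4 * zext U (fun z => W z * normc (f z) ^+ 2) z).
have ig : (area R).-integrable setT (EFin \o on_plane g).
  have i1 := integrable_gradient_term hf.
  have i2 := integrable_lin 4 4 (@measurable_plane_setT R) W_energy_integrable if2.
  have := integrable_lin 1 1 (@measurable_plane_setT R) i1 i2.
  by under [X in EFin \o on_plane X]eq_fun do rewrite !mul1r.
have [] := @area_integral_dominated R (fun n => zext U (energy_integrand n f))
  (zext U (fun z => l1 z + l2 z)) g
  [set z | [/\ U z, Re (P z) = 0 & cder P z != 0]].
- move=> n; apply: (cmeasurable_zext oU) => z Uz; apply: contcD.
    apply: contcM (cf z Uz); apply: contcM; first exact: cont_gradW.
    exact: cont_taun.
  apply: contcM (cf z Uz); apply: contcM (contc_conj (cP' z Uz)).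
  by apply: contcM; [exact: cWc|exact: cont_dtaunP].
- by apply: (cmeasurable_zext oU) => z Uz; exact: contcD (cl1 z Uz) (cl2 z Uz).
- exact: negligible_Re_zero.
- move=> z Nz; rewrite /zext; case: ifPn => [|_]; last exact: cvg_cst.
  rewrite inE => Uz; apply: cvgcD.
    apply: cvgcM; last exact: cvg_cst.
    apply: cvgcM; first exact: cvg_cst.
    by apply: cvg_realC; exact: taun_cvg.
  rewrite /l2; apply: cvgcM; last exact: cvg_cst.
  have [P0|nP] := eqVneq (P' z) 0.
    rewrite P0 rmorph0 mulr0 (_ : (fun n => _) = (fun=> 0)); first exact: cvg_cst.
    by apply/funext => n; rewrite mulr0.
  apply: cvgcM; last exact: cvg_cst.
  rewrite -[X in _ --> X]mulr1; apply: cvgcM; first exact: cvg_cst.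
  apply: cvg_realC; apply: dtaun_cvg; apply/eqP => a0.
  by apply: Nz.
- exact: ig.
- move=> n z; rewrite /g /zext; case: ifPn => [|_]; last by rewrite normc0 !mulr0 !addr0.
  rewrite inE => Uz; apply: le_trans (le_normcD _ _) _; apply: lerD.
    rewrite !normcM normc_real ler_wpM2r ?normc_ge0// ler_wpM2l ?normc_ge0//.
    exact: taun_le.
  rewrite !normcM !normc_real normc_conj.
  have /andP[W0 _] := W01 Uz; have /andP[d0 d4] := dtaun_bound n (Re (P z)).
  rewrite (ger0_norm W0) (ger0_norm d0) -mulrA -mulrDr -mulrDr.
  have x0 := normc_ge0 (P' z); have y0 := normc_ge0 (f z).
  move: x0 y0; set x := normc (P' z); set y := normc (f z) => x0 y0.
  have h : x * y <= x ^+ 2 + y ^+ 2 by have := sqr_ge0 (x - y); have := sqr_ge0 (x + y); nra.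
  rewrite -mulrA [4 * _]mulrCA; apply: ler_wpM2l => //.
  by apply: ler_pM => //; rewrite mulr_ge0.
move=> iL cvL.
have E : area_integral setT (zext U (fun z => l1 z + l2 z)) = 0.
  have c0 : (area_integral setT (zext U (energy_integrand n f)) : C) @[n --> \oo] --> (0 : C).
    rewrite (_ : (fun n => _) = fun=> 0); first exact: cvg_cst.
    by apply/funext => n; rewrite area_integral_zext; exact: energy_identity.
  exact: (cvg_unique _ cvL c0).
have i1 : cintegrable U l1.
  apply/(cintegrable_zext _ mU); apply: (cintegrable_zext_compact oU cK0 K0U cl1) => z Uz Kz.
  by rewrite /l1 gradW_eq0// !mul0r.
have i12 : cintegrable U (fun z => l1 z + l2 z) by apply/(cintegrable_zext _ mU).
have i2 : cintegrable U l2.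
  have := cintegrableD mU i12 (cintegrableZ (-1) mU i1).
  by under eq_fun do rewrite mulN1r addrC addKr.
split => //; apply/eqP; rewrite -addr_eq0 addrC -area_integralD//.
by rewrite -area_integral_zext E.
Qed.

End EnergyEstimate.

(** * Bump functions on discs *)

Section Bump.
Variable R : realType.
Local Notation C := (cplane R).
Implicit Types (p z : C) (r t : R).

(** A continuously differentiable step from [1] to [0]. The argument will be the squared distance
    divided by [r ^+ 2], so the thresholds [1 / 4] and [1] correspond to the radii [r / 2] and
    [r]. *)
Definition beta (t : R) : R := 1 - sqp (1 - 2 * sqp (1 - t)).
Definition dbeta (t : R) : R :=
  - (8 * Num.max (1 - 2 * sqp (1 - t)) 0 * Num.max (1 - t) 0).

Lemma is_derive_beta t : is_derive t 1 beta (dbeta t).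
Proof.
have d1 : is_derive t 1 (fun t : R => 1 - t) (-1).
  by apply: is_derive_eq (is_deriveB (is_derive_cst (1 : R) t 1) (is_derive_id t 1)) _; rewrite sub0r.
have d2 := @is_derive1_comp R (@sqp R) (fun t : R => 1 - t) _ _ _ (is_derive_sqp _) d1.
have d3 : is_derive t 1 (fun t : R => 1 - 2 * sqp (1 - t)) (4 * Num.max (1 - t) 0).
  have d4 := is_deriveM (is_derive_cst (2 : R) t 1) d2; have d5 := is_deriveB (is_derive_cst (1 : R) t 1) d4.
  apply: is_derive_eq d5 _; rewrite /GRing.scale /=; ring.
have d6 := @is_derive1_comp R (@sqp R) (fun t : R => 1 - 2 * sqp (1 - t)) _ _ _ (is_derive_sqp _) d3.
have d7 := is_deriveB (is_derive_cst (1 : R) t 1) d6.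
by apply: is_derive_eq d7 _; rewrite /dbeta; ring.
Qed.

Lemma sqp_ge0 (x : R) : 0 <= sqp x. Proof. exact: sqr_ge0. Qed.

Lemma sqp_eq0 (x : R) : x <= 0 -> sqp x = 0.
Proof. by move=> x0; rewrite /sqp (max_idPr x0) expr0n. Qed.

Lemma sqp_pos (x : R) : 0 <= x -> sqp x = x ^+ 2.
Proof. by move=> x0; rewrite /sqp (max_idPl x0). Qed.

Lemma beta01 t : 0 <= beta t <= 1.
Proof.
rewrite /beta; have h := sqp_ge0 (1 - t); have h2 := sqp_ge0 (1 - 2 * sqp (1 - t)).
apply/andP; split; last lra.
have [x0|x0] := leP (1 - 2 * sqp (1 - t)) 0; first by rewrite sqp_eq0//; lra.
by move: h2; rewrite (sqp_pos (ltW x0)); move: x0 h; set s := sqp _; nra.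
Qed.

Lemma beta_out t : 1 <= t -> beta t = 0 /\ dbeta t = 0.
Proof.
move=> t1; have h : 1 - t <= 0 by lra.
by rewrite /beta /dbeta (sqp_eq0 h) (max_idPr h) !mulr0 subr0 sqp_pos// expr1n subrr oppr0.
Qed.

Lemma beta_in t : t <= 1 / 4 -> beta t = 1 /\ dbeta t = 0.
Proof.
move=> t1; have h : 1 - 2 * sqp (1 - t) <= 0.
  rewrite sqp_pos; last lra.
  nra.
by rewrite /beta /dbeta (sqp_eq0 h) (max_idPr h) subr0 mulr0 mul0r oppr0.
Qed.

Lemma cont_sqp (x : R) : {for x, continuous (@sqp R)}.
Proof. exact: derivable_real_continuous (is_derive_sqp x). Qed.

Lemma cont_dbeta t : {for t, continuous dbeta}.
Proof.
have c1 : {for t, continuous (fun t : R => 1 - t)}.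
  by apply: continuousB; [exact: cst_continuous|exact: cvg_id].
have c2 : {for t, continuous (fun t : R => Num.max (1 - t) 0)}.
  exact: cont_comp c1 (@cont_pospart R _).
have c3 : {for t, continuous (fun t : R => 1 - 2 * sqp (1 - t))}.
  apply: continuousB; first exact: cst_continuous.
  apply: contrM; first exact: cst_continuous.
  exact: cont_comp c1 (@cont_sqp _).
apply: continuousN; apply: contrM c2; apply: contrM; first exact: cst_continuous.
exact: cont_comp c3 (@cont_pospart R _).
Qed.

(** Written as the real part of a product of a holomorphic function with a conjugate, so that the
    product and conjugation rules of [pderiv] give its partial derivatives. *)
Definition sqdist p r z : R := Re ((z - p) * ((z - p)^*)%C) / r ^+ 2.
Definition bump p r z : R := beta (sqdist p r z).
Definition bumpx p r z : R := dbeta (sqdist p r z) / r ^+ 2 * (2 * Re (z - p)).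
Definition bumpy p r z : R := dbeta (sqdist p r z) / r ^+ 2 * (2 * Im (z - p)).

Lemma sqdistE p r z : sqdist p r z = (normc (z - p) / r) ^+ 2.
Proof.
rewrite /sqdist expr_div_n; congr (_ / _); rewrite sqr_normcE.
by case: (z - p) => x y /=; ring.
Qed.

Lemma pderiv_bump p r z : pderiv (fun w => (bump p r w)%:C : C) z
  (bumpx p r z)%:C (bumpy p r z)%:C.
Proof.
have d0 : is_derive z 1 (fun w : C => w - p) 1.
  apply: is_derive_eq (is_derivecB (is_derivec_id z) (is_derivec_cst z p)) _.
  by rewrite subr0.
have d1 := pderiv_holomorphic d0.
have d2 := pderivM d1 (pderiv_conj d1).
have d3 : is_derive (Re ((z - p) * ((z - p)^*)%C)) 1 (fun t => beta (t / r ^+ 2))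
    (dbeta (sqdist p r z) / r ^+ 2).
  have d4 : is_derive (Re ((z - p) * ((z - p)^*)%C)) 1 (fun t : R => t / r ^+ 2) (r ^+ 2)^-1.
    have := is_deriveM (is_derive_id (Re ((z - p) * ((z - p)^*)%C)) 1)
      (is_derive_cst ((r ^+ 2)^-1) (Re ((z - p) * ((z - p)^*)%C)) 1).
    by move=> h; apply: is_derive_eq h _; rewrite /GRing.scale /=; ring.
  exact: (@is_derive1_comp R beta (fun t : R => t / r ^+ 2) _ _ _ (is_derive_beta _) d4).
apply: pderiv_eq (pderiv_real_comp d2 d3) _ _; congr (_%:C); rewrite /bumpx /bumpy.
  by congr (_ * _); case: (z - p) => x y /=; ring.
by congr (_ * _); case: (z - p) => x y /=; ring.
Qed.

Lemma cont_sqdist p r z : {for z, continuous (sqdist p r)}.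
Proof.
have c0 : {for z, continuous (fun w : C => w - p)} by apply: contcB; [exact: cvg_id|exact: contc_cst].
apply: contrM; last exact: cst_continuous.
by apply: contc_Re; apply: contcM c0 (contc_conj c0).
Qed.

Lemma cont_bump p r z : {for z, continuous (bump p r)}.
Proof.
apply: (@cont_comp _ _ _ (sqdist p r) beta); first exact: cont_sqdist.
exact: derivable_real_continuous (is_derive_beta _).
Qed.

Lemma cont_bump_partial p r z :
  {for z, continuous (bumpx p r)} /\ {for z, continuous (bumpy p r)}.
Proof.
have c0 : {for z, continuous (fun w : C => w - p)} by apply: contcB; [exact: cvg_id|exact: contc_cst].
have c1 : {for z, continuous (fun z => dbeta (sqdist p r z) / r ^+ 2)}.
  apply: contrM; last exact: cst_continuous.
  by apply: (@cont_comp _ _ _ (sqdist p r) dbeta); [exact: cont_sqdist|exact: cont_dbeta].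
split; apply: contrM c1 _; apply: contrM; try exact: cst_continuous.
  exact: contc_Re.
exact: contc_Im.
Qed.

Lemma bump01 p r z : 0 <= bump p r z <= 1. Proof. exact: beta01. Qed.

Lemma bump_out p r z : 0 < r -> r <= normc (z - p) ->
  [/\ bump p r z = 0, bumpx p r z = 0 & bumpy p r z = 0].
Proof.
move=> r0 h; have [e1 e2] : beta (sqdist p r z) = 0 /\ dbeta (sqdist p r z) = 0.
  apply: beta_out; rewrite sqdistE -[1](expr1n _ 2) ler_pXn2r ?nnegrE ?divr_ge0 ?normc_ge0 ?(ltW r0)//.
  by rewrite ler_pdivlMr// mul1r.
by rewrite /bump /bumpx /bumpy e1 e2 !mul0r.
Qed.

Lemma bump_in p r z : 0 < r -> normc (z - p) <= r / 2 ->
  [/\ bump p r z = 1, bumpx p r z = 0 & bumpy p r z = 0].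
Proof.
move=> r0 h; have [e1 e2] : beta (sqdist p r z) = 1 /\ dbeta (sqdist p r z) = 0.
  apply: beta_in; rewrite sqdistE (_ : 1 / 4 = (1 / 2) ^+ 2); last by field.
  rewrite ler_pXn2r ?nnegrE ?divr_ge0 ?normc_ge0 ?(ltW r0)//.
  by rewrite ler_pdivrMr//; lra.
by rewrite /bump /bumpx /bumpy e1 e2 !mul0r.
Qed.

End Bump.

(** * Residues at a pole as area integrals *)

Section Residues.
Variable R : realType.
Local Notation C := (cplane R).
Implicit Types (p z : C) (r : R).

Lemma cintegrable0 (A : set C) : cintegrable A (fun=> 0) /\ area_integral A (fun=> 0) = 0.
Proof.
split; first by split; apply: integrable0.
by rewrite /area_integral /Rintegral /= !integral0.
Qed.

Lemma compact_closed_disc p r : compact [set z : C | normc (z - p) <= r].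
Proof.
apply: (@subclosed_compact _ _ (box_set (Re p - r) (Re p + r) (Im p - r) (Im p + r))).
- have -> : [set z : C | normc (z - p) <= r] = ~` [set z : C | r < normc (z - p)].
    by apply/seteqP; split => z /=; [move=> h /(le_lt_trans h); rewrite ltxx|move=> /negP; rewrite -leNgt].
  apply: open_closedC; apply: normcP_open => z /= zr.
  exists (normc (z - p) - r); first by rewrite subr_gt0.
  by move=> w wz; have := normc_triangle z p w; rewrite (normcB z w); lra.
- exact: compact_box.
move=> z /= h; have := le_trans (Re_le_normc _) h; have := le_trans (Im_le_normc _) h.
by rewrite ReB ImB /box_set /= !ler_norml => /andP[h1 h2] /andP[h3 h4]; split; apply/andP; split; lra.
Qed.

Lemma compact_annulus p r (s : R) : compact [set z : C | s <= normc (z - p) <= r].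
Proof.
have -> : [set z : C | s <= normc (z - p) <= r] =
   [set z : C | normc (z - p) <= r] `&` ~` [set z : C | normc (z - p) < s].
  apply/seteqP; split => z /= => [/andP[h ->]|[-> /negP]]; last by rewrite -leNgt andbT.
  by split => //; apply/negP; rewrite -leNgt.
apply: compact_closedI; first exact: compact_closed_disc.
by apply: open_closedC; exact: open_disc.
Qed.

Lemma area_integral_sum (A : set C) n (F : 'I_n -> C -> C) : measurable (plane_set A) ->
  (forall i, cintegrable A (F i)) ->
  cintegrable A (fun z => \sum_(i < n) F i z) /\
  area_integral A (fun z => \sum_(i < n) F i z) = \sum_(i < n) area_integral A (F i).
Proof.
move=> mA; elim: n F => [|n IH] F iF.
  rewrite big_ord0; under eq_fun do rewrite big_ord0.
  exact: cintegrable0.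
have [h1 h2] := IH (fun i => F (lift ord0 i)) (fun i => iF _).
rewrite big_ord_recl -h2; under eq_fun do rewrite big_ord_recl.
by split; [exact: cintegrableD|exact: area_integralD].
Qed.

(** Twice the derivative of the bump in the conjugate variable; it lives on the annulus of radii
    [r / 2] and [r], away from the pole. *)
Definition gradb p r z : C := (bumpx p r z)%:C + 'i%C * (bumpy p r z)%:C.

Lemma cont_gradb p r z : {for z, continuous (gradb p r)}.
Proof.
have [cx cy] := cont_bump_partial p r z.
apply: contcD; first exact: contc_real.
by apply: contcM; [exact: contc_cst|exact: contc_real].
Qed.

Lemma gradb_eq0 p r z : 0 < r -> ~ (r / 2 <= normc (z - p) <= r) -> gradb p r z = 0.
Proof.
move=> r0 /negP; rewrite negb_and -!ltNge /gradb => /orP[/ltW h|/ltW h].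
  by have [_ -> ->] := bump_in r0 h; rewrite mulr0 addr0.
by have [_ -> ->] := bump_out r0 h; rewrite mulr0 addr0.
Qed.

Lemma cont_near_eq (f g : C -> C) z : (\forall w \near z, f w = g w) ->
  {for z, continuous f} -> {for z, continuous g}.
Proof.
move=> h c; apply/continuous_normcP => e e0; have /continuous_normcP/(_ e e0)[d d0 hd] := c.
have /nbhs_normcP[d' d'0 hd'] := h.
exists (Num.min d d'); first by rewrite lt_min d0.
move=> w; rewrite lt_min => /andP[w1 w2].
by rewrite -hd'// -hd' ?subrr ?normc0//; exact: hd.
Qed.

(** A singularity of [F] at [p] is harmless, since [gradb] vanishes identically near [p]. *)
Lemma cont_gradbM p r z (F : C -> C) : 0 < r ->
  (z != p -> {for z, continuous F}) -> {for z, continuous (fun w => gradb p r w * F w)}.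
Proof.
move=> r0 cF; have [->|zp] := eqVneq z p; last by apply: contcM (cF zp); exact: cont_gradb.
apply: (@cont_near_eq (fun=> 0)); last exact: contc_cst.
have h : normc (p - p) < r / 2 by rewrite subrr normc0 divr_gt0.
apply: filterS (near_disc h) => w hw.
by rewrite gradb_eq0 ?mul0r// => /andP[]; rewrite leNgt hw.
Qed.

(** Write [f] as its Taylor polynomial of degree below [m] plus [(z - p) ^+ m] times a holomorphic
    [h]. The last part meets [H] in the holomorphic product [k * h], and its integral against
    [gradb] is [0] by Stokes' formula for [bump * k * h]. Only the derivatives of order below [m]
    remain. *)
Lemma residue_pairing p r (H k : C -> C) m : 0 < r ->
  (forall z, normc (z - p) < 2 * r -> derivable k z 1) ->
  (forall z, normc (z - p) < 2 * r -> z != p -> (z - p) ^+ m * H z = k z) ->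
  exists c : nat -> C, forall f,
    (forall z, normc (z - p) < 4 * r -> derivable f z 1) ->
    cintegrable setT (zext [set z | normc (z - p) < 2 * r] (fun z => gradb p r z * H z * f z)) /\
    area_integral setT (zext [set z | normc (z - p) < 2 * r] (fun z => gradb p r z * H z * f z)) =
    \sum_(j < m) c j * iter j (@cder R) f p.
Proof.
move=> r0 dk Hk; set D := [set z | _].
have oD : open D by exact: open_disc.
have mD := open_plane_measurable oD.
have cKr := @compact_annulus p r (r / 2); set K := [set z | _] in cKr.
have KD : K `<=` D by move=> z /= /andP[_ h]; apply: le_lt_trans h _; lra.
have cH z : D z -> z != p -> {for z, continuous H}.
  move=> Dz zp; apply: (@cont_near_eq (fun w => k w / (w - p) ^+ m)).
    have n1 : \forall w \near z, D w by exact: near_disc.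
    have n2 : \forall w \near z, w != p.
      have zp0 : 0 < normc (z - p) by rewrite normc_gt0 subr_eq0.
      apply/nbhs_normcP; exists (normc (z - p)) => // w; apply: contraTneq => ->.
      by rewrite -leNgt normcB.
    near=> w; have wp : w != p by near: w.
    have wp0 : (w - p) ^+ m != 0 by rewrite expf_neq0// subr_eq0.
    by rewrite -Hk//; [rewrite mulrC mulKf|near: w].
  apply: contcM; first exact: derivable_continuous_at (dk z Dz).
  apply: contcV; first by rewrite expf_neq0// subr_eq0.
  by apply: contcX; apply: contcB; [exact: cvg_id|exact: contc_cst].
pose G j z := gradb p r z * (H z * (z - p) ^+ j).
have iG j : cintegrable D (G j).
  apply/(cintegrable_zext _ mD); apply: (cintegrable_zext_compact oD cKr KD).
    move=> z Dz; apply: cont_gradbM => // zp; apply: contcM (cH z Dz zp) _.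
    by apply: contcX; apply: contcB; [exact: cvg_id|exact: contc_cst].
  by move=> z Dz Kz; rewrite /G gradb_eq0// mul0r.
(* The coefficients are integrals of [gradb * H * (z - p) ^+ j]: they are fixed before [f] is
   given. *)
exists (fun j => area_integral D (G j) / (j`!)%:R) => f df.
have r40 : 0 < 4 * r by lra.
have [M M0 /(_ m)[h [dh _ tay _]]] := taylor r40 df.
have e42 : 4 * r / 2 = 2 * r by field.
rewrite e42 in dh tay.
pose V z := (bump p r z)%:C * (k z * h z).
have dkh z : D z -> is_derive z 1 (fun z => k z * h z) (cder (fun z => k z * h z) z).
  move=> Dz; apply: derivable_is_derive.
  exact: is_derive_derivable (is_derivecM (derivable_is_derive (dk z Dz)) (derivable_is_derive (dh z Dz))).
pose A z := (bumpx p r z)%:C * (k z * h z) + (bump p r z)%:C * cder (fun z => k z * h z) z.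
pose B z := (bumpy p r z)%:C * (k z * h z) + (bump p r z)%:C * ('i%C * cder (fun z => k z * h z) z).
have hkh : holomorphic_on D (fun z => k z * h z).
  by move=> z Dz; exact: is_derive_derivable (dkh z Dz).
have ckh z : D z -> {for z, continuous (fun z => k z * h z)} by exact: holomorphic_continuous.
have cdkh z : D z -> {for z, continuous (cder (fun z => k z * h z))}.
  by apply: holomorphic_continuous; exact: holomorphic_cder.
have St : area_integral D (fun z => A z + 'i%C * B z) = 0.
  have [] := @Stokes_compact R D [set z | normc (z - p) <= r] V A B oD (@compact_closed_disc p r).
  - by move=> z /= hz; apply: le_lt_trans hz _; lra.
  - move=> z Dz; exact: pderivM (pderiv_bump p r z) (pderiv_holomorphic (dkh z Dz)).
  - move=> z Dz; have [cx _] := cont_bump_partial p r z; apply: contcD.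
      by apply: contcM (ckh z Dz); exact: contc_real.
    by apply: contcM (cdkh z Dz); apply: contc_real; exact: cont_bump.
  - move=> z Dz; have [_ cy] := cont_bump_partial p r z; apply: contcD.
      by apply: contcM (ckh z Dz); exact: contc_real.
    apply: contcM; first by apply: contc_real; exact: cont_bump.
    by apply: contcM (cdkh z Dz); exact: contc_cst.
  - move=> z Dz /= /negP; rewrite -ltNge => /ltW hz.
    by rewrite /V; have [-> _ _] := bump_out r0 hz; rewrite mul0r.
  by [].
have eF z : D z -> gradb p r z * H z * f z =
    \sum_(j < m) (iter j (@cder R) f p / (j`!)%:R) * G j z + gradb p r z * (k z * h z).
  move=> Dz; have [->|zp] := eqVneq z p.
    have g0 : gradb p r p = 0.
      by apply: gradb_eq0 => //; rewrite subrr normc0 => /andP[]; rewrite leNgt divr_gt0.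
    rewrite g0 !mul0r addr0 big1// => j _; by rewrite /G g0 mul0r mulr0.
  rewrite (tay z Dz) -(Hk z Dz zp) [in LHS]mulrDr mulr_sumr; congr (_ + _); last by ring.
  by apply: eq_bigr => j _; rewrite /G; ring.
have iGs : cintegrable D (fun z => \sum_(j < m) (iter j (@cder R) f p / (j`!)%:R) * G j z) /\
  area_integral D (fun z => \sum_(j < m) (iter j (@cder R) f p / (j`!)%:R) * G j z) =
  \sum_(j < m) area_integral D (fun z => (iter j (@cder R) f p / (j`!)%:R) * G j z).
  by apply: area_integral_sum => // j; apply: cintegrableZ.
have ikh : cintegrable D (fun z => gradb p r z * (k z * h z)).
  apply/(cintegrable_zext _ mD); apply: (cintegrable_zext_compact oD cKr KD).
    by move=> z Dz; apply: contcM (ckh z Dz); exact: cont_gradb.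
  by move=> z Dz Kz; rewrite gradb_eq0// mul0r.
have -> : zext D (fun z => gradb p r z * H z * f z) =
  zext D (fun z => \sum_(j < m) (iter j (@cder R) f p / (j`!)%:R) * G j z + gradb p r z * (k z * h z)).
  by apply/funext => z; rewrite /zext; case: ifPn => //; rewrite inE => /eF.
have [iG1 iG2] := iGs; split.
  by apply/(cintegrable_zext _ mD); exact: cintegrableD.
rewrite area_integral_zext area_integralD// iG2.
have -> : area_integral D (fun z => gradb p r z * (k z * h z)) = 0.
  rewrite -St; apply: eq_area_integral => z Dz; rewrite /A /B /gradb.
  rewrite [in RHS]mulrDr.
  have -> : 'i%C * ((bump p r z)%:C * ('i%C * cder (fun z0 : C => k z0 * h z0) z)) =
     - ((bump p r z)%:C * cder (fun z0 : C => k z0 * h z0) z).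
    have i2 : 'i%C * 'i%C = -1 :> C by rewrite -expr2 sqr_i.
    by rewrite mulrCA [X in _ * X]mulrA i2 mulN1r mulrN.
  ring.
rewrite addr0; apply: eq_bigr => j _; rewrite area_integralZ//; ring.
Unshelve. all: by end_near.
Qed.

End Residues.

(** * Square integrability of the derivative and the pairing formula *)

Section RepresentationFormula.
Variable R : realType.
Local Notation C := (cplane R).
Implicit Types (z w : C).

Lemma compact_finite_union n (K : 'I_n -> set C) : (forall i, compact (K i)) ->
  compact [set z | exists i, K i z].
Proof.
elim: n K => [|n IH] K cK.
  rewrite (_ : [set z | _] = set0); first exact: compact0.
  by apply/seteqP; split => // z [[]].
rewrite (_ : [set z | _] = K ord0 `|` [set z | exists i : 'I_n, K (lift ord0 i) z]).
  by apply: compactU => //; apply: IH => i; exact: cK.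
apply/seteqP; split => z /= => [[i Kz]|[Kz|[i Kz]]]; [|by exists ord0|by exists (lift ord0 i)].
by case: (unliftP ord0 i) Kz => [j|] -> Kz; [right; exists j|left].
Qed.

Lemma pderiv_sum n (V A B : 'I_n -> C -> C) z :
  (forall i, pderiv (V i) z (A i z) (B i z)) ->
  pderiv (fun w => \sum_(i < n) V i w : C) z (\sum_(i < n) A i z) (\sum_(i < n) B i z).
Proof.
elim: n V A B => [|n IH] V A B dV.
  by under eq_fun do rewrite big_ord0; rewrite !big_ord0; exact: pderiv_cst.
under eq_fun do rewrite big_ord_recl; rewrite !big_ord_recl.
apply: pderivD; first exact: dV.
by apply: (IH (fun i => V (lift ord0 i)) (fun i => A (lift ord0 i)) (fun i => B (lift ord0 i))) => i; exact: dV.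
Qed.

Lemma cont_sumr n (F : 'I_n -> C -> R) z : (forall i, {for z, continuous (F i)}) ->
  {for z, continuous (fun w => \sum_(i < n) F i w)}.
Proof.
elim: n F => [|n IH] F cF.
  have -> : (fun w : C => \sum_(i < 0) F i w) = fun=> 0 by apply/funext => w; rewrite big_ord0.
  exact: cst_continuous.
have -> : (fun w : C => \sum_(i < n.+1) F i w) = fun w => F ord0 w + \sum_(i < n) F (lift ord0 i) w.
  by apply/funext => w; rewrite big_ord_recl.
by apply: contrD; [exact: cF|apply: (IH (fun i => F (lift ord0 i))); move=> i; exact: cF].
Qed.

Lemma conjc_iM (w : C) : (('i%C * w)^*)%C = - 'i%C * (w^*)%C :> C.
Proof. by case: w => a b; apply/eqP; rewrite eq_complex /=; apply/andP; split; apply/eqP; ring. Qed.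

(** With [a] and [b] the conjugates of [h'] and [H'], it recovers twice the conjugate of [h'] from
    those of [P'] and [Q'], the derivatives of [h - H] and [i (h + H)]. *)
Lemma conj_sum_identity (w v a b : C) :
  2 * (w * (v * a)) = w * (a - b) * v + 'i%C * (w * (- 'i%C * (a + b)) * v).
Proof.
have i2 : 'i%C * 'i%C = -1 :> C by rewrite -expr2 sqr_i.
have -> : 'i%C * (w * (- 'i%C * (a + b)) * v) = - ('i%C * 'i%C) * (w * (a + b) * v) by ring.
by rewrite i2; ring.
Qed.

Lemma eq_cintegrable (A : set C) (f g : C -> C) : measurable (plane_set A) ->
  (forall z, A z -> f z = g z) -> cintegrable A f -> cintegrable A g.
Proof.
move=> mA fg /(cintegrable_zext _ mA) h; apply/(cintegrable_zext _ mA).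
suff -> : zext A g = zext A f by [].
by apply/funext => z; rewrite /zext; case: ifPn => //; rewrite inE => /fg.
Qed.

Variables (Omega : set C) (h H : C -> C) (n : nat) (p : 'I_n -> C) (r : R).
Hypotheses (oO : open Omega) (hh : holomorphic_on Omega h) (r0 : 0 < r).
(** The bumps live on discs of radius [r] and the residue computation on discs of radius [2 r],
    which [sep] makes disjoint; the Taylor expansion used there starts from radius [4 r] and halves
    it. *)
Hypothesis discO : forall i z, normc (z - p i) < 4 * r -> Omega z.
Hypothesis sep : forall i j, i != j -> 4 * r <= normc (p i - p j).
Variables (m : 'I_n -> nat) (k : 'I_n -> C -> C).
Hypothesis hk : forall i z, normc (z - p i) < 2 * r -> derivable (k i) z 1.
Hypothesis Hk : forall i z, normc (z - p i) < 2 * r -> z != p i ->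
  (z - p i) ^+ m i * H z = k i z.
Definition punctured : set C := [set z | Omega z /\ forall i, z != p i].
Local Notation U := punctured.
Hypothesis hH : holomorphic_on U H.
Hypothesis boundary_eq : forall e : R, 0 < e -> exists K : set C,
  [/\ compact K, K `<=` Omega &
      forall z, Omega z -> ~ K z -> normc ((h z)^*%C - H z) < e].

Lemma punctured_open : open U.
Proof.
have -> : U = Omega `&` ~` [set z | exists i, z = p i].
  apply/seteqP; split => z /= [Oz hz]; split => //.
    by move=> [i e]; have := hz i; rewrite e eqxx.
  by move=> i; apply/eqP => e; apply: hz; exists i.
apply: openI => //; apply: closed_openC; apply: closed_compactC.
by apply: compact_finite_union => i; exact: compact_set1.
Qed.
Let oU := punctured_open.
Let mU := open_plane_measurable oU.
Let mO := open_plane_measurable oO.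

Lemma sum_local (V : zmodType) (F : 'I_n -> V) i z : normc (z - p i) < 2 * r ->
  (forall j, r <= normc (z - p j) -> F j = 0) -> \sum_j F j = F i.
Proof.
move=> zi F0; rewrite (bigD1 i)//= big1 ?addr0// => j ji; apply: F0.
have := sep ji; have := normc_triangle (p j) (p i) z.
have := r0; rewrite (normcB (p j) z); lra.
Qed.

Definition eta z := \sum_i bump (p i) r z.
Definition etax z := \sum_i bumpx (p i) r z.
Definition etay z := \sum_i bumpy (p i) r z.

Lemma near_pole z : (exists i, normc (z - p i) < r) \/ (forall i, r <= normc (z - p i)).
Proof.
have [|nex] := pselect (exists i, normc (z - p i) < r); first by left.
by right => i; rewrite leNgt; apply/negP => hi; apply: nex; exists i.
Qed.

Lemma eta_local i z : normc (z - p i) < 2 * r ->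
  [/\ eta z = bump (p i) r z, etax z = bumpx (p i) r z & etay z = bumpy (p i) r z].
Proof.
by move=> zi; split; apply: sum_local zi _ => j /(bump_out r0)[].
Qed.

Lemma eta_far z : (forall i, r <= normc (z - p i)) -> [/\ eta z = 0, etax z = 0 & etay z = 0].
Proof. by move=> hz; split; apply: big1 => i _; have [] := bump_out r0 (hz i). Qed.

Lemma eta01 z : 0 <= eta z <= 1.
Proof.
have [[i zi]|/eta_far[-> _ _]] := near_pole z; last by rewrite lexx ler01.
by have [|-> _ _] := @eta_local i z; [have := r0; lra|exact: bump01].
Qed.

Definition K0 := [set z | exists i, r / 2 <= normc (z - p i) <= r].

Lemma compact_K0 : compact K0.
Proof. by apply: compact_finite_union => i; exact: compact_annulus. Qed.

Lemma K0_sub : K0 `<=` U.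
Proof.
move=> z [i /andP[zi1 zi2]]; split; first by apply: (@discO i); have := r0; lra.
move=> j; apply/negP => /eqP zj; have [e|ij] := eqVneq i j.
  by move: zi1; rewrite zj e subrr normc0; have := r0; lra.
by have := sep ij; have := r0; rewrite normcB -zj; lra.
Qed.

Lemma grad_eta0 z : ~ K0 z -> etax z = 0 /\ etay z = 0.
Proof.
move=> Kz; have [[i zi]|/eta_far[_ -> ->]//] := near_pole z.
have [|_ -> ->] := @eta_local i z; first by have := r0; lra.
have [h1|h1] := leP (normc (z - p i)) (r / 2); first by have [_ -> ->] := bump_in r0 h1.
by exfalso; apply: Kz; exists i; rewrite (ltW h1) ltW.
Qed.

Let W z := 1 - eta z.
Let Wx z := - etax z.
Let Wy z := - etay z.

Lemma pderiv_eta z : pderiv (fun w => (eta w)%:C : C) z (etax z)%:C (etay z)%:C.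
Proof.
have := @pderiv_sum n (fun i w => (bump (p i) r w)%:C) (fun i w => (bumpx (p i) r w)%:C)
  (fun i w => (bumpy (p i) r w)%:C) z (fun i => pderiv_bump (p i) r z).
rewrite -!rmorph_sum.
have -> : (fun w => \sum_(i < n) (bump (p i) r w)%:C : C) = fun w => (eta w)%:C.
  by apply/funext => w; rewrite /eta rmorph_sum.
by [].
Qed.

Lemma cont_eta z : {for z, continuous eta}.
Proof. by apply: cont_sumr => i; exact: cont_bump. Qed.

Lemma cont_etax z : {for z, continuous etax}.
Proof. by apply: cont_sumr => i; have [] := cont_bump_partial (p i) r z. Qed.

Lemma cont_etay z : {for z, continuous etay}.
Proof. by apply: cont_sumr => i; have [] := cont_bump_partial (p i) r z. Qed.

Let dW z : U z -> pderiv (fun w => (W w)%:C : C) z (Wx z)%:C (Wy z)%:C.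
Proof.
move=> _; have h1 := pderivD (pderiv_cst 1 z) (pderivM (pderiv_cst (-1) z) (pderiv_eta z)).
have h2 : pderiv (fun w => (W w)%:C : C) z (0 + (0 * (eta z)%:C + -1 * (etax z)%:C))
    (0 + (0 * (eta z)%:C + -1 * (etay z)%:C)).
  have -> : (fun w => (W w)%:C : C) = fun w => 1 + -1 * (eta w)%:C.
    by apply/funext => w; rewrite /W rmorphB mulN1r.
  by [].
by apply: pderiv_eq h2 _ _; rewrite mul0r !add0r mulN1r /Wx /Wy rmorphN.
Qed.

Let cW z : U z -> {for z, continuous W}.
Proof. by move=> _; apply: continuousB; [exact: cst_continuous|exact: cont_eta]. Qed.
Let cWx z : U z -> {for z, continuous Wx}.
Proof. by move=> _; apply: continuousN; exact: cont_etax. Qed.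
Let cWy z : U z -> {for z, continuous Wy}.
Proof. by move=> _; apply: continuousN; exact: cont_etay. Qed.
Let W01 z : U z -> 0 <= W z <= 1.
Proof. by move=> _; have := eta01 z; rewrite /W; lra. Qed.
Let gradW0 z : U z -> ~ K0 z -> Wx z = 0 /\ Wy z = 0.
Proof. by move=> _ /grad_eta0[e1 e2]; rewrite /Wx /Wy e1 e2 oppr0. Qed.

Lemma W_pole i : W (p i) = 0.
Proof.
have h2 : normc (p i - p i) <= r / 2 by rewrite subrr normc0 ltW// divr_gt0.
have [|e _ _] := @eta_local i (p i); first by rewrite subrr normc0 mulr_gt0.
by rewrite /W e; have [-> _ _] := bump_in r0 h2; rewrite subrr.
Qed.

Let boundary_cutoff (P : C -> C) :
  (forall z, U z -> `|Re (P z)| <= normc ((h z)^*%C - H z)) ->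
  forall e : R, 0 < e -> exists K : set C,
  [/\ compact K, K `<=` U & forall z, U z -> ~ K z -> W z = 0 \/ `|Re (P z)| < e].
Proof.
move=> hP e e0; have [K [cK KO hK]] := boundary_eq e0.
(* Removing the open half discs, on which [W] is [0], turns a compact subset of [Omega] into a
   compact subset of the punctured domain. *)
exists (K `&` ~` [set z | exists i, normc (z - p i) < r / 2]); split.
- apply: compact_closedI => //; apply: open_closedC.
  apply: normcP_open => z /= [i zi]; have [d d0 hd] := open_normcP (@open_disc _ (p i) (r / 2)) zi.
  by exists d => // w wz; exists i; exact: hd.
- move=> z [Kz nz]; split; first exact: KO.
  by move=> i; apply/eqP => zp; apply: nz; exists i; rewrite zp subrr normc0 divr_gt0.
- move=> z Uz; have [Kz|nK] := pselect (K z).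
    move=> /not_andP[//|/contrapT[i zi]]; left.
    have [|E _ _] := @eta_local i z; first by have := r0; lra.
    by rewrite /W E; have [-> _ _] := bump_in r0 (ltW zi); rewrite subrr.
  by move=> _; right; apply: le_lt_trans (hP z Uz) (hK z _ nK); case: Uz.
Qed.

Let UO z : U z -> Omega z. Proof. by case. Qed.
Let hhU : holomorphic_on U h. Proof. by move=> z /UO /hh. Qed.

(* [Re P] and [Re Q] are the real and imaginary parts of [h^* - H]. *)
Let P : C -> C := fun z => h z - H z.
Let Q : C -> C := fun z => 'i%C * (h z + H z).

Lemma is_derive_PQ z : U z -> is_derive z 1 P (cder h z - cder H z) /\
  is_derive z 1 Q ('i%C * (cder h z + cder H z)).
Proof.
move=> Uz; have dh := holomorphic_is_derive hhU Uz; have dH := holomorphic_is_derive hH Uz.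
split; first exact: is_derivecB.
have := is_derivecM (is_derivec_cst z ('i%C : C)) (is_derivecD dh dH).
by move=> d; apply: is_derive_eq d _; rewrite mul0r add0r.
Qed.

Let hP : holomorphic_on U P. Proof. by move=> z /is_derive_PQ[/is_derive_derivable]. Qed.
Let hQ : holomorphic_on U Q. Proof. by move=> z /is_derive_PQ[_ /is_derive_derivable]. Qed.

Lemma cder_PQ z : U z -> cder P z = cder h z - cder H z /\
  cder Q z = 'i%C * (cder h z + cder H z).
Proof. by move=> /is_derive_PQ[/is_derive_val e1 /is_derive_val e2]; rewrite /cder e1 e2. Qed.

Let bP := boundary_cutoff (P := P).
Let bQ := boundary_cutoff (P := Q).

Let ReP_le z : U z -> `|Re (P z)| <= normc ((h z)^*%C - H z).
Proof.
move=> _; apply: le_trans (Re_le_normc _); rewrite /P !ReB.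
by case: (h z) => x y /=.
Qed.

Let ReQ_le z : U z -> `|Re (Q z)| <= normc ((h z)^*%C - H z).
Proof.
move=> _; apply: le_trans (Im_le_normc _); rewrite /Q ReM ImB /= ImD mul0r mul1r sub0r.
by case: (h z) => x y /=; rewrite -opprD.
Qed.

Let eLP := energy_limit oU hP dW cW cWx cWy W01 (bP ReP_le) compact_K0 K0_sub gradW0.
Let eLQ := energy_limit oU hQ dW cW cWx cWy W01 (bQ ReQ_le) compact_K0 K0_sub gradW0.
Let iWP := W_energy_integrable oU hP dW cW cWx cWy W01 (bP ReP_le) compact_K0 K0_sub gradW0.
Let iWQ := W_energy_integrable oU hQ dW cW cWx cWy W01 (bQ ReQ_le) compact_K0 K0_sub gradW0.

(** Integrands that vanish at the poles have literally the same extension from [Omega] and from the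
    punctured domain, so no null set has to be discarded. *)
Lemma zext_punctured (V : zmodType) (F : C -> V) : (forall i, F (p i) = 0) ->
  zext U F = zext Omega F.
Proof.
move=> F0; apply/funext => z; have [Oz|nO] := pselect (Omega z).
  have [Uz|nU] := pselect (U z); first by rewrite !zextT.
  rewrite zextN// zextT//; have [i ->] : exists i, z = p i; last by rewrite F0.
  apply: contrapT => nex; apply: nU; split => // i; apply/eqP => e; apply: nex.
  by exists i.
by rewrite !zextN// => -[].
Qed.

Let O_h' : holomorphic_on Omega (cder h). Proof. exact: holomorphic_cder. Qed.

Definition Keta := [set z : C | exists i, normc (z - p i) <= r].

Lemma compact_Keta : compact Keta.
Proof. by apply: compact_finite_union => i; exact: compact_closed_disc. Qed.

Lemma Keta_sub : Keta `<=` Omega.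
Proof. by move=> z [i zi]; apply: (@discO i); have := r0; lra. Qed.

Lemma eta_out z : ~ Keta z -> eta z = 0.
Proof.
move=> Kz; have [|//] := @eta_far z.
by move=> i; rewrite leNgt; apply/negP => /ltW zi; apply: Kz; exists i.
Qed.

(** Split [1 = eta + W]. The part with [eta] has compact support; the part with [W] is dominated by
    the two energies, those of [P] and [Q]. *)
Theorem cder_bergman : bergman_space Omega (cder h).
Proof.
split => //; apply/(integrable_zext (fun z => normc (cder h z) ^+ 2) mO).
have c2 z : Omega z -> {for z, continuous (fun z => normc (cder h z) ^+ 2)}.
  move=> Oz; apply: (@cont_comp _ _ _ (fun z => normc (cder h z)) (fun x : R => x ^+ 2)).
    exact: contc_normc (holomorphic_continuous O_h' Oz).
  exact: exprn_continuous.
have i1 : (area R).-integrable setT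
    (EFin \o on_plane (zext Omega (fun z => eta z * normc (cder h z) ^+ 2))).
  pose g (z : C) : C := (eta z * normc (cder h z) ^+ 2)%:C.
  have cg z : Omega z -> {for z, continuous g}.
    by move=> Oz; apply: contc_real; apply: contrM (c2 z Oz); exact: cont_eta.
  have g0 z : Omega z -> ~ Keta z -> g z = 0.
    by move=> Oz Kz; rewrite /g eta_out// mul0r.
  have [h1 _] := cintegrable_zext_compact oO compact_Keta Keta_sub cg g0.
  by rewrite Re_zext in h1.
have mT : measurable (plane_set (setT : set C)) by exact: measurable_plane_setT.
have i2 := integrable_lin 1 1 mT i1 (integrable_lin 1 1 mT iWP iWQ).
apply: le_integrable i2 => //.
  by apply/measurable_EFinP; exact: measurable_zext.
move=> q _ /=; rewrite lee_fin /on_plane /zext; set z := q.1 +i* q.2.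
have E01 := eta01 z; have N0 := sqr_ge0 (normc (cder h z)).
case: ifPn => [|_]; last first.
  by rewrite (_ : `|0| = 0 :> R); [exact: normr_ge0|exact: normr0].
rewrite inE => Oz; rewrite (ger0_norm N0).
have [Uz|nU] := pselect (U z); last first.
  rewrite memNset// !mulr0 !addr0 mul1r.
  have [i zp] : exists i, z = p i.
    apply: contrapT => nex; apply: nU; split => // i; apply/eqP => e; apply: nex.
    by exists i.
  have /eqP := W_pole i; rewrite -zp /W subr_eq0 => /eqP <-.
  by rewrite mulr0 addr0 mul1r ler_norm.
rewrite mem_set//; apply: le_trans (ler_norm _).
have [-> ->] := cder_PQ Uz; rewrite !mul1r.
have W0 : 0 <= W z by rewrite /W; lra.
(* By the parallelogram law the right side is twice the sum of the squared moduli of [h'] and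
   [H']. *)
have par : normc (cder h z) ^+ 2 <= normc (cder h z - cder H z) ^+ 2 +
    normc ('i%C * (cder h z + cder H z)) ^+ 2.
  rewrite normcM normc_i mul1r !sqr_normcE.
  case: (cder h z) => a b; case: (cder H z) => c d /=.
  by have := sqr_ge0 c; have := sqr_ge0 d; have := sqr_ge0 a; have := sqr_ge0 b; nra.
rewrite -mulrDr; have := ler_wpM2l W0 par; rewrite {1}/W; lra.
Qed.

(** With [gE] the gradient of [eta] in complex form, [energy_limit] for [P] and [Q] turns the part
    with [W] into the integral of [gE * (h^* - H) * f], since [gradW = - gE]. Stokes' formula turns
    the part with [eta] into minus the integral of [gE * h^* * f]. Their sum is minus the integral
    of [gE * H * f], which [residue_pairing] evaluates pole by pole. *)
Theorem representation : exists c : 'I_n -> nat -> C, forall f, bergman_space Omega f ->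
  area_integral Omega (fun z => f z * ((cder h z)^*)%C) =
  \sum_i \sum_(j < m i) c i j * iter j (@cder R) f (p i).
Proof.
have /choice[c hc] : forall i, exists ci : nat -> C, forall f : C -> C,
    (forall z, normc (z - p i) < 4 * r -> derivable f z 1) ->
    cintegrable setT (zext [set z | normc (z - p i) < 2 * r]
      (fun z => gradb (p i) r z * H z * f z)) /\
    area_integral setT (zext [set z | normc (z - p i) < 2 * r]
      (fun z => gradb (p i) r z * H z * f z)) =
    \sum_(j < m i) ci j * iter j (@cder R) f (p i).
  move=> i; exact: residue_pairing r0 (@hk i) (@Hk i).
(* The sign comes from Stokes' formula; the half, from working with twice the derivative in the
   conjugate variable. *)
exists (fun i j => - (c i j / 2)) => f [hf f2].
have hfU : holomorphic_on U f by move=> z /UO /hf.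
have cfU z : U z -> {for z, continuous f} by exact: holomorphic_continuous.
have cf z : Omega z -> {for z, continuous f} by exact: holomorphic_continuous.
have iWf : (area R).-integrable setT
    (EFin \o on_plane (zext U (fun z => W z * normc (f z) ^+ 2))).
  have f2z := (integrable_zext (fun z => normc (f z) ^+ 2) mO).1 f2.
  apply: le_integrable f2z => //.
    apply/measurable_EFinP; apply: measurable_zext => // z Uz.
    apply: contrM; first exact: cW.
    apply: (@cont_comp _ _ _ (fun z => normc (f z)) (fun x : R => x ^+ 2)).
      exact: contc_normc (cfU z Uz).
    exact: exprn_continuous.
  move=> q _ /=; rewrite lee_fin /on_plane /zext; set z := q.1 +i* q.2.
  case: ifPn => [|_]; last by rewrite normr0 normr_ge0.
  rewrite inE => -[Oz _]; rewrite mem_set// normrM ler_piMl//.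
  by have := eta01 z; rewrite /W => E; rewrite ger0_norm; lra.
have [iP eP] := eLP hfU iWf; have [iQ eQ] := eLQ hfU iWf.
have iQ' := cintegrableZ 'i%C mU iQ.
have cgW z : {for z, continuous (gradW Wx Wy)}.
  apply: contcD; first by apply: contc_real; apply: continuousN; exact: cont_etax.
  by apply: contcM; [exact: contc_cst|apply: contc_real; apply: continuousN; exact: cont_etay].
have gW0 z : ~ K0 z -> gradW Wx Wy z = 0.
  by move=> Kz; have [e1 e2] := grad_eta0 Kz; rewrite /gradW /Wx /Wy e1 e2 !oppr0 mulr0 addr0.
have iR (G : C -> C) : holomorphic_on U G ->
    cintegrable U (fun z => gradW Wx Wy z * (Re (G z))%:C * f z).
  move=> hG; apply/(cintegrable_zext _ mU).
  apply: (cintegrable_zext_compact oU compact_K0 K0_sub) => z Uz; last first.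
    by move=> Kz; rewrite gW0// !mul0r.
  apply: contcM (cfU z Uz); apply: contcM; first exact: cgW.
  by apply: contc_real; apply: contc_Re; exact: holomorphic_continuous hG Uz.
have iRP := iR _ hP; have iRQ := iR _ hQ; have iRQ' := cintegrableZ 'i%C mU iRQ.
pose F1 z := 2 * ((W z)%:C * (f z * ((cder h z)^*)%C)).
have eF1 z : U z -> F1 z = (W z)%:C * ((cder P z)^*)%C * f z +
    'i%C * ((W z)%:C * ((cder Q z)^*)%C * f z).
  move=> Uz; have [-> ->] := cder_PQ Uz; rewrite /F1; move: (W z)%:C => w.
  have cB a b : ((a - b)^*)%C = (a^*)%C - (b^*)%C :> C by exact: rmorphB.
  have cD a b : ((a + b)^*)%C = (a^*)%C + (b^*)%C :> C by exact: rmorphD.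
  rewrite conjc_iM cB cD.
  exact: conj_sum_identity.
have e1 : area_integral U F1 =
    - area_integral U (fun z => gradW Wx Wy z * (((h z)^*)%C - H z) * f z).
  rewrite (eq_area_integral eF1).
  apply: (etrans (area_integralD mU iP iQ')).
  apply: (etrans (congr1 (+%R _) (area_integralZ 'i%C mU iQ))).
  apply: (etrans (congr2 (fun a b : C => a + 'i%C * b) eP eQ)).
  have -> : area_integral U (fun z => gradW Wx Wy z * (((h z)^*)%C - H z) * f z) =
      area_integral U (fun z => gradW Wx Wy z * (Re (P z))%:C * f z +
        'i%C * (gradW Wx Wy z * (Re (Q z))%:C * f z)).
    apply: eq_area_integral => z Uz.
    have -> : ((h z)^*)%C - H z = (Re (P z))%:C + 'i%C * (Re (Q z))%:C.
      rewrite /P /Q; case: (h z) => a b; case: (H z) => c' d; apply/eqP.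
      by rewrite eq_complex /=; apply/andP; split; apply/eqP; ring.
    by ring.
  by rewrite (area_integralD mU iRP iRQ') (area_integralZ 'i%C mU iRQ); ring.
pose gE z : C := (etax z)%:C + 'i%C * (etay z)%:C.
have gWE z : gradW Wx Wy z = - gE z.
  by rewrite /gradW /Wx /Wy /gE !rmorphN /= mulrN -opprD.
pose F2 z := 2 * ((eta z)%:C * (f z * ((cder h z)^*)%C)).
have cgE z : {for z, continuous gE}.
  apply: contcD; first by apply: contc_real; exact: cont_etax.
  by apply: contcM; [exact: contc_cst|apply: contc_real; exact: cont_etay].
have ch z : Omega z -> {for z, continuous (fun z => ((h z)^*)%C : C)}.
  by move=> Oz; exact: contc_conj (holomorphic_continuous hh Oz).
have ch' z : Omega z -> {for z, continuous (fun z => ((cder h z)^*)%C : C)}.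
  by move=> Oz; exact: contc_conj (holomorphic_continuous O_h' Oz).
have gE0 z : ~ Keta z -> gE z = 0.
  move=> Kz; rewrite /gE; have [|-> ->] := @grad_eta0 z; last by rewrite mulr0 addr0.
  by move=> [i /andP[_ zi]]; apply: Kz; exists i.
have iF2 : cintegrable Omega F2.
  apply/(cintegrable_zext _ mO).
  apply: (cintegrable_zext_compact oO compact_Keta Keta_sub) => z Oz; last first.
    by move=> Kz; rewrite /F2 eta_out// mul0r mulr0.
  apply: contcM; first exact: contc_cst.
  apply: contcM; first by apply: contc_real; exact: cont_eta.
  by apply: contcM; [exact: cf|exact: ch'].
have igEh : cintegrable Omega (fun z => gE z * ((h z)^*)%C * f z).
  apply/(cintegrable_zext _ mO).
  apply: (cintegrable_zext_compact oO compact_Keta Keta_sub) => z Oz; last first.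
    by move=> Kz; rewrite gE0// !mul0r.
  by apply: contcM (cf z Oz); apply: contcM; [exact: cgE|exact: ch].
have e2 : area_integral Omega F2 = - area_integral Omega (fun z => gE z * ((h z)^*)%C * f z).
  apply/eqP; rewrite -addr_eq0 -area_integralD//; apply/eqP.
  pose A z := (etax z)%:C * (f z * ((h z)^*)%C) +
    (eta z)%:C * (cder f z * ((h z)^*)%C + f z * ((cder h z)^*)%C).
  pose B z := (etay z)%:C * (f z * ((h z)^*)%C) +
    (eta z)%:C * ('i%C * cder f z * ((h z)^*)%C + f z * (('i%C * cder h z)^*)%C).
  have cf' z : Omega z -> {for z, continuous (cder f)}.
    by apply: holomorphic_continuous; exact: holomorphic_cder.
  have [|||<- _] := @Stokes_compact R Omega Keta (fun z => (eta z)%:C * (f z * ((h z)^*)%C))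
     A B oO compact_Keta Keta_sub
     (fun z Oz => pderivM (pderiv_eta z) (pderivM (pderiv_holomorphic (holomorphic_is_derive hf Oz))
       (pderiv_conj (pderiv_holomorphic (holomorphic_is_derive hh Oz))))) _ _ _.
  - move=> z Oz; apply: contcD.
      apply: contcM; first by apply: contc_real; exact: cont_etax.
      by apply: contcM; [exact: cf|exact: ch].
    apply: contcM; first by apply: contc_real; exact: cont_eta.
    by apply: contcD; apply: contcM; [exact: cf'|exact: ch|exact: cf|exact: ch'].
  - move=> z Oz; apply: contcD.
      apply: contcM; first by apply: contc_real; exact: cont_etay.
      by apply: contcM; [exact: cf|exact: ch].
    apply: contcM; first by apply: contc_real; exact: cont_eta.
    apply: contcD; apply: contcM; [|exact: ch|exact: cf|].
      by apply: contcM; [exact: contc_cst|exact: cf'].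
    apply: contc_conj; apply: contcM; first exact: contc_cst.
    exact: holomorphic_continuous O_h' Oz.
  - by move=> z Oz Kz; rewrite eta_out// mul0r.
  apply: eq_area_integral => z Oz; rewrite /F2 /A /B /gE conjc_iM.
  have i2 : 'i%C * 'i%C = -1 :> C by rewrite -expr2 sqr_i.
  move: ((cder h z)^*)%C ((h z)^*)%C (eta z)%:C (etax z)%:C (etay z)%:C (cder f z) => a b w x y f'.
  have -> : 'i%C * (y * (f z * b) + w * ('i%C * f' * b + f z * (- 'i%C * a))) =
    'i%C * y * (f z * b) + ('i%C * 'i%C) * (w * (f' * b - f z * a)) by ring.
  by rewrite i2; ring.
have W_zero i : (W (p i))%:C = 0 :> C by rewrite W_pole.
have e1' : area_integral U F1 = area_integral Omega F1.
  rewrite -(area_integral_zext U) -(area_integral_zext Omega) zext_punctured// => i.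
  by rewrite /F1 W_zero mul0r mulr0.
have gE_pole i : gE (p i) = 0.
  have h2 : normc (p i - p i) <= r / 2 by rewrite subrr normc0 ltW// divr_gt0.
  have [|_ x y] := @eta_local i (p i); first by rewrite subrr normc0 mulr_gt0.
  by rewrite /gE x y; have [_ -> ->] := bump_in r0 h2; rewrite mulr0 addr0.
have iF1 : cintegrable Omega F1.
  apply/(cintegrable_zext _ mO); rewrite -zext_punctured; last first.
    by move=> i; rewrite /F1 W_zero mul0r mulr0.
  apply/(cintegrable_zext _ mU); apply: eq_cintegrable (cintegrableD mU iP iQ') => // z Uz.
  by rewrite eF1.
pose G z := gE z * H z * f z.
(* The two halves are integrals over different sets, the punctured domain and [Omega]. [Gu] and [F1]
   vanish at the poles, so both can be moved to [Omega] and added there. *)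
pose Gu z := gE z * (((h z)^*)%C - H z) * f z.
have Gu0 i : Gu (p i) = 0 by rewrite /Gu gE_pole !mul0r.
have iGu : cintegrable Omega Gu.
  apply/(cintegrable_zext _ mO); rewrite -zext_punctured//.
  apply: (cintegrable_zext_compact oU compact_K0 K0_sub) => z Uz; last first.
    move=> Kz; rewrite /Gu; have -> : gE z = 0; last by rewrite !mul0r.
    by apply/eqP; rewrite -oppr_eq0 -gWE gW0.
  apply: contcM (cfU z Uz); apply: contcM; first exact: cgE.
  by apply: contcB; [apply: ch; case: Uz|exact: holomorphic_continuous hH Uz].
have iG : cintegrable Omega G.
  apply: eq_cintegrable (cintegrableD mO igEh (cintegrableZ (-1) mO iGu)) => // z Oz.
  by rewrite /Gu /G; ring.
have E : 2 * area_integral Omega (fun z => f z * ((cder h z)^*)%C) = - area_integral Omega G.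
  have h2 : cintegrable Omega (fun z => f z * ((cder h z)^*)%C).
    apply: eq_cintegrable (cintegrableZ 2^-1 mO (cintegrableD mO iF1 iF2)) => // z Oz.
    by rewrite /F1 /F2 /W rmorphB /=; field.
  have -> : 2 * area_integral Omega (fun z => f z * ((cder h z)^*)%C) =
      area_integral Omega (fun z => F1 z + F2 z).
    rewrite -area_integralZ//; apply: eq_area_integral => z Oz.
    by rewrite /F1 /F2 /W rmorphB /=; ring.
  rewrite area_integralD// -e1' e1 e2.
  have -> : area_integral U (fun z => gradW Wx Wy z * (((h z)^*)%C - H z) * f z) =
      - area_integral Omega Gu.
    have iGuU : cintegrable U Gu.
      by apply/(cintegrable_zext _ mU); rewrite zext_punctured//; apply/(cintegrable_zext _ mO).
    rewrite -(area_integral_zext Omega) -zext_punctured// area_integral_zext.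
    rewrite -[in RHS]mulN1r -area_integralZ//; apply: eq_area_integral => z _.
    by rewrite gWE /Gu; ring.
  have -> : area_integral Omega G = area_integral Omega (fun z =>
      gE z * ((h z)^*)%C * f z + -1 * Gu z).
    by apply: eq_area_integral => z Oz; rewrite /Gu /G; ring.
  rewrite area_integralD// ?area_integralZ//; last exact: cintegrableZ.
  ring.
pose D i : C -> C := zext [set z | normc (z - p i) < 2 * r] (fun z => gradb (p i) r z * H z * f z).
have eG : zext Omega G = fun z => \sum_i D i z.
  have D0 z i : r <= normc (z - p i) -> D i z = 0.
    move=> zi; rewrite /D /zext; case: ifP => // _.
    by rewrite /gradb; have [_ -> ->] := bump_out r0 zi; rewrite mulr0 addr0 !mul0r.
  apply/funext => z; have [[i zi]|zfar] := near_pole z; last first.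
    rewrite big1; last by move=> i _; exact: D0.
    have [_ x y] := eta_far zfar; rewrite /zext; case: ifP => // _.
    by rewrite /G /gE x y mulr0 addr0 !mul0r.
  have zi2 : normc (z - p i) < 2 * r by have := r0; lra.
  rewrite (sum_local (F := fun i => D i z) zi2 (D0 z)) /D !zextT//; last first.
    by apply: (@discO i); have := r0; lra.
  by have [_ x y] := eta_local zi2; rewrite /G /gE x y.
have dfi i z : normc (z - p i) < 4 * r -> derivable f z 1 by move=> /discO /hf.
have [_ eS] := @area_integral_sum R setT n D (@measurable_plane_setT R)
  (fun i => (hc i f (dfi i)).1).
have t2 : 2 != 0 :> C by rewrite pnatr_eq0.
apply: (mulfI t2); rewrite E -area_integral_zext eG eS mulr_sumr -sumrN.
apply: eq_bigr => i _; rewrite (hc i f (dfi i)).2 mulr_sumr -sumrN.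
by apply: eq_bigr => j _; field.
Qed.

End RepresentationFormula.

(** * Complex extension of real power series *)

Section PowerSeries.
Variable R : realType.
Local Notation C := (cplane R).
Implicit Types (z w : C).

Lemma cvg_series_terms_bounded (u : R^nat) (l : R) : series u @ \oo --> l ->
  exists2 M : R, 0 <= M & forall n, `|u n| <= M.
Proof.
move=> ul; have u0 : u n @[n --> \oo] --> (0 : R).
  by apply: cvg_series_cvg_0; apply/cvg_ex; exists l.
have [M [Mr hM]] := cvg_seq_bounded (cvgP _ u0).
exists (`|M| + 1); first by rewrite addr_ge0.
by move=> n; apply: hM => //; have := ler_norm M; lra.
Qed.

Definition psum (c : nat -> C) N z : C := \sum_(n < N) c n * z ^+ n.

Lemma derivable_psum c N z : derivable (psum c N) z 1.
Proof.
elim: N => [|N IH].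
  have -> : psum c 0 = fun=> 0 by apply/funext => w; rewrite /psum big_ord0.
  exact: is_derive_derivable (is_derivec_cst _ _).
have -> : psum c N.+1 = fun w => psum c N w + c N * w ^+ N.
  by apply/funext => w; rewrite /psum big_ord_recr.
have dX : derivable (fun w : C => w ^+ N) z 1.
  elim: N {IH} => [|N IH]; first exact: is_derive_derivable (is_derivec_cst _ _).
  have -> : (fun w : C => w ^+ N.+1) = fun w => w * w ^+ N by apply/funext => w; rewrite exprS.
  exact: is_derive_derivable (is_derivecM (is_derivec_id z) (derivable_is_derive IH)).
apply: is_derive_derivable (is_derivecD (derivable_is_derive IH) _).
exact: (is_derivecM (is_derivec_cst z (c N)) (derivable_is_derive dX)).
Qed.

Lemma psum_cauchy c (M rho : R) N k z : 0 <= M -> 0 < rho ->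
  (forall n, normc (c n) * rho ^+ n <= M) -> normc z <= rho / 2 ->
  normc (psum c (N + k) z - psum c N z) <= 2 * M * (2^-1 ^+ N - 2^-1 ^+ (N + k)).
Proof.
move=> M0 rho0 cM zr; elim: k => [|k IH]; first by rewrite addn0 !subrr normc0 mulr0.
rewrite addnS {1}/psum big_ord_recr -/(psum c (N + k) z) /=.
have -> : psum c (N + k) z + c (N + k)%N * z ^+ (N + k) - psum c N z =
  (psum c (N + k) z - psum c N z) + c (N + k)%N * z ^+ (N + k) by ring.
apply: le_trans (le_normcD _ _) _.
have t : normc (c (N + k)%N * z ^+ (N + k)) <= M * 2^-1 ^+ (N + k).
  rewrite normcM normcX; apply: (@le_trans _ _ (normc (c (N + k)%N) * (rho / 2) ^+ (N + k))).
    rewrite ler_wpM2l ?normc_ge0// lerXn2r ?nnegrE ?normc_ge0//.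
    by rewrite divr_ge0// ltW.
  by rewrite exprMn mulrA ler_wpM2r// exprn_ge0.
apply: le_trans (lerD IH t) _; rewrite exprS.
by rewrite le_eqVlt; apply/orP; left; apply/eqP; field.
Qed.

Lemma psum_limit c (M rho : R) : 0 <= M -> 0 < rho ->
  (forall n, normc (c n) * rho ^+ n <= M) ->
  exists Gamma : C -> C,
    [/\ forall z, normc z <= rho / 2 -> psum c N z @[N --> \oo] --> Gamma z &
      forall N z, normc z <= rho / 2 -> normc (psum c N z - Gamma z) <= 4 * M * 2^-1 ^+ N].
Proof.
move=> M0 rho0 cM.
have small (e : R) : 0 < e -> exists N, 2 * M * 2^-1 ^+ N < e.
  move=> e0; have : (2 * M) * 2^-1 ^+ n @[n --> \oo] --> (2 * M * 0 : R).
    by apply: cvgMr; apply: cvg_expr; rewrite ger0_norm; lra.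
  rewrite mulr0 => /cvgrPdist_lt/(_ e e0)[N _ /(_ N (leqnn N))] /=.
  by rewrite sub0r normrN => h; exists N; apply: le_lt_trans (ler_norm _) h.
(* Completeness is used in [R]: the limit is taken for the real and the imaginary part separately,
   each with error [2 * M * 2^-1 ^+ N], which explains the [4] in the conclusion. *)
have part (pr : C -> R) : (forall a b, pr (a - b) = pr a - pr b) ->
    (forall a, `|pr a| <= normc a) ->
    exists L : C -> R, forall z, normc z <= rho / 2 ->
      pr (psum c N z) @[N --> \oo] --> L z /\
      forall N, `|pr (psum c N z) - L z| <= 2 * M * 2^-1 ^+ N.
  move=> prB prn; exists (fun z => lim (pr (psum c N z) @[N --> \oo])) => z zr.
  have est N k : `|pr (psum c (N + k) z) - pr (psum c N z)| <= 2 * M * 2^-1 ^+ N.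
    rewrite -prB; apply: le_trans (prn _) _; apply: le_trans (psum_cauchy N k M0 rho0 cM zr) _.
    have e : 0 <= 2^-1 ^+ (N + k) :> R by rewrite exprn_ge0//; lra.
    by rewrite ler_wpM2l ?mulr_ge0//; lra.
  have cv : cvgn (fun N => pr (psum c N z)).
    apply/cauchy_cvgP/cauchy_exP => e e0; have [N hN] := small e e0.
    exists (pr (psum c N z)); exists N => // n /= Nn.
    rewrite /ball /= distrC -(subnKC Nn); exact: le_lt_trans (est _ _) hN.
  split => // N; rewrite distrC ler_distl; apply/andP; split.
    apply: limr_ge => //; exists N => // n /= Nn.
    by have := est N (n - N)%N; rewrite subnKC// ler_distl => /andP[].
  apply: limr_le => //; exists N => // n /= Nn.
  by have := est N (n - N)%N; rewrite subnKC// ler_distl => /andP[].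
have [LR hR] := part (@complex.Re R) (@ReB R) (@Re_le_normc R).
have [LI hI] := part (@complex.Im R) (@ImB R) (@Im_le_normc R).
exists (fun z => LR z +i* LI z); split => [z zr|N z zr].
  by apply: cvg_complex; [have [] := hR z zr|have [] := hI z zr].
have [_ /(_ N) h1] := hR z zr; have [_ /(_ N) h2] := hI z zr.
apply: le_trans (normc_le_ReIm _) _; rewrite ReB ImB /=; lra.
Qed.

(** Convergence at the real point [t0 + r / 2] bounds the terms there, hence the coefficients. The
    series with complex argument then converges uniformly for modulus at most [r / 4], and
    [uniform_limit_derivable] halves the radius once more. *)
Lemma powseries_extension (a b : R^nat) (x y : R -> R) (t0 r : R) : 0 < r ->
  (forall t, `|t - t0| < r -> series (fun n => a n * (t - t0) ^+ n) @ \oo --> x t) ->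
  (forall t, `|t - t0| < r -> series (fun n => b n * (t - t0) ^+ n) @ \oo --> y t) ->
  exists2 Gamma : C -> C, (forall z, normc z < r / 8 -> derivable Gamma z 1) &
    forall t : R, `|t| < r / 8 -> Gamma t%:C = x (t0 + t) +i* y (t0 + t).
Proof.
move=> r0 sx sy; pose rho := r / 2.
have rho0 : 0 < rho by rewrite /rho; lra.
have tr : `|t0 + rho - t0| < r by rewrite addrAC subrr add0r gtr0_norm// /rho; lra.
have [Ma Ma0 hMa] := cvg_series_terms_bounded (sx _ tr).
have [Mb Mb0 hMb] := cvg_series_terms_bounded (sy _ tr).
pose c n : C := a n +i* b n.
have cM n : normc (c n) * rho ^+ n <= Ma + Mb.
  have e0 : 0 <= rho ^+ n by rewrite exprn_ge0// ltW.
  apply: (@le_trans _ _ ((`|a n| + `|b n|) * rho ^+ n)).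
    by rewrite ler_wpM2r//; exact: normc_le_ReIm.
  have := hMa n; have := hMb n; rewrite addrAC subrr add0r !normrM (ger0_norm e0); lra.
have M0 : 0 <= Ma + Mb by rewrite addr_ge0.
have [Gamma [cvG unif]] := psum_limit M0 rho0 cM.
have rho2 : rho / 2 = r / 4 by rewrite /rho; field.
rewrite rho2 in cvG unif.
exists Gamma => [z zr|t ht].
  have r4 : 0 < r / 4 by lra.
  have e8 : r / 4 / 2 = r / 8 by field.
  apply: (@uniform_limit_derivable R (psum c) Gamma 0 (r / 4) r4).
  - by move=> n w _; exact: derivable_psum.
  - move=> e e0.
    have : (4 * (Ma + Mb)) * 2^-1 ^+ n @[n --> \oo] --> (4 * (Ma + Mb) * 0 : R).
      by apply: cvgMr; apply: cvg_expr; rewrite ger0_norm; lra.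
    rewrite mulr0 => /cvgrPdist_lt/(_ e e0)[N _ /(_ N (leqnn N))] /=.
    rewrite sub0r normrN => h; exists N => w; rewrite subr0 => /ltW wr.
    by apply: le_trans (unif N w wr) _; apply: le_trans (ler_norm _) (ltW h).
  - by rewrite subr0 e8.
have tC : normc (t%:C : C) <= r / 4 by rewrite normc_real; lra.
have e : t0 + t - t0 = t by rewrite addrAC subrr add0r.
have tr2 : `|t0 + t - t0| < r by rewrite e; lra.
have h1 := sx _ tr2; have h2 := sy _ tr2; rewrite e in h1 h2.
have tX n : (t%:C : C) ^+ n = (t ^+ n)%:C by rewrite rmorphXn.
have h3 : psum c N t%:C @[N --> \oo] --> (x (t0 + t) +i* y (t0 + t) : C).
  have -> : (fun N => psum c N t%:C) = fun N =>
    (series (fun n => a n * t ^+ n) N +i* series (fun n => b n * t ^+ n) N : C).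
    apply/funext => N; rewrite /psum /series /= !big_mkord.
    elim: N => [|N IH]; first by rewrite !big_ord0.
    rewrite !big_ord_recr /= IH tX; apply/eqP; rewrite eq_complex /=.
    by rewrite !mulr0 subr0 add0r !eqxx.
  exact: cvg_complex.
exact: (cvg_unique _ (cvG _ tC) h3).
Qed.

End PowerSeries.

(** * A quantitative inverse function theorem *)

Section LocalInverse.
Variable R : realType.
Local Notation C := (cplane R).
Implicit Types (z w v a b : C).
Variables (Gamma : C -> C) (c : C) (d : R).
Hypotheses (dG : forall z, normc z < d -> derivable Gamma z 1) (c0 : c != 0).
(** [Gamma] differs little from multiplication by [c]. The ratio [1 / 16] leaves room both for the
    inversion and for the estimate of a quotient of four such factors, [quotient_Re_ge]. *)
Hypothesis strict : forall a b, normc a < d -> normc b < d ->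
  normc (Gamma a - Gamma b - c * (a - b)) <= normc c / 16 * normc (a - b).

Let nc0 : 0 < normc c. Proof. by rewrite normc_gt0. Qed.

Lemma strict_lower a b : normc a < d -> normc b < d ->
  normc c / 2 * normc (a - b) <= normc (Gamma a - Gamma b).
Proof.
move=> ad bd; have h := strict ad bd.
have t := normc_triangle (c * (a - b)) 0 (Gamma a - Gamma b).
rewrite !subr0 normcB normcM in t; have := normc_ge0 (a - b); have := nc0; nra.
Qed.

(** For a small real increment [s], both [c * s] and [Gamma' z * s] approximate the same difference
    of values; dividing by [s] compares them. *)
Lemma strict_cder z : normc z < d -> normc (cder Gamma z - c) <= normc c / 16.
Proof.
move=> zd; apply/ler_addgt0Pr => e e0.
have dz := derivable_is_derive (dG zd); have /is_derive_normcP/(_ _ e0)[r r0 hr] := dz.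
have zd0 : normc (z - 0) < d by rewrite subr0.
have [r' r'0 hr'] := open_normcP (@open_disc _ 0 d) zd0.
pose s := Num.min r r' / 2; have s0 : 0 < s by rewrite divr_gt0// lt_min r0.
have [sr sr'] : s < r /\ s < r'.
  have [h1 h2] : Num.min r r' <= r /\ Num.min r r' <= r' by rewrite !ge_min !lexx orbT.
  by move: s0; rewrite /s; lra.
pose w := z + s%:C; have wz : w - z = s%:C by rewrite /w addrC addKr.
have nw : normc (w - z) = s by rewrite wz normc_real gtr0_norm.
have wd : normc w < d by have := hr' w; rewrite /= subr0 nw; exact.
have h1 := hr w; rewrite nw -/(cder Gamma z) in h1; have {}h1 := h1 sr.
have h2 := strict wd zd; rewrite nw in h2.
have := le_normcD (Gamma w - Gamma z - c * (w - z)) (- (Gamma w - Gamma z - cder Gamma z * (w - z))).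
have -> : Gamma w - Gamma z - c * (w - z) - (Gamma w - Gamma z - cder Gamma z * (w - z)) =
  (cder Gamma z - c) * (w - z) by ring.
rewrite normcN normcM nw => t; have {h1 h2}t : normc (cder Gamma z - c) * s <= (normc c / 16 + e) * s by lra.
by rewrite -(ler_pM2r s0).
Qed.

Lemma strict_inj a b : normc a < d -> normc b < d -> Gamma a = Gamma b -> a = b.
Proof.
move=> ad bd e; have := strict_lower ad bd; rewrite e subrr normc0 => h.
apply/eqP; rewrite -subr_eq0 -normc_eq0 eq_le normc_ge0 andbT.
by move: h; rewrite pmulr_rle0// divr_gt0.
Qed.

(** Minimise the modulus of [Gamma z - v] on the closed disc. The minimum is not on the circle,
    where [strict_lower] makes the modulus exceed its value at [z0]. If it were positive, a damped
    Newton step would lower it. *)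
Lemma strict_surj z0 v (rho : R) : 0 < rho -> normc z0 + rho < d ->
  normc (v - Gamma z0) < normc c * rho / 4 -> exists2 z, normc (z - z0) < rho & Gamma z = v.
Proof.
move=> rho0 zd hv.
have z0d : normc z0 < d by lra.
have inD z : normc (z - z0) <= rho -> normc z < d.
  by move=> h; have := normc_triangle z 0 z0; rewrite !subr0; lra.
pose f z := normc (Gamma z - v).
have cf z : normc (z - z0) <= rho -> {for z, continuous f}.
  move=> zr; apply: contc_normc; apply: contcB; last exact: contc_cst.
  by apply: derivable_continuous_at; apply: dG; exact: inD.
have K0 : [set z : C | normc (z - z0) <= rho] !=set0 by exists z0; rewrite /= subrr normc0 ltW.
have [|z1] := compact_EVT_min K0 (@compact_closed_disc _ z0 rho) (f := f).
  by apply: continuous_in_subspaceT => z; rewrite inE; exact: cf.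
rewrite inE /= => z1r min.
have f0 : f z1 <= f z0 by apply: min; rewrite inE /= subrr normc0 ltW.
have fv : f z0 < normc c * rho / 4 by rewrite /f normcB.
have z1i : normc (z1 - z0) < rho.
  rewrite lt_neqAle z1r andbT; apply/eqP => e.
  have := strict_lower (inD _ z1r) z0d; rewrite e.
  have := normc_triangle (Gamma z1) (Gamma z0) v; rewrite (normcB v).
  have := nc0; rewrite /f in f0 fv *; nra.
exists z1 => //; apply/eqP; rewrite -subr_eq0 -normc_eq0 eq_le normc_ge0 andbT leNgt.
apply/negP => fpos; have fpos' : 0 < f z1 by [].
pose step := (v - Gamma z1) / c.
have step0 : normc step = f z1 / normc c by rewrite /step normcM normcV normcB.
(* The damping keeps the Newton step in the closed disc; [+ 1] makes the denominator positive. *)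
pose t := Num.min 1 ((rho - normc (z1 - z0)) / (normc step + 1)).
have s1 : 0 < normc step + 1 by have := normc_ge0 step; lra.
have t0 : 0 < t by rewrite lt_min ltr01 divr_gt0// subr_gt0.
have t1 : t <= 1 by rewrite ge_min lexx.
have tstep : t * normc step <= rho - normc (z1 - z0).
  have : t <= (rho - normc (z1 - z0)) / (normc step + 1) by rewrite ge_min lexx orbT.
  rewrite ler_pdivlMr//; have := normc_ge0 step; nra.
pose z2 := z1 + t%:C * step.
have z2z1 : z2 - z1 = t%:C * step by rewrite /z2 addrC addKr.
have z2r : normc (z2 - z0) <= rho.
  have := normc_triangle z2 z0 z1; rewrite z2z1 normcM normc_real gtr0_norm//; lra.
have := min z2; rewrite inE => /(_ z2r); apply/negP; rewrite -ltNge.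
have h := strict (inD _ z2r) (inD _ z1r).
rewrite z2z1 normcM normc_real gtr0_norm// in h.
have cs : c * step = v - Gamma z1 by rewrite /step mulrC divfK.
have e : Gamma z2 - v = (Gamma z2 - Gamma z1 - c * (t%:C * step)) + (1 - t)%:C * (Gamma z1 - v).
  by rewrite mulrCA cs rmorphB /=; ring.
rewrite /f e; apply: le_lt_trans (le_normcD _ _) _.
rewrite normcM normc_real ger0_norm ?subr_ge0// -/(f z1).
have cst : normc c * normc step = f z1 by rewrite step0 mulrC divfK// gt_eqF.
apply: (@le_lt_trans _ _ (t * f z1 / 16 + (1 - t) * f z1)).
  rewrite lerD2r; apply: le_trans h _; rewrite -cst.
  by rewrite le_eqVlt; apply/orP; left; apply/eqP; field.
by nra.
Qed.

Definition image_disc (r : R) : set C := Gamma @` [set z | normc z < r].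

Lemma image_disc_open r : r <= d -> open (image_disc r).
Proof.
move=> rd; apply: normcP_open => _ [z0 /= z0r <-].
pose rho := (r - normc z0) / 2; have rho0 : 0 < rho by rewrite /rho; lra.
exists (normc c * rho / 4); first by rewrite divr_gt0// mulr_gt0.
move=> v hv; have [|z zr <-] := strict_surj rho0 _ hv; first by rewrite /rho; lra.
exists z => //=; have := normc_triangle z 0 z0; rewrite !subr0 /rho in zr *; lra.
Qed.

Definition local_inverse (v : C) : C := xget 0 [set z | normc z < d /\ Gamma z = v].

Lemma local_inverseK z : normc z < d -> local_inverse (Gamma z) = z.
Proof.
move=> zd; rewrite /local_inverse; case: xgetP => [y _ [yd /strict_inj e]|]; first exact: e.
by move=> /(_ z) /=; tauto.
Qed.

(** The derivative is the inverse of [Gamma'], nonzero by [strict_cder]. [strict_lower] makes the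
    inverse Lipschitz, which turns the remainder of [Gamma] into a remainder for it. *)
Lemma local_inverse_holomorphic r : r <= d -> holomorphic_on (image_disc r) local_inverse.
Proof.
move=> rd v0 Uv; have [z0 /= z0r ev0] := Uv; have z0d := lt_le_trans z0r rd.
have dz := derivable_is_derive (dG z0d); set c1 := 'D_1 Gamma z0 in dz.
have c1l : normc c / 4 <= normc c1.
  have h := strict_cder z0d; have := normc_triangle c 0 c1.
  by rewrite !subr0 normcB -/(cder Gamma z0) -/c1 in h *; have := nc0; lra.
have c10 : 0 < normc c1 by apply: lt_le_trans c1l; rewrite divr_gt0.
have c1n : c1 != 0 by rewrite -normc_gt0.
apply: (@is_derive_derivable _ _ _ c1^-1); apply/is_derive_normcP => e e0.
have k0 : 0 < e * normc c1 * normc c / 2 by rewrite divr_gt0// !mulr_gt0.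
have /is_derive_normcP/(_ _ k0)[s s0 hs] := dz.
have [s' s'0 hs'] := open_normcP (image_disc_open rd) Uv.
exists (Num.min s' (s * normc c / 2)).
  by rewrite lt_min s'0 divr_gt0// mulr_gt0.
move=> v; rewrite lt_min => /andP[/hs'[z /= zr ev] vs].
have zd := lt_le_trans zr rd.
rewrite -ev -ev0 !local_inverseK// in vs *.
have lo := strict_lower zd z0d.
have zs : normc (z - z0) < s.
  have : normc c / 2 * normc (z - z0) < s * normc c / 2 by exact: le_lt_trans lo vs.
  by rewrite [s * _]mulrC -mulrA mulrAC mulrC; have := nc0; nra.
have := hs z zs => h.
have -> : z - z0 - c1^-1 * (Gamma z - Gamma z0) =
   - c1^-1 * (Gamma z - Gamma z0 - c1 * (z - z0)) by field.
rewrite normcM normcN normcV -ler_pdivlMl ?invr_gt0// invrK.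
apply: le_trans h _.
have : 0 <= e * normc c1 by rewrite mulr_ge0// ltW.
by move=> q0; have := ler_wpM2l q0 lo; lra.
Qed.

End LocalInverse.

(** * Winding numbers: a domain does not lie on both sides of an arc of its boundary *)

Section Winding.
Variable R : realType.
Local Notation C := (cplane R).
Implicit Types (z w v a b : C) (t s : R).

Lemma connected_locally_const (T : Type) (D : set C) (f : C -> T) : open D -> connected D ->
  (forall w, D w -> exists2 r : R, 0 < r & forall w', normc (w' - w) < r -> f w' = f w) ->
  forall w1 w2, D w1 -> D w2 -> f w1 = f w2.
Proof.
move=> oD cD loc w1 w2 D1 D2.
have opn (P : T -> Prop) : open (D `&` [set w | P (f w)]).
  apply: normcP_open => w [Dw Pw]; have [r r0 hr] := loc w Dw.
  have [r' r'0 hr'] := open_normcP oD Dw.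
  exists (Num.min r r'); first by rewrite lt_min r0.
  by move=> w'; rewrite lt_min => /andP[h1 h2]; split; [exact: hr'|rewrite /= hr].
have e : D `&` [set w | f w = f w1] = D.
  apply: cD; first by exists w1.
    by exists (D `&` [set w | f w = f w1]); [exact: opn (fun x => x = f w1)|rewrite setIA setIid].
  exists (~` (D `&` [set w | f w <> f w1])); first by apply: open_closedC; exact: opn (fun x => x <> f w1).
  apply/seteqP; split => w [Dw]; [move=> /= h; split => // -[_]//|].
  by move=> h; split => //=; apply: contrapT => h'; apply: h.
by move: D2; rewrite -[in X in X -> _]e => -[_ /= ->].
Qed.

(** Here [T] has no topology, so that [f] may be membership in a set, with values in [Prop]. *)
Lemma segment_locally_const (T : Type) (D : set C) (f : C -> T) z1 z2 : open D ->
  (forall w, D w -> exists2 r : R, 0 < r & forall w', normc (w' - w) < r -> f w' = f w) ->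
  (forall t, 0 <= t <= 1 -> D (z1 + (z2 - z1) * t%:C)) -> f z1 = f z2.
Proof.
move=> oD loc seg; apply: contrapT => ne.
(* An indicator along the segment: locally constant, hence with derivative [0], it cannot pass from
   [1] to [0]. *)
pose chi t : C := if `[< f (z1 + (z2 - z1) * t%:C) = f z1 >] then 1 else 0.
have d t : 0 <= t <= 1 -> cderiv chi t 0.
  move=> ht; have [r r0 hr] := loc _ (seg t ht).
  have c := cderiv_continuous (cderiv_line z1 (z2 - z1) t).
  apply: (@cderiv_near _ (fun=> chi t)); last exact: cderiv_cst.
  move: c => /cvg_normcP/(_ r r0).
  by apply: filterS => s hs; rewrite /chi (hr _ hs).
have c0 : cont_itv 0 1 (fun _ : R => (0 : C)) by move=> t _; exact: contc_cst.
have := cint_ftc ler01 d c0; rewrite cint_cst// mul0r => /esym/eqP.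
have -> : chi 0 = 1 by rewrite /chi mulr0 addr0 asboolT.
have -> : chi 1 = 0 by rewrite /chi mulr1 addrC subrK asboolF// => e; apply: ne.
by rewrite sub0r oppr_eq0 oner_eq0.
Qed.

(** Numerator and denominator are within [33 / 256 = 1 / 16 + 1 / 16 + 1 / 256] of [1], so the
    quotient is within [1 / 2] of [1]. *)
Lemma quotient_Re_ge (e0 e1 e2 e3 : C) :
  normc e0 <= 1 / 16 -> normc e1 <= 1 / 16 -> normc e2 <= 1 / 16 -> normc e3 <= 1 / 16 ->
  1 / 2 <= Re ((1 + e0) * (1 + e1) / ((1 + e2) * (1 + e3))).
Proof.
move=> h0 h1 h2 h3; set N := (1 + e0) * (1 + e1); set M := (1 + e2) * (1 + e3).
have prod a b : normc a <= 1 / 16 -> normc b <= 1 / 16 -> normc ((1 + a) * (1 + b) - 1) <= 33 / 256.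
  move=> ha hb; have -> : (1 + a) * (1 + b) - 1 = a + b + a * b by ring.
  apply: le_trans (le_normcD _ _) _; rewrite normcM.
  have := le_normcD a b; have := normc_ge0 a; have := normc_ge0 b; nra.
have hN := prod _ _ h0 h1; have hM := prod _ _ h2 h3; rewrite -/N -/M in hN hM.
have M1 : 223 / 256 <= normc M.
  have := normc_triangle 1 0 M; rewrite !subr0 normc1 normcB; lra.
have M0 : M != 0 by rewrite -normc_gt0; lra.
have e : N / M = 1 + (N - M) / M by field.
have q : normc ((N - M) / M) <= 1 / 2.
  rewrite normcM normcV ler_pdivrMr; last lra.
  have -> : N - M = (N - 1) - (M - 1) by ring.
  have := le_normcD (N - 1) (- (M - 1)); rewrite normcN; lra.
rewrite e ReD /=; have := le_trans (Re_le_normc _) q.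
by rewrite ler_norml => /andP[]; lra.
Qed.

Variables (D : set C) (gam gam' : R -> C).
Hypotheses (oD : open D) (cD : connected D).
Hypothesis dgam : forall t, cderiv gam t (gam' t).
Hypothesis cgam' : forall t, {for t, continuous gam'}.
Hypothesis pgam : gam (1 / 2) = gam (- (1 / 2)).
Hypothesis avoid : forall t, ~ D (gam t).

Let le1 : - (1 / 2) <= 1 / 2 :> R. Proof. by lra. Qed.
Let cgam t : {for t, continuous gam}. Proof. exact: cderiv_continuous (dgam t). Qed.

(** It is [2 pi i] times the winding number. The period is centred at the parameter [0], where the
    arc will be crossed. *)
Definition winding w : C := cint (- (1 / 2)) (1 / 2) (fun t => gam' t / (gam t - w)).

Lemma winding_const w1 w2 : D w1 -> D w2 -> winding w1 = winding w2.
Proof.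
apply: connected_locally_const => // w Dw.
have [r r0 hr] := open_normcP oD Dw; exists r => // w' wr.
apply: (const_of_derive0 (p := w) (r := r) (f := winding)) => // v vr.
have Dv := hr v vr; have [d d0 hd] := open_normcP oD Dv.
have far t : - (1 / 2) <= t <= 1 / 2 -> d <= normc (gam t - v).
  by move=> _; rewrite leNgt; apply/negP => /hd /avoid.
have cg' : cont_itv (- (1 / 2)) (1 / 2) gam' by move=> t _; exact: cgam'.
have cg : cont_itv (- (1 / 2)) (1 / 2) gam by move=> t _; exact: cgam.
have := kernel_derive 1 le1 d0 cg' cg far.
have nz t : gam t - v != 0.
  by rewrite subr_eq0; apply/eqP => e; apply: (@avoid t); rewrite e.
have -> : cint (- (1 / 2)) (1 / 2) (fun t => gam' t / (gam t - v) ^+ 2) = 0.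
  have dF t : - (1 / 2) <= t <= 1 / 2 ->
      cderiv (fun t => - (gam t - v)^-1 : C) t (gam' t / (gam t - v) ^+ 2).
    move=> _; have d2 := is_derivecB (is_derivec_id (gam t)) (is_derivec_cst (gam t) v).
    have d3 := is_derivecN (is_derivecV (f := fun w : C => w - v) (nz t) d2).
    apply: cderiv_eq (cderiv_comp (dgam t) d3) _.
    by rewrite subr0 !mulNr opprK mul1r mulrC.
  have cF : cont_itv (- (1 / 2)) (1 / 2) (fun t => gam' t / (gam t - v) ^+ 2 : C).
    move=> t _; apply: contcM; first exact: cgam'.
    apply: contcV; first by rewrite expf_neq0.
    by apply: contcX; apply: contcB; [exact: cgam|exact: contc_cst].
  by apply: (etrans (cint_ftc le1 dF cF)); rewrite pgam subrr.
by rewrite mulr0.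
Qed.

Variables (Gamma : C -> C) (c : C) (d rho : R).
Hypotheses (dG : forall z, normc z < d -> derivable Gamma z 1) (c0 : c != 0) (d0 : 0 < d).
Hypothesis strict : forall a b, normc a < d -> normc b < d ->
  normc (Gamma a - Gamma b - c * (a - b)) <= normc c / 16 * normc (a - b).
Hypothesis Ggam : forall t, `|t| < d -> Gamma t%:C = gam t.
Hypothesis rho0 : 0 < rho.
Hypothesis far : forall t, - (1 / 2) <= t <= 1 / 2 -> d / 2 <= `|t| ->
  rho <= normc (gam t - Gamma 0).

Lemma gam'_cder t : `|t| < d -> gam' t = cder Gamma t%:C.
Proof.
move=> td; apply: (cderiv_unique (dgam t)).
have h1 : normc (t%:C : C) < d by rewrite normc_real.
have h := cderiv_comp (cderiv_real (is_derive_id t 1)) (derivable_is_derive (dG h1)).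
have h2 : cderiv (fun s : R => Gamma s%:C) t (cder Gamma t%:C).
  by apply: cderiv_eq h _; rewrite mulr1.
apply: cderiv_near h2; apply/nbhs_ballP; exists (d - `|t|); first by rewrite /= subr_gt0.
move=> s; rewrite /ball /= => st; apply: Ggam.
by have := ler_normD t (s - t); rewrite addrC subrK (distrC s t); lra.
Qed.

(* The lower bound integrates over [-d, d] to about [pi] as [e] goes to [0]: this
   gives the jump of the winding number across the curve. *)
Lemma jump_integrand (e t : R) : 0 < e -> e < d -> `|t| < d ->
  e / (t ^+ 2 + e ^+ 2) <=
  Im (gam' t / (gam t - Gamma ('i%C * e%:C)) - gam' t / (gam t - Gamma (- ('i%C * e%:C)))).
Proof.
move=> e0 ed td; set p := 'i%C * e%:C; set q := - p.
have np : normc p = e by rewrite /p normcM normc_i mul1r normc_real gtr0_norm.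
have pd : normc p < d by rewrite np.
have qd : normc q < d by rewrite normcN np.
have tCd : normc (t%:C : C) < d by rewrite normc_real.
rewrite gam'_cder// -Ggam//.
have rel a b : normc a < d -> normc b < d -> a != b -> exists2 r : C,
    normc r <= 1 / 16 & Gamma a - Gamma b = c * (a - b) * (1 + r).
  move=> ad bd ab; have ab0 : a - b != 0 by rewrite subr_eq0.
  exists ((Gamma a - Gamma b - c * (a - b)) / (c * (a - b))); last by field; rewrite ab0 c0.
  rewrite normcM normcV normcM ler_pdivrMr ?mulr_gt0 ?normc_gt0//.
  by apply: le_trans (strict ad bd) _; rewrite le_eqVlt; apply/orP; left; apply/eqP; field.
have Imt (x : R) : x != 0 -> t%:C != ('i%C * x%:C : C).
  move=> x0; apply/eqP => /(congr1 (@complex.Im R)); rewrite /= mul0r add0r mul1r => /esym/eqP.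
  by rewrite (negbTE x0).
have qE : q = 'i%C * (- e)%:C by rewrite /q /p rmorphN mulrN.
have tp : t%:C != p by apply: Imt; rewrite gt_eqF.
have tq : t%:C != q by rewrite qE; apply: Imt; rewrite oppr_eq0 gt_eqF.
have pq : p != q.
  rewrite -subr_eq0 /q opprK -normc_gt0; have -> : p + p = 'i%C * (e + e)%:C.
    by rewrite /p rmorphD mulrDr.
  by rewrite normcM normc_i mul1r normc_real gtr0_norm; lra.
have [e1 h1 E1] := rel p q pd qd pq.
have [e2 h2 E2] := rel _ _ tCd pd tp.
have [e3 h3 E3] := rel _ _ tCd qd tq.
have [e4 h4 E4] : exists2 r : C, normc r <= 1 / 16 & cder Gamma t%:C = c * (1 + r).
  exists ((cder Gamma t%:C - c) / c); last by field.
  rewrite normcM normcV ler_pdivrMr ?normc_gt0//.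
  by have := strict_cder dG strict tCd; lra.
have nz r : normc r <= 1 / 16 -> 1 + r != 0 :> C.
  move=> hr; rewrite -normc_gt0; have := normc_triangle 1 0 (- r).
  by rewrite !subr0 opprK normcN normc1; lra.
have s0 : 0 < t ^+ 2 + e ^+ 2 by rewrite ltr_wpDl ?sqr_ge0// exprn_gt0.
have tptq : (t%:C - p) * (t%:C - q) = (t ^+ 2 + e ^+ 2)%:C.
  by rewrite /q /p; apply/eqP; rewrite eq_complex /=; apply/andP; split; apply/eqP; ring.
have tp0 : t%:C - p != 0 by rewrite subr_eq0.
have tq0 : t%:C - q != 0 by rewrite subr_eq0.
have -> : cder Gamma t%:C / (Gamma t%:C - Gamma p) - cder Gamma t%:C / (Gamma t%:C - Gamma q) =
   cder Gamma t%:C * (Gamma p - Gamma q) / ((Gamma t%:C - Gamma p) * (Gamma t%:C - Gamma q)).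
  field; rewrite E2 E3 !mulf_neq0 ?nz//.
have -> : cder Gamma t%:C * (Gamma p - Gamma q) / ((Gamma t%:C - Gamma p) * (Gamma t%:C - Gamma q)) =
   (2 * e / (t ^+ 2 + e ^+ 2))%:C * ('i%C * ((1 + e4) * (1 + e1) / ((1 + e2) * (1 + e3)))).
  have -> : (2 * e / (t ^+ 2 + e ^+ 2))%:C = 2 * e%:C / ((t%:C - p) * (t%:C - q)) :> C.
    by rewrite tptq -[2]/(2%:R) rmorphM fmorphV rmorphM /= rmorph_nat.
  rewrite E1 E2 E3 E4 {1}/q opprK.
  have -> : p + p = 2 * e%:C * 'i%C by rewrite /p; ring.
  have tq0' : t%:C + p != 0 by move: tq0; rewrite /q opprK.
  by field; rewrite c0 tp0 tq0' !nz.
have := quotient_Re_ge h4 h1 h2 h3; set Q := (1 + e4) * _ / _ => hQ.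
have -> : Im ((2 * e / (t ^+ 2 + e ^+ 2))%:C * ('i%C * Q)) = 2 * e / (t ^+ 2 + e ^+ 2) * Re Q.
  by rewrite !ImM ReM /=; ring.
have : 0 <= e / (t ^+ 2 + e ^+ 2) by rewrite divr_ge0// ltW.
by rewrite -mulrA; nra.
Qed.

(** Otherwise [winding] would agree at the points [Gamma (i e)] and [Gamma (- i e)], so the integral
    of [J] would be [0]. But [J] is bounded below by [e / (t ^+ 2 + e ^+ 2) - B * e], whose integral
    [2 * atan (1 / (2 * e)) - B * e] exceeds [pi / 2 - 1], which is not negative. *)
Lemma not_two_sided : d <= 1 / 2 -> 
  ~ forall e, 0 < e -> e < d -> D (Gamma ('i%C * e%:C)) /\ D (Gamma (- ('i%C * e%:C))).
Proof.
move=> d12 both.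
have cg'itv : cont_itv (- (1 / 2)) (1 / 2) gam' by move=> t _; exact: cgam'.
have [M M0 hM] := cont_itv_bounded cg'itv.
(* For [|t| >= d] the first summand times [e] bounds the kernel [e / (t ^+ 2 + e ^+ 2)], and the
   second times [e] bounds [J], with [M] a bound for the velocity and [rho / 2] one for the
   distances. *)
pose B := 4 / d ^+ 2 + M * (3 * normc c) * 4 / rho ^+ 2.
have nc0 : 0 < normc c by rewrite normc_gt0.
have B0 : 0 <= B.
  by rewrite addr_ge0// ?divr_ge0 ?exprn_ge0 ?mulr_ge0// ltW.
(* In turn: [e] is less than [d] and at most [1 / 4]; the two test points are within [rho / 2] of
   [Gamma 0]; and [B * e < 1]. *)
pose e := Num.min (d / 2) (Num.min (rho / (4 * normc c)) (1 / (1 + B))).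
have e0 : 0 < e by rewrite !lt_min !divr_gt0// ?mulr_gt0//; lra.
have [ed2 erho eB] : [/\ e <= d / 2, e <= rho / (4 * normc c) & e <= 1 / (1 + B)].
  by rewrite /e !ge_min !lexx ?orbT.
have ed : e < d by have := d0; lra.
set p := 'i%C * e%:C; set q := - p.
have [Dp Dq] : D (Gamma p) /\ D (Gamma q) by exact: both.
have np : normc p = e by rewrite /p normcM normc_i mul1r normc_real gtr0_norm.
have nq : normc q = e by rewrite normcN.
have pd : normc p < d by rewrite np.
have qd : normc q < d by rewrite nq.
have zd : normc (0 : C) < d by rewrite normc0.
have upper a b : normc a < d -> normc b < d -> normc (Gamma a - Gamma b) <= 3 / 2 * normc c * normc (a - b).
  move=> ad bd; have := strict ad bd; have := le_normcD (Gamma a - Gamma b - c * (a - b)) (c * (a - b)).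
  by rewrite subrK normcM; have := nc0; have := normc_ge0 (a - b); nra.
have nz w t : D w -> gam t - w != 0.
  by move=> Dw; rewrite subr_eq0; apply/eqP => E; apply: (@avoid t); rewrite E.
have cker w : D w -> forall t, {for t, continuous (fun t => gam' t / (gam t - w) : C)}.
  move=> Dw t; apply: contcM; first exact: cgam'.
  by apply: contcV; [exact: nz|apply: contcB; [exact: cgam|exact: contc_cst]].
pose J t := Im (gam' t / (gam t - Gamma p) - gam' t / (gam t - Gamma q)).
pose L t := e / (t ^+ 2 + e ^+ 2) - B * e.
have cJ : cont_itv (- (1 / 2)) (1 / 2) J.
  by move=> t _; apply: contc_Im; apply: contcB; exact: cker.
have s0 t : 0 < t ^+ 2 + e ^+ 2 by rewrite ltr_wpDl ?sqr_ge0// exprn_gt0.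
have dL t : - (1 / 2) <= t <= 1 / 2 -> is_derive t 1 (fun t => atan (t / e) - B * e * t) (L t).
  move=> _; have d1 : is_derive t 1 (fun t : R => t / e) e^-1.
    have h := is_deriveM (is_derive_id t 1) (is_derive_cst e^-1 t 1).
    by apply: is_derive_eq h _; rewrite /GRing.scale /=; ring.
  have d2 : is_derive t 1 (fun t : R => B * e * t) (B * e).
    have h := is_deriveM (is_derive_cst (B * e) t 1) (is_derive_id t 1).
    by apply: is_derive_eq h _; rewrite /GRing.scale /=; ring.
  have d3 := @is_derive1_comp R (@atan R) (fun t : R => t / e) _ _ _ (is_derive1_atan _) d1.
  apply: is_derive_eq (is_deriveB d3 d2) _; rewrite /L; congr (_ - _).
  by field; rewrite !gt_eqF// exprn_gt0.
have cL : cont_itv (- (1 / 2)) (1 / 2) L.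
  move=> t _; apply: continuousB; last exact: cst_continuous.
  apply: contrM; first exact: cst_continuous.
  apply: continuousV; first by rewrite gt_eqF.
  by apply: contrD; [exact: exprn_continuous|exact: cst_continuous].
have LJ t : - (1 / 2) <= t <= 1 / 2 -> L t <= J t.
  move=> ht; have [td|td] := ltP `|t| d.
    have := jump_integrand e0 ed td; rewrite -/p -/q -/(J t) /L.
    have : 0 <= B * e by rewrite mulr_ge0// ltW.
    by lra.
  have td2 : d / 2 <= `|t| by have := d0; lra.
  have ft := far ht td2.
  have close w : normc w = e -> normc w < d -> rho / 2 <= normc (gam t - Gamma w).
    move=> we wd; have u := upper _ _ wd zd; rewrite subr0 we in u.
    have : 3 / 2 * normc c * e <= rho / 2.
      move: erho; rewrite ler_pdivlMr ?mulr_gt0//; have := nc0; nra.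
    by have := normc_triangle (gam t) (Gamma 0) (Gamma w); lra.
  have fp := close _ np pd; have fq := close _ nq qd.
  have Jn : `|J t| <= M * (3 * normc c * e) * (4 / rho ^+ 2).
    apply: le_trans (Im_le_normc _) _.
    have -> : gam' t / (gam t - Gamma p) - gam' t / (gam t - Gamma q) =
       gam' t * (Gamma p - Gamma q) * ((gam t - Gamma p) * (gam t - Gamma q))^-1.
      by field; rewrite !nz.
    rewrite !normcM normcV normcM; apply: ler_pM.
    - by rewrite mulr_ge0 ?normc_ge0.
    - by rewrite invr_ge0 mulr_ge0 ?normc_ge0.
    - apply: ler_pM; rewrite ?normc_ge0//; first exact: hM.
      apply: le_trans (upper _ _ pd qd) _; have := le_normcD p p.
      by rewrite /q opprK np; have := nc0; nra.
    - have -> : 4 / rho ^+ 2 = ((rho / 2) * (rho / 2))^-1 by field; rewrite gt_eqF.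
      have r2 : 0 < rho / 2 by rewrite divr_gt0.
      rewrite lef_pV2 ?posrE ?mulr_gt0//; last 2 first.
      + exact: lt_le_trans r2 fp.
      + exact: lt_le_trans r2 fq.
      by apply: ler_pM => //; exact: ltW.
  have : e / (t ^+ 2 + e ^+ 2) <= 4 / d ^+ 2 * e.
    rewrite mulrC; apply: ler_wpM2r; first exact: ltW.
    have -> : 4 / d ^+ 2 = ((d / 2) ^+ 2)^-1 by field; rewrite gt_eqF.
    have d20 : 0 < (d / 2) ^+ 2 by rewrite exprn_gt0// divr_gt0.
    rewrite lef_pV2 ?posrE//; apply: (@le_trans _ _ (`|t| ^+ 2)).
      by rewrite ler_pXn2r ?nnegrE// divr_ge0// ltW.
    by rewrite real_normK ?num_real// lerDl sqr_ge0.
  move: Jn; rewrite ler_norml => /andP[Jn _]; move: Jn; rewrite /L /B; lra.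
have := Rintegral_itv_le cL cJ LJ.
rewrite (Rintegral_itv_ftc le1 dL cL).
have -> : (\int[lebesgue_measure]_(t in `[- (1 / 2), (1 / 2)]) J t)%R = 0.
  have := cintB (a := - (1 / 2)) (b := 1 / 2) (fun t _ => cker _ Dp t) (fun t _ => cker _ Dq t).
  rewrite -/(winding (Gamma p)) -/(winding (Gamma q)) (winding_const Dp Dq) subrr.
  by move=> /(congr1 (@complex.Im R)).
rewrite mulNr atanN.
have : pi / 4 <= atan (1 / 2 / e).
  rewrite -atan1; have : 1 <= 1 / 2 / e by rewrite ler_pdivlMr//; lra.
  rewrite le_eqVlt => /predU1P[<-//|h]; apply: ltW; exact: lt_atan.
have : B * e < 1.
  by move: eB; rewrite ler_pdivlMr; have := e0; lra.
have := pi_ge2 R; lra.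
Qed.

End Winding.

(** * Parameters of simple closed curves *)

Section ClosedCurves.
Variable R : realType.
Local Notation C := (cplane R).
Variable gamma : R -> C.
Hypothesis per : forall t, gamma (t + 1) = gamma t.
Hypothesis inj : forall s t : R, 0 <= s < 1 -> 0 <= t < 1 -> gamma s = gamma t -> s = t.

Lemma closed_curve_period t (k : int) : gamma (t + k%:~R) = gamma t.
Proof.
have nat_per (n : nat) s : gamma (s + n%:R) = gamma s.
  elim: n s => [|n IH] s; first by rewrite addr0.
  by rewrite -natr1 addrA per IH.
case: k => n; first exact: nat_per.
by rewrite -(nat_per n.+1) NegzE mulrNz -pmulrn subrK.
Qed.

Lemma closed_curve_inj s t : gamma s = gamma t -> exists k : int, s = t + k%:~R.
Proof.
have red u : 0 <= u - (Num.floor u)%:~R < 1 /\ gamma (u - (Num.floor u)%:~R) = gamma u.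
  split; last by rewrite -mulrNz closed_curve_period.
  have /andP[h1 h2] := floor_itv u; rewrite subr_ge0 h1 /=.
  by rewrite ltrBlDl; move: h2; rewrite intrD.
have [s01 es] := red s; have [t01 et] := red t.
move=> e; exists (Num.floor s - Num.floor t).
have : s - (Num.floor s)%:~R = t - (Num.floor t)%:~R by apply: inj => //; rewrite es et.
by move=> /eqP; rewrite subr_eq => /eqP E; rewrite intrB {1}E; ring.
Qed.

Lemma closed_curve_shift s t0 : exists2 t : R, - (1 / 2) <= t <= 1 / 2 & gamma (t0 + t) = gamma s.
Proof.
pose k := Num.floor (s - t0 + 1 / 2).
exists (s - t0 - k%:~R); last first.
  have -> : t0 + (s - t0 - k%:~R) = s + (- k)%:~R by rewrite mulrNz; ring.
  exact: closed_curve_period.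
have /andP[h1 h2] := floor_itv (s - t0 + 1 / 2).
by move: h2; rewrite intrD -/k; move: h1; rewrite -/k; lra.
Qed.

Lemma small_int_eq0 (k : int) : `|k%:~R : R| < 1 -> k = 0.
Proof.
by rewrite -intr_norm -[1](mulr1z 1) ltr_int; case: k => [[|n]|n].
Qed.

End ClosedCurves.

(** * Straightening a real analytic boundary *)

Section Straightening.
Variable R : realType.
Local Notation C := (cplane R).
Implicit Types (z w a b : C) (t s : R).
Variables (D : set C).
Hypothesis bD : bounded_domain D.

Let oD : open D. Proof. by case: bD. Qed.
Let cD : connected D. Proof. by case: bD. Qed.

Lemma boundary_notin w : boundary D w -> ~ D w.
Proof. by move=> [_ h] Dw; apply: h; rewrite (interior_id _).1//; exact: oD. Qed.

Lemma notin_boundary w : ~ boundary D w -> D w \/ ~ closure D w.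
Proof.
move=> nb; have [Dw|nD] := pselect (D w); first by left.
right => cl; apply: nb; split => //.
by move=> /interior_subset.
Qed.

Variables (n : nat) (gammas : 'I_n -> R -> C).
Hypothesis curves : forall i, analytic_simple_closed (gammas i).
Hypothesis disj : forall i j, i != j -> range (gammas i) `&` range (gammas j) = set0.
Hypothesis bdE : boundary D = \bigcup_(i in [set: 'I_n]) range (gammas i).

Definition velocity i t : C :=
  (fun t => Re (gammas i t))^`() t +i* (fun t => Im (gammas i t))^`() t.

Lemma curve_cderiv i t : cderiv (gammas i) t (velocity i t).
Proof.
have [[sx sy _ _ _] _ _] := curves i; split; rewrite /= derive1E; apply: derivableP.
  exact: (sx 0%N t).
exact: (sy 0%N t).
Qed.

Lemma velocity_cont i t : {for t, continuous (velocity i)}.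
Proof.
have [[sx sy _ _ _] _ _] := curves i; apply: (@cvg_complex _ _ (nbhs t)).
  by apply: differentiable_continuous; apply/derivable1_diffP; exact: (sx 1%N t).
by apply: differentiable_continuous; apply/derivable1_diffP; exact: (sy 1%N t).
Qed.

Lemma velocity_neq0 i t : velocity i t != 0.
Proof.
have [[_ _ reg _ _] _ _] := curves i.
by apply: contra_neq (reg t) => -[-> ->].
Qed.

Lemma shift_cderiv i t0 t : cderiv (fun t => gammas i (t0 + t)) t (velocity i (t0 + t)).
Proof.
have shift : is_derive t 1 (fun t : R => t0 + t) 1.
  by apply: is_derive_eq (is_deriveD (is_derive_cst t0 t 1) (is_derive_id t 1)) _; rewrite add0r.
have [h1 h2] := curve_cderiv i (t0 + t); split.
  have h := @is_derive1_comp R (fun t => Re (gammas i t)) (fun t : R => t0 + t) _ _ _ h1 shift.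
  by apply: is_derive_eq h _; rewrite mulr1.
have h := @is_derive1_comp R (fun t => Im (gammas i t)) (fun t : R => t0 + t) _ _ _ h2 shift.
by apply: is_derive_eq h _; rewrite mulr1.
Qed.

Lemma shift_velocity_cont i t0 t : {for t, continuous (fun t => velocity i (t0 + t))}.
Proof.
apply: (@cont_comp _ _ _ (fun t : R => t0 + t) (velocity i)); last exact: velocity_cont.
by apply: contrD; [exact: cst_continuous|exact: cvg_id].
Qed.

Lemma curve_cont i t : {for t, continuous (gammas i)}.
Proof. exact: cderiv_continuous (curve_cderiv i t). Qed.

(** All boundary points outside the short arc around [t0] form a compact set, which misses the point
    by simplicity and disjointness of the curves; hence it stays at a positive distance. *)
Lemma boundary_near i t0 (d : R) : 0 < d -> d <= 1 / 4 ->
  exists2 rho : R, 0 < rho &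
    (forall w, boundary D w -> normc (w - gammas i t0) < rho ->
      exists2 t : R, `|t| < d & w = gammas i (t0 + t)) /\
    (forall t, - (1 / 2) <= t <= 1 / 2 -> d <= `|t| ->
      rho <= normc (gammas i (t0 + t) - gammas i t0)).
Proof.
move=> d0 d14; have [[_ _ _ per inj] _ _] := curves i.
pose T := `[- (1 / 2), 1 / 2]%classic `&` ~` [set t : R | `|t| < d].
(* From the curve through the point only the parameters with [|t| >= d] in one period are kept; the
   other curves are kept entirely. *)
pose K j := if j == i then (fun t => gammas i (t0 + t)) @` T else gammas j @` `[0, 1]%classic.
have cK j : compact (K j).
  rewrite /K; case: eqP => _; apply: continuous_compact.
  - apply: continuous_in_subspaceT => t _.
    apply: (@cont_comp _ _ _ (fun t => t0 + t) (gammas i)); last exact: curve_cont.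
    by apply: contrD; [exact: cst_continuous|exact: cvg_id].
  - apply: compact_closedI; first exact: segment_compact.
    apply: open_closedC; apply: (@open_comp _ _ (fun t : R => `|t|) [set x | x < d]).
      by move=> t _; exact: norm_continuous.
    exact: open_lt.
  - by apply: continuous_in_subspaceT => t _; exact: curve_cont.
  - exact: segment_compact.
have ns : ~ [set z | exists j, K j z] (gammas i t0).
  move=> [j]; rewrite /K; case: eqP => [_|/eqP ji] [t ht e].
    have [k ek] := closed_curve_inj per inj e.
    have tk : t = k%:~R by move: ek => /addrI.
    case: ht => /=; rewrite in_itv /= => h1 h2; apply: h2.
    have k0 : k = 0 by apply: (@small_int_eq0 R); rewrite -tk ltr_norml; lra.
    by rewrite /= tk k0 normr0.
  have : (range (gammas j) `&` range (gammas i)) (gammas i t0).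
    by split; [exists t|exists t0].
  by rewrite disj.
have /nbhs_normcP[rho rho0 hrho] := near_notin_compact (compact_finite_union cK) ns.
exists rho => //; split => [w|t ht td].
  rewrite bdE => -[j _ [t _ <-]] /hrho nK.
  have [ji|ji] := eqVneq j i; last first.
    exfalso; apply: nK; exists j; rewrite /K (negbTE ji).
    have [[_ _ _ perj injj] _ _] := curves j.
    have [t' ht' <-] := closed_curve_shift perj t (1 / 2).
    by exists (1 / 2 + t') => //=; rewrite in_itv /=; lra.
  subst j; have [t' ht' e] := closed_curve_shift per t t0.
  exists t' => //; rewrite ltNge; apply/negP => dt'; apply: nK; exists i.
  rewrite /K eqxx; exists t' => //; split; first by rewrite /= in_itv.
  by move=> /=; rewrite ltNge dt'.
rewrite leNgt; apply/negP => /hrho; apply; exists i; rewrite /K eqxx.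
exists t => //; split; first by rewrite /= in_itv.
by move=> /=; rewrite ltNge td.
Qed.

(** The power series of the two coordinates are evaluated at a complex argument. The derivative at
    [0] is the velocity, nonzero by regularity, which allows [strict_derivative] with a ratio
    proportional to it. *)
Lemma curve_complexification i t0 : exists (Gamma : C -> C) (c : C), exists2 d : R, 0 < d &
  [/\ c != 0, forall z, normc z < d -> derivable Gamma z 1,
      forall u v, normc u < d -> normc v < d ->
        normc (Gamma u - Gamma v - c * (u - v)) <= normc c / 16 * normc (u - v) &
      forall t : R, `|t| < d -> Gamma t%:C = gammas i (t0 + t)].
Proof.
have [_ ax ay] := curves i.
have [a [ra ra0 ha]] := ax t0; have [b [rb rb0 hb]] := ay t0.
pose r := Num.min ra rb; have r0 : 0 < r by rewrite lt_min ra0.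
have [Gamma dG GE] : exists2 Gamma : C -> C, (forall z, normc z < r / 8 -> derivable Gamma z 1) &
    forall t : R, `|t| < r / 8 -> Gamma t%:C = gammas i (t0 + t).
  have [||G h1 h2] := powseries_extension (a := a) (b := b) (x := fun t => Re (gammas i t))
    (y := fun t => Im (gammas i t)) (t0 := t0) r0.
  - by move=> t tr; apply: ha; apply: lt_le_trans tr _; rewrite ge_min lexx.
  - by move=> t tr; apply: hb; apply: lt_le_trans tr _; rewrite ge_min lexx orbT.
  by exists G => // t /h2 ->; rewrite complex_eta.
have r8 : 0 < r / 8 by rewrite divr_gt0.
have c0 : cder Gamma 0 != 0.
  have h := gam'_cder (shift_cderiv i t0) dG GE.
  have <- : velocity i (t0 + 0) = cder Gamma 0 by apply: h; rewrite normr0.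
  exact: velocity_neq0.
have k0 : 0 < normc (cder Gamma 0) / 16 by rewrite divr_gt0// normc_gt0.
have [|d /andP[d0 dr] strict] := strict_derivative (f := Gamma) (p := 0) r8 k0.
  by move=> z; rewrite subr0; exact: dG.
exists Gamma, (cder Gamma 0); exists d; first exact: d0.
split => [//|z zd|u v ud vd|t td].
- by apply: dG; exact: lt_le_trans dr.
- by apply: strict; rewrite subr0.
- by apply: GE; exact: lt_le_trans dr.
Qed.

Lemma segment_in_half_disc (d sg t : R) z1 z2 : 0 <= t <= 1 ->
  normc z1 < d -> 0 < sg * Im z1 -> normc z2 < d -> 0 < sg * Im z2 ->
  normc (z1 + (z2 - z1) * t%:C) < d /\ 0 < sg * Im (z1 + (z2 - z1) * t%:C).
Proof.
move=> /andP[t0 t1] n1 i1 n2 i2; split.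
  have -> : z1 + (z2 - z1) * t%:C = (1 - t)%:C * z1 + t%:C * z2 by rewrite rmorphB /=; ring.
  apply: le_lt_trans (le_normcD _ _) _; rewrite !normcM !normc_real !ger0_norm ?subr_ge0//.
  have [->|t0n] := eqVneq t 0; first by rewrite mul0r addr0 subr0 mul1r.
  have tp : 0 < t by rewrite lt_neqAle eq_sym t0n.
  by nra.
have -> : sg * Im (z1 + (z2 - z1) * t%:C) = (1 - t) * (sg * Im z1) + t * (sg * Im z2).
  by rewrite ImD ImM ImB /= mulr0 add0r; ring.
have [->|t0n] := eqVneq t 0; first by rewrite mul0r addr0 subr0 mul1r.
have tp : 0 < t by rewrite lt_neqAle eq_sym t0n.
by apply: ltr_wpDl; [rewrite mulr_ge0 ?subr_ge0// ltW|exact: mulr_gt0].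
Qed.

(** The image of an open half disc misses the boundary, so membership in [D] is locally constant on
    it, and a half disc is convex. The sign [sg] selects the half. *)
Lemma half_disc_side (Gamma : C -> C) (d sg : R) z1 z2 :
  (forall z, normc z < d -> derivable Gamma z 1) ->
  (forall z, normc z < d -> boundary D (Gamma z) -> Im z = 0) ->
  normc z1 < d -> 0 < sg * Im z1 -> normc z2 < d -> 0 < sg * Im z2 ->
  D (Gamma z1) -> D (Gamma z2).
Proof.
move=> dG bd n1 i1 n2 i2.
have oV : open [set z : C | normc z < d /\ 0 < sg * Im z].
  have -> : [set z : C | normc z < d /\ 0 < sg * Im z] =
     [set z : C | normc (z - 0) < d] `&` (fun z : C => sg * Im z) @^-1` [set x | 0 < x].
    by apply/seteqP; split => z /=; rewrite subr0.
  apply: openI; first exact: open_disc.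
  apply: open_comp; last exact: open_gt.
  move=> z _; apply: contrM; first exact: cst_continuous.
  by apply: contc_Im; exact: cvg_id.
have cG z : normc z < d -> {for z, continuous Gamma}.
  by move=> zd; exact: derivable_continuous_at (dG z zd).
have <- // : D (Gamma z1) = D (Gamma z2).
apply: (@segment_locally_const R Prop _ (fun z => D (Gamma z)) z1 z2 oV).
  move=> w [wd wi]; have nb : ~ boundary D (Gamma w).
    by move=> /(bd w wd) e; move: wi; rewrite e mulr0 ltxx.
  have cl : closed (closure D) by exact: closed_closure.
  have [Dw|nDw] := notin_boundary nb.
    have [e e0 he] := open_normcP oD Dw.
    have /continuous_normcP/(_ e e0)[e' e'0 he'] := cG w wd.
    exists e'; first exact: e'0.
    by move=> w' /he'/he Dw'; apply/propext; split => _; [exact: Dw|exact: Dw'].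
  have [e e0 he] := open_normcP (closed_openC cl) nDw.
  have /continuous_normcP/(_ e e0)[e' e'0 he'] := cG w wd.
  exists e'; first exact: e'0.
  move=> w' /he'/he nDw'; apply/propext; split => Dw'.
    by exfalso; apply: nDw'; exact: subset_closure.
  by exfalso; apply: nDw; exact: subset_closure.
by move=> t ht; exact: segment_in_half_disc.
Qed.

(** Close to the point, the boundary consists of the arc only, by [boundary_near]; since [Gamma] is
    injective, a preimage of a point of the arc is its real parameter. *)
Lemma complexified_boundary i t0 (Gamma : C -> C) (c : C) (d : R) : 0 < d -> c != 0 ->
  (forall z, normc z < d -> derivable Gamma z 1) ->
  (forall u v, normc u < d -> normc v < d ->
    normc (Gamma u - Gamma v - c * (u - v)) <= normc c / 16 * normc (u - v)) ->
  (forall t : R, `|t| < d -> Gamma t%:C = gammas i (t0 + t)) ->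
  exists2 d' : R, 0 < d' <= d &
    forall z, normc z < d' -> boundary D (Gamma z) <-> Im z = 0.
Proof.
move=> d0 c0 dG strict GE.
have nc0 : 0 < normc c by rewrite normc_gt0.
pose d1 := Num.min d (1 / 4).
have d10 : 0 < d1 by rewrite lt_min d0 divr_gt0.
have [d1d d14] : d1 <= d /\ d1 <= 1 / 4 by rewrite !ge_min !lexx orbT.
have [rho rho0 [near1 _]] := boundary_near i t0 d10 d14.
(* On this disc [Gamma] moves by at most [17 / 16] times the modulus of [c * z], hence by less than
   [rho]. *)
pose d' := Num.min d (rho / (2 * normc c)).
have [d'd d'rho] : d' <= d /\ d' <= rho / (2 * normc c) by split; rewrite ge_min lexx ?orbT.
have d'0 : 0 < d' by rewrite lt_min d0 divr_gt0// mulr_gt0.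
have zd0 : normc (0 : C) < d by rewrite normc0.
have G0 : Gamma 0 = gammas i t0 by have := GE 0; rewrite normr0 addr0 => ->.
have Gnear z : normc z < d' -> normc (Gamma z - gammas i t0) < rho.
  move=> zd; have := strict _ _ (lt_le_trans zd d'd) zd0; rewrite subr0 G0.
  have := le_normcD (Gamma z - gammas i t0 - c * z) (c * z); rewrite subrK normcM => h1 h2.
  have : normc z < rho / (2 * normc c) by exact: lt_le_trans d'rho.
  rewrite ltr_pdivlMr ?mulr_gt0//; have := normc_ge0 z; move: h1 h2 nc0 rho0.
  move: (normc z) (normc c) => x y; clear; nra.
exists d'; first by rewrite d'0.
move=> z zd'; have zd := lt_le_trans zd' d'd; split=> [bz|z0].
  have [t td e] := near1 _ bz (Gnear z zd').
  have td2 : `|t| < d := lt_le_trans td d1d.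
  have -> // : z = t%:C.
  apply: (strict_inj c0 strict zd); first by rewrite normc_real.
  by rewrite e GE.
have -> : z = (Re z)%:C by rewrite -[LHS]complex_eta z0.
rewrite (GE _ (le_lt_trans (Re_le_normc z) zd)) bdE.
by exists i => //; exists (t0 + Re z).
Qed.

Lemma complexified_one_sided i t0 (Gamma : C -> C) (c : C) (d : R) : 0 < d -> d <= 1 / 4 -> c != 0 ->
  (forall z, normc z < d -> derivable Gamma z 1) ->
  (forall u v, normc u < d -> normc v < d ->
    normc (Gamma u - Gamma v - c * (u - v)) <= normc c / 16 * normc (u - v)) ->
  (forall t : R, `|t| < d -> Gamma t%:C = gammas i (t0 + t)) ->
  ~ forall e, 0 < e -> e < d -> D (Gamma ('i%C * e%:C)) /\ D (Gamma (- ('i%C * e%:C))).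
Proof.
move=> d0 d14 c0 dG strict GE; have [[_ _ _ per _] _ _] := curves i.
have pgam : gammas i (t0 + 1 / 2) = gammas i (t0 + - (1 / 2)).
  by rewrite -(per (t0 + - (1 / 2))); congr (gammas i _); field.
have avoid t : ~ D (gammas i (t0 + t)).
  by apply: boundary_notin; rewrite bdE; exists i => //; exists (t0 + t).
have d2 : 0 < d / 2 by rewrite divr_gt0.
have d24 : d / 2 <= 1 / 4 by lra.
have [rho rho0 [_ far]] := boundary_near i t0 d2 d24.
have d12 : d <= 1 / 2 by lra.
have G0 : Gamma 0 = gammas i t0 by have := GE 0; rewrite normr0 addr0 => ->.
have far0 t : - (1 / 2) <= t <= 1 / 2 -> d / 2 <= `|t| -> rho <= normc (gammas i (t0 + t) - Gamma 0).
  by move=> ht td; rewrite G0; exact: far.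
have two := not_two_sided oD cD (shift_cderiv i t0) (@shift_velocity_cont i t0) pgam avoid.
exact: (two _ _ _ _ dG c0 d0 strict GE rho0 far0 d12).
Qed.

(** Each open half disc is entirely inside or outside of [D]; at least one is inside by the
    existence hypothesis, and not both by one-sidedness. *)
Lemma half_disc_in_domain (Gamma : C -> C) (d : R) :
  (forall z, normc z < d -> derivable Gamma z 1) ->
  (forall z, normc z < d -> boundary D (Gamma z) -> Im z = 0) ->
  (forall z, normc z < d -> Im z = 0 -> boundary D (Gamma z)) ->
  (exists2 z, normc z < d & D (Gamma z)) ->
  (~ forall e, 0 < e -> e < d -> D (Gamma ('i%C * e%:C)) /\ D (Gamma (- ('i%C * e%:C)))) ->
  exists sg : R, (sg = 1 \/ sg = -1) /\
    forall z, normc z < d -> D (Gamma z) <-> 0 < sg * Im z.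
Proof.
move=> dG bd bd' [z zd Dz] two.
have ImN0 w : normc w < d -> D (Gamma w) -> Im w != 0.
  by move=> wd Dw; apply/eqP => e; exact: boundary_notin (bd' w wd e) Dw.
have side sg z1 z2 := @half_disc_side Gamma d sg z1 z2 dG bd.
have Imz := ImN0 z zd Dz.
exists (Num.sg (Im z)); split.
  by case: sgrP Imz => //; [left|right].
have szp : 0 < Num.sg (Im z) * Im z by rewrite -normrEsg normr_gt0.
move=> w wd; split => [Dw|sw]; last exact: (side _ _ _ zd) szp wd sw Dz.
have Imw := ImN0 w wd Dw.
rewrite ltNge le_eqVlt mulf_eq0 sgr_eq0 (negbTE Imz) (negbTE Imw) /=; apply/negP => sw.
have sw' : 0 < - Num.sg (Im z) * Im w by rewrite mulNr oppr_gt0.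
apply: two => e e0 ed.
have n1 : normc ('i%C * e%:C : C) < d by rewrite normcM normc_i mul1r normc_real gtr0_norm.
have n2 : normc (- ('i%C * e%:C : C)) < d by rewrite normcN.
have im1 : Im ('i%C * e%:C : C) = e by rewrite /= mul0r add0r mul1r.
have im2 : Im (- ('i%C * e%:C : C)) = - e by rewrite ImN im1.
have pos (u : C) : Im u != 0 -> normc u < d -> D (Gamma u).
  move=> u0 ud; have [h|h] := ltP 0 (Num.sg (Im z) * Im u); first exact: (side _ _ _ zd) szp ud h Dz.
  apply: (side _ _ _ wd sw' ud _ Dw); rewrite mulNr oppr_gt0 lt_neqAle h andbT.
  by rewrite mulf_neq0// sgr_eq0.
by split; apply: pos => //; rewrite ?im1 ?im2 ?oppr_eq0 gt_eqF.
Qed.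

Theorem boundary_straightening (s0 : C) : boundary D s0 -> exists U psi, straightens D U psi /\ U s0.
Proof.
move=> bs0; have [cl0 _] := bs0; have : boundary D s0 by [].
rewrite bdE => -[i _ [t0 _ es0]].
have [Gamma [c [d0 d00 [c0 dG0 strict0 GE0]]]] := curve_complexification i t0.
have [d1 /andP[d10 d1d0] bd1] := complexified_boundary d00 c0 dG0 strict0 GE0.
pose d := Num.min d1 (1 / 4).
have dpos : 0 < d by rewrite lt_min d10 divr_gt0.
have [dd1 d14] : d <= d1 /\ d <= 1 / 4 by rewrite !ge_min !lexx orbT.
have bd z : normc z < d -> boundary D (Gamma z) <-> Im z = 0.
  by move=> zd; apply: bd1; exact: lt_le_trans dd1.
have dd0 := le_trans dd1 d1d0.
have dG z : normc z < d -> derivable Gamma z 1.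
  by move=> zd; apply: dG0; exact: lt_le_trans dd0.
have strict u v : normc u < d -> normc v < d ->
    normc (Gamma u - Gamma v - c * (u - v)) <= normc c / 16 * normc (u - v).
  by move=> ud vd; apply: strict0; [exact: lt_le_trans ud dd0|exact: lt_le_trans vd dd0].
have GE t : `|t| < d -> Gamma t%:C = gammas i (t0 + t).
  by move=> td; apply: GE0; exact: lt_le_trans td dd0.
have two := complexified_one_sided dpos d14 c0 dG strict GE.
have oU := image_disc_open dG c0 strict (lexx d).
have Us0 : image_disc Gamma d s0.
  have z0d : normc (0 : C) < d by rewrite normc0.
  exists 0; first exact: z0d.
  by have := GE 0; rewrite normr0 addr0 => ->.
have exD : exists2 z, normc z < d & D (Gamma z).
  have [w [Dw [z /= zd ew]]] := cl0 _ (open_nbhs_nbhs (conj oU Us0)).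
  by exists z => //; rewrite ew.
have [sg [sg1 sgE]] := half_disc_in_domain dG (fun z zd => (bd z zd).1) (fun z zd => (bd z zd).2) exD two.
(* If the domain lies below the real axis, the sign turns the chart by a half turn, which remains
   holomorphic and preserves the axis. *)
pose psi v : C := sg%:C * local_inverse Gamma d v.
have sg0 : sg%:C != 0 :> C.
  by rewrite -normc_gt0 normc_real; case: sg1 => ->; rewrite ?normrN normr1.
have psiK z : normc z < d -> psi (Gamma z) = sg%:C * z.
  by move=> zd; rewrite /psi (local_inverseK c0 strict).
have ImsgM (z : C) : Im (sg%:C * z) = sg * Im z by rewrite ImM /= mul0r addr0.
exists (image_disc Gamma d), psi; split; last exact: Us0.
split; first exact: oU.
- move=> v Uv.
  have h := local_inverse_holomorphic dG c0 strict (lexx d) Uv.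
  exact: is_derive_derivable (is_derivecM (is_derivec_cst v sg%:C) (derivable_is_derive h)).
- move=> _ _ [z /= zd <-] [w /= wd <-]; rewrite (psiK z zd) (psiK w wd) => /(mulfI sg0) ->; exact: erefl.
- by move=> _ [z /= zd <-]; rewrite (psiK z zd) ImsgM; exact: sgE.
- move=> _ [z /= zd <-]; rewrite (psiK z zd) ImsgM; split => [bz|/eqP].
    by rewrite ((bd z zd).1 bz) mulr0.
  rewrite mulf_eq0 => /orP[/eqP s0'|/eqP e]; last exact/(bd z zd).
  exfalso; case: sg1; rewrite s0' => /eqP; last by rewrite eq_sym oppr_eq0 oner_eq0.
  by rewrite eq_sym oner_eq0.
Qed.

End Straightening.

(** * The function on the second sheet of the double *)

Section Double.
Variable R : realType.
Local Notation C := (cplane R).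
Implicit Types (z w s a b : C).

(** The value [0] at infinity is a default: poles are only approached through punctured
    neighbourhoods. *)
Definition finite_part (x : sphere R) : C := if x is Some v then v else 0.

Lemma derivable_conj_comp (f chi : C -> C) s : derivable chi s 1 ->
  derivable f (chi s)^*%C 1 -> derivable (fun s => (f (chi s)^*%C)^*%C : C) s 1.
Proof.
move=> dchi df.
have h1 := is_derive_conj (derivable_is_derive df); rewrite conjcK in h1.
exact: is_derive_derivable (is_derivec_comp (derivable_is_derive dchi) h1).
Qed.

Lemma derivable_near (f g : C -> C) s : (\forall w \near s, f w = g w) ->
  derivable f s 1 -> derivable g s 1.
Proof. by move=> fg df; exact: is_derive_derivable (is_derive_near fg (derivable_is_derive df)). Qed.

Lemma nbhs_conj (Q : set C) z : (\forall w \near ((z^*)%C : C), Q w) -> \forall w \near z, Q (w^*)%C.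
Proof.
move=> /nbhs_normcP[r r0 h]; apply/nbhs_normcP; exists r => // w wz; apply: h.
by rewrite -normc_conj rmorphB /= conjcK conjcK.
Qed.

Lemma bounded_closure_compact (A : set C) : bounded_set A -> compact (closure A).
Proof.
move=> bA; have [M M0 hM] := pinfty_ex_gt0 bA.
apply: (@subclosed_compact _ _ [set z : C | normc (z - 0) <= Re M]).
- exact: closed_closure.
- exact: compact_closed_disc.
have cl : closed [set z : C | normc (z - 0) <= Re M].
  by apply: closed_compactC; exact: compact_closed_disc.
rewrite [X in _ `<=` X](closure_id _).1//; apply: closureS => z Az /=.
by rewrite subr0; have /= := hM z Az; rewrite normcEC lecE => /andP[].
Qed.

Variables (D : set C) (G : C -> C) (F : double_pt R -> sphere R).
Hypothesis bD : bounded_domain D.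
Hypothesis curves : bounded_by_curves (@analytic_simple_closed R) D.
Hypothesis atlasF : meromorphic_atlas (double_atlas D) F.
Hypothesis FG : forall s, D s -> F (s, false) = to_sphere (G s).
Hypothesis no_pole : forall s, boundary D s -> F (s, false) <> None.

Let oD : open D. Proof. by case: bD. Qed.

(** The chart of the second sheet is the conjugate coordinate; the outer conjugation makes the
    function meromorphic in [s] itself. *)
Definition back s : C := ((finite_part (F (s, true)))^*)%C.

(** Stated after composition with an injective [phi], because the function is wanted on [Omega]
    while the double is that of [Omega_s]. Where [F] is a reciprocal, its denominator has no other
    zero nearby, and the order of its zero at [z0] is the exponent [m]; elsewhere [m = 0]. *)
Lemma back_local (phi : C -> C) z0 r : 0 < r ->
  (forall z, normc (z - z0) < r -> derivable phi z 1 /\ D (phi z)) ->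
  (forall z, normc (z - z0) < r -> phi z = phi z0 -> z = z0) ->
  exists m (k : C -> C), exists2 r' : R, 0 < r' &
    (forall z, normc (z - z0) < r' -> derivable k z 1) /\
    (forall z, normc (z - z0) < r' -> z != z0 -> (z - z0) ^+ m * back (phi z) = k z).
Proof.
move=> r0 dphi inj; have zz0 : normc (z0 - z0) < r by rewrite subrr normc0.
have [dphi0 Dphi0] := dphi z0 zz0.
have [|f mf fF] := atlasF (k := back_chart D); first exact: Or32.
have backE z : normc (z - z0) < r -> F (phi z, true) = f (phi z)^*%C.
  by move=> /dphi[_ Dz]; exact: (fF (phi z, true)).
have cphi := derivable_continuous_at dphi0.
have mer : meromorphic_at f (phi z0)^*%C by apply: mf; exists (phi z0, true).
have pull (Q : set C) : (\forall w \near ((phi z0)^*%C : C), Q w) ->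
    exists2 r' : R, 0 < r' <= r & forall z, normc (z - z0) < r' -> Q (phi z)^*%C.
  move=> /nbhs_conj/nbhs_normcP[e e0 he].
  have /continuous_normcP/(_ e e0)[d d0 hd] := cphi.
  exists (Num.min d r); first by rewrite lt_min d0 r0 ge_min lexx orbT.
  by move=> z; rewrite lt_min => /andP[zd _]; apply: he; exact: hd.
case: mer => [[g hg]|[g [hg ng]]].
  have [r' /andP[r'0 r'r] hr'] := pull _ hg.
  exists 0%N, (fun z => (g (phi z)^*%C)^*%C); exists r'; first exact: r'0.
  split => z zr.
    have [dg _] := hr' z zr; apply: derivable_conj_comp dg.
    by have [] := dphi z (lt_le_trans zr r'r).
  move=> _; rewrite expr0 mul1r /back backE; last exact: lt_le_trans zr r'r.
  by have [_ ->] := hr' z zr.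
have [r1 /andP[r10 r1r] hr1] := pull _ hg.
have [r2 /andP[r20 r2r] hr2] := pull _ ng.
pose r' := Num.min r1 r2; have r'0 : 0 < r' by rewrite lt_min r10.
have r'le z : normc (z - z0) < r' -> [/\ normc (z - z0) < r1, normc (z - z0) < r2 & normc (z - z0) < r].
  by rewrite lt_min => /andP[h1 h2]; split => //; exact: lt_le_trans h1 r1r.
pose q z : C := (g (phi z)^*%C)^*%C.
have dq z : normc (z - z0) < r' -> derivable q z 1.
  move=> /r'le[h1 _ h]; have [dg _] := hr1 z h1; apply: derivable_conj_comp dg.
  by have [] := dphi z h.
have q0 z : normc (z - z0) < r' -> z != z0 -> q z != 0.
  move=> /r'le[h1 h2 h] zz; rewrite /q conjc_eq0; apply: hr2 => //.
  by apply: contra zz => /eqP/(inv_inj (@conjcK R)) e; apply/eqP; exact: inj.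
have [m [k [k0 dk qE]]] := zero_of_finite_order r'0 dq q0.
have r'2 : 0 < r' / 2 by rewrite divr_gt0.
have kn z : normc (z - z0) < r' / 2 -> k z != 0.
  move=> zr; have [->//|zz] := eqVneq z z0.
  have zr' : normc (z - z0) < r' by lra.
  by have := q0 z zr' zz; rewrite (qE z zr) mulf_eq0 negb_or => /andP[].
exists m, (fun z => (k z)^-1); exists (r' / 2); first exact: r'2.
split => z zr.
  exact: is_derive_derivable (is_derivecV (kn z zr) (derivable_is_derive (dk z zr))).
move=> zz; have zr' : normc (z - z0) < r' by lra.
have [h1 _ h] := r'le z zr'; rewrite /back backE//.
have [_ ->] := hr1 z h1; rewrite /sphere_inv.
have qz := q0 z zr' zz; have gz : g (phi z)^*%C != 0 by rewrite -conjc_eq0.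
rewrite (negbTE gz) /= fmorphV /= -/(q z) (qE z zr) invfM mulrA divff ?mul1r//.
by rewrite expf_neq0// subr_eq0.
Qed.

(** In a border chart [chi] one function [g] describes both sheets: [G s] is [g (chi s)], and
    [back s] is the conjugate of [g] at the conjugate of [chi s]. At a boundary point [chi] is real,
    so the limits are conjugate to each other. *)
Lemma back_boundary b : boundary D b -> exists a : C, forall e : R, 0 < e ->
  exists2 d : R, 0 < d & forall s, D s -> normc (s - b) < d ->
    [/\ derivable back s 1, normc (G s - a) < e & normc (back s - (a^*)%C) < e].
Proof.
move=> bb; have [n [gammas [cg dj bE]]] := curves.
have [U [chi [st Ub]]] := boundary_straightening bD cg dj bE bb.
have [oU hchi _ _ bchi] := st.
have [|f mf fF] := atlasF (k := border_chart D U chi).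
  by apply: Or33; exists U, chi.
pose x0 := chi b; have x0r : Im x0 = 0 by apply/(bchi b Ub).
have x0J : (x0^*)%C = x0 by rewrite -[x0]complex_eta x0r /= oppr0.
have pb : chart_dom (border_chart D U chi) (b, false) by split => //; right.
have mer : meromorphic_at f x0 by apply: mf; exists (b, false).
have Fb : F (b, false) = f x0 by exact: (fF _ pb).
have [g hg] : exists g : C -> C, \forall w \near x0, derivable g w 1 /\ f w = to_sphere (g w).
  case: mer => [//|[g [hg _]]].
  have [dg fg] := nbhs_singleton hg.
  have g0 : g x0 != 0.
    (* A zero of the denominator would be a pole on the boundary; as there is none, the reciprocal
       is itself a finite holomorphic function near [x0]. *)
    by apply/eqP => e; apply: (no_pole bb); rewrite Fb fg /sphere_inv e eqxx.
  have ng : \forall w \near x0, g w != 0.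
    have ng0 : 0 < normc (g x0) by rewrite normc_gt0.
    have /continuous_normcP/(_ _ ng0)[r r0 hr] := derivable_continuous_at dg.
    apply/nbhs_normcP; exists r => // w /hr; apply: contraTneq => ->.
    by rewrite sub0r normcN ltxx.
  exists (fun w => (g w)^-1); near=> w.
  have gw : g w != 0 by near: w.
  have [dgw fw] : derivable g w 1 /\ f w = sphere_inv (g w) by near: w.
  split; last by rewrite fw /sphere_inv (negbTE gw).
  exact: is_derive_derivable (is_derivecV gw (derivable_is_derive dgw)).
have /nbhs_normcP[e1 e10 he1] := hg.
exists (g x0) => e e0.
have [dg0 _] := nbhs_singleton hg.
have /continuous_normcP/(_ e e0)[e2 e20 he2] := derivable_continuous_at dg0.
pose e3 := Num.min e1 e2; have e30 : 0 < e3 by rewrite lt_min e10.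
have /continuous_normcP/(_ _ e30)[d1 d10 hd1] := holomorphic_continuous hchi Ub.
have [d2 d20 hd2] := open_normcP oU Ub.
exists (Num.min d1 d2); first by rewrite lt_min d10.
have near_s s : normc (s - b) < Num.min d1 d2 -> [/\ U s, normc (chi s - x0) < e1 & normc (chi s - x0) < e2].
  rewrite lt_min => /andP[/hd1 h1 /hd2 h2]; move: h1; rewrite -/x0 lt_min => /andP[h3 h4].
  by split.
have conj_x0 s : normc ((chi s)^*%C - x0) = normc (chi s - x0).
  by rewrite -{1}x0J -rmorphB /= normc_conj.
have backE s : D s -> normc (s - b) < Num.min d1 d2 -> back s = (g (chi s)^*%C)^*%C.
  move=> Ds /near_s[Us h1 _].
  have ps : chart_dom (border_chart D U chi) (s, true) by split => //; left.
  have := fF _ ps; rewrite /back /= => ->.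
  by have [_ ->] := he1 (chi s)^*%C (eq_ind_r (fun x => x < e1) h1 (conj_x0 s)).
move=> s Ds sb; have [Us h1 h2] := near_s s sb; split.
- have h3 : normc ((chi s)^*%C - x0) < e1 by rewrite conj_x0.
  have [dg _] := he1 _ h3.
  apply: derivable_near (derivable_conj_comp (hchi s Us) dg).
  have nD : nbhs s D by exact: open_nbhs_nbhs.
  have nb := near_disc sb.
  by near=> w; apply/esym; apply: backE; near: w.
- have ps : chart_dom (border_chart D U chi) (s, false) by split => //; left.
  have := fF _ ps; rewrite FG//=; have [_ ->] := he1 _ h1.
  by case=> ->; exact: he2.
- by rewrite backE// -rmorphB /= normc_conj; apply: he2; rewrite conj_x0.
Unshelve. all: by end_near.
Qed.

End Double.

(** * Finiteness of the poles and compact exhaustion *)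

Section FinitePoles.
Variable R : realType.
Local Notation C := (cplane R).
Implicit Types (z w : C) (r : R).

Lemma finite_radius n (Q : 'I_n -> R -> Prop) : (forall i, exists2 r : R, 0 < r & Q i r) ->
  (forall i r r', 0 < r' -> r' <= r -> Q i r -> Q i r') -> exists2 r : R, 0 < r & forall i, Q i r.
Proof.
elim: n Q => [|n IH] Q exQ mono; first by exists 1 => // -[].
have [r1 r10 h1] := exQ ord0.
have [r2 r20 h2] := IH (fun i => Q (lift ord0 i)) (fun i => exQ _) (fun i => @mono _).
have r0 : 0 < Num.min r1 r2 by rewrite lt_min r10.
exists (Num.min r1 r2) => // i; case: (unliftP ord0 i) => [j|] ->.
  by apply: mono (h2 j); rewrite // ge_min lexx orbT.
by apply: mono h1; rewrite // ge_min lexx.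
Qed.

(** It supplies the poles and the common radius that [representation] assumes: singularities of [H]
    are isolated and lie in a compact set, so they are finitely many. *)
Theorem bergman_pairing (Omega : set C) (h H : C -> C) : open Omega -> holomorphic_on Omega h ->
  (forall z0, Omega z0 -> exists m (k : C -> C), exists2 r : R, 0 < r &
    (forall z, normc (z - z0) < r -> derivable k z 1) /\
    (forall z, normc (z - z0) < r -> z != z0 -> (z - z0) ^+ m * H z = k z)) ->
  (forall e : R, 0 < e -> exists K : set C, [/\ compact K, K `<=` Omega &
    forall z, Omega z -> ~ K z -> derivable H z 1 /\ normc ((h z)^*%C - H z) < e]) ->
  bergman_space Omega (cder h) /\
  exists n (p : 'I_n -> C) (m : 'I_n -> nat) (c : 'I_n -> nat -> C),
    (forall i, Omega (p i)) /\
    forall f, bergman_space Omega f ->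
      area_integral Omega (fun z => f z * (cder h z)^*%C) =
      \sum_i \sum_(j < m i) c i j * iter j (@cder R) f (p i).
Proof.
move=> oO hh loc bnd; have [K1 [cK1 K1O hK1]] := bnd 1 ltr01.
(* Off its centre, a disc where [(z - z0) ^+ m * H] is holomorphic contains no singularity of [H].
   Points outside [Omega] get a dummy radius, so that choice applies. *)
have iso z0 : exists r : R, Omega z0 -> 0 < r /\
    forall z, normc (z - z0) < r -> z != z0 -> derivable H z 1.
  have [Oz|nO] := pselect (Omega z0); last by exists 0.
  have [m [k [r r0 [dk Hk]]]] := loc z0 Oz; exists r => _; split => // z zr zz.
  have zz0 : z - z0 != 0 by rewrite subr_eq0.
  have d1 := is_derivecB (is_derivec_id z) (is_derivec_cst z z0).
  have dX : derivable (fun w : C => (w - z0) ^+ m) z 1.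
    elim: m {Hk} => [|m IH]; first exact: is_derive_derivable (is_derivec_cst _ _).
    have -> : (fun w : C => (w - z0) ^+ m.+1) = fun w => (w - z0) * (w - z0) ^+ m.
      by apply/funext => w; rewrite exprS.
    exact: is_derive_derivable (is_derivecM d1 (derivable_is_derive IH)).
  have X0 : (z - z0) ^+ m != 0 by rewrite expf_neq0.
  have dq := is_derivecM (is_derivecV (f := fun w : C => (w - z0) ^+ m) X0 (derivable_is_derive dX))
    (derivable_is_derive (dk z zr)).
  apply: derivable_near (is_derive_derivable dq).
  have n1 := near_disc zr.
  have n2 : \forall w \near z, w != z0.
    have zp0 : 0 < normc (z - z0) by rewrite normc_gt0.
    apply/nbhs_normcP; exists (normc (z - z0)) => // w; apply: contraTneq => ->.
    by rewrite -leNgt normcB.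
  near=> w; have wz : w != z0 by near: w.
  rewrite -Hk//; last by near: w.
  have X1 : (w - z0) ^+ m != 0 by rewrite expf_neq0// subr_eq0.
  by rewrite (mulKf X1).
have /choice[rad hrad] := iso.
have : cover_compact K1 by rewrite -compact_cover.
move=> /(_ C K1 (fun z0 => [set z : C | normc (z - z0) < rad z0])).
case=> [z _|z Kz|D' D'K1 cov]; first exact: open_disc.
  by exists z => //=; rewrite subrr normc0; have [] := hrad z (K1O z Kz).
pose bad z := `[< Omega z /\ ~ derivable H z 1 >].
(* A singularity lies in [K1], hence in one of the finitely many discs of the cover, and can only be
   its centre. So this list of centres contains them all. *)
pose s := [seq z <- (finmap.enum_fset D') | bad z].
have us : uniq s by rewrite filter_uniq// finmap.fset_uniq.
have sbad z : z \in s -> Omega z by rewrite mem_filter => /andP[/asboolP[]].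
pose p (i : 'I_(size s)) : C := s`_i.
have pO i : Omega (p i) by apply: sbad; rewrite mem_nth.
have hH : holomorphic_on (punctured Omega p) H.
  move=> z [Oz nz]; apply: contrapT => nd.
  have Kz : K1 z by apply: contrapT => nK; have [] := hK1 z Oz nK.
  have [z' /= z'D zz'] := cov z Kz.
  have K1z' : K1 z' by have := D'K1 z' z'D; rewrite inE.
  have ezz : z = z'.
    apply/eqP; apply: contrapT => /negP ne; apply: nd.
    by have [_ hd] := hrad z' (K1O _ K1z'); exact: hd.
  have zs : z \in s by rewrite mem_filter /bad asboolT//= ezz.
  have := nz (Ordinal (etrans (index_mem z s) zs)).
  by rewrite /p /= nth_index// eqxx.
have /choice[m hm] : forall i, exists m : nat, exists (k : C -> C), exists2 r : R, 0 < r &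
    (forall z, normc (z - p i) < r -> derivable k z 1) /\
    (forall z, normc (z - p i) < r -> z != p i -> (z - p i) ^+ m * H z = k z).
  by move=> i; exact: loc.
have /choice[k hk] := hm.
have [r r0 hr] : exists2 r : R, 0 < r & forall i,
   [/\ forall z, normc (z - p i) < 4 * r -> Omega z,
     forall j, i != j -> 4 * r <= normc (p i - p j),
     forall z, normc (z - p i) < 2 * r -> derivable (k i) z 1 &
     forall z, normc (z - p i) < 2 * r -> z != p i -> (z - p i) ^+ m i * H z = k i z].
  apply: finite_radius => [i|i r r' r'0 r'r [h1 h2 h3 h4]]; last first.
    split=> [z hz|j ij|z hz|z hz].
    - by apply: h1; move: hz r'r; clear; lra.
    - by have := h2 j ij; move: r'r; clear; lra.
    - by apply: h3; move: hz r'r; clear; lra.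
    - by apply: h4; move: hz r'r; clear; lra.
  have [ra ra0 ha] := open_normcP oO (pO i).
  have [rb rb0 [hb1 hb2]] := hk i.
  have [rc rc0 hc] : exists2 r : R, 0 < r & forall j, i != j -> 4 * r <= normc (p i - p j).
    apply: finite_radius => [j|j r r' r'0 r'r hj ij]; last by have := hj ij; lra.
    have [->|ij] := eqVneq i j; first by exists 1.
    have pij : 0 < normc (p i - p j).
      rewrite normc_gt0 subr_eq0; apply: contra ij => /eqP e.
      have := nth_uniq 0 (ltn_ord i) (ltn_ord j) us; rewrite -/(p i) -/(p j) e eqxx.
      by move=> /esym/eqP/val_inj ->.
    by exists (normc (p i - p j) / 4); [rewrite divr_gt0|move=> _; lra].
  (* The divisors match the discs of radius [4 r] inside [Omega] and [2 r] inside the domain of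
     [k i]; [rc] already accounts for the separation. *)
  exists (Num.min (ra / 4) (Num.min (rb / 2) rc)); first by rewrite !lt_min rc0 !divr_gt0.
  set q := Num.min _ _; have [q1 q2 q3] : [/\ q <= ra / 4, q <= rb / 2 & q <= rc].
    by rewrite /q !ge_min !lexx !orbT.
  split=> [z hz|j ij|z hz|z hz].
  - by apply: ha; move: hz q1; clear; lra.
  - by have := hc j ij; move: q3; clear; lra.
  - by apply: hb1; move: hz q2; clear; lra.
  - by apply: hb2; move: hz q2; clear; lra.
have discO i z : normc (z - p i) < 4 * r -> Omega z by have [h1 _ _ _] := hr i; exact: h1.
have sep i j : i != j -> 4 * r <= normc (p i - p j) by have [_ h1 _ _] := hr i; exact: h1.
have hk1 i z : normc (z - p i) < 2 * r -> derivable (k i) z 1 by have [_ _ h1 _] := hr i; exact: h1.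
have hk2 i z : normc (z - p i) < 2 * r -> z != p i -> (z - p i) ^+ m i * H z = k i z.
  by have [_ _ _ h1] := hr i; exact: h1.
have bd e : 0 < e -> exists K : set C, [/\ compact K, K `<=` Omega &
      forall z, Omega z -> ~ K z -> normc ((h z)^*%C - H z) < e].
  move=> /bnd[K [cK KO hK]]; exists K; split => // z Oz nK.
  by have [] := hK z Oz nK.
split; first exact: cder_bergman oO hh r0 discO sep hH bd.
have [c hc] := representation oO hh r0 discO sep hk1 hk2 hH bd.
by exists (size s), p, m, c.
Unshelve. all: by end_near.
Qed.

(** The points near which [P] holds on [D] form an open set [N] containing the boundary, so the rest
    of the closure is compact and inside [D]. Pointwise limits at the boundary thus become
    statements off a compact set. *)
Lemma compact_off_boundary (D : set C) (P : C -> Prop) : bounded_domain D ->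
  (forall b, boundary D b -> exists2 d : R, 0 < d & forall s, D s -> normc (s - b) < d -> P s) ->
  exists K : set C, [/\ compact K, K `<=` D & forall s, D s -> ~ K s -> P s].
Proof.
move=> [oD cD _ bD] hP.
pose N := [set w : C | exists2 d : R, 0 < d & forall s, D s -> normc (s - w) < d -> P s].
have oN : open N.
  apply: normcP_open => w [d d0 hd]; exists (d / 2); first by rewrite divr_gt0.
  move=> w' ww; exists (d / 2); first by rewrite divr_gt0.
  by move=> s Ds sw; apply: hd => //; have := normc_triangle s w w'; lra.
exists (closure D `&` ~` N); split.
- by apply: compact_closedI; [exact: bounded_closure_compact|exact: open_closedC].
- move=> w [cw nN]; apply: contrapT => nD; apply: nN; apply: hP; split => //.
  by move=> /interior_subset.
- move=> s Ds nK; have [d d0 hd] : N s.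
    by apply: contrapT => nN; apply: nK; split => //; exact: subset_closure.
  by apply: hd => //; rewrite subrr normc0.
Qed.

End FinitePoles.

(** * Derivatives of the Bergman kernel and its combinations *)

Section BergmanKernel.
Variable R : realType.
Local Notation C := (cplane R).
Implicit Types (z w u : C).

(** Valid for any [f]: negation exchanges the positive and negative parts, and infinite values are
    sent to [0] on both sides. *)
Lemma RintegralN d (T : measurableType d) (mu : {measure set T -> \bar R}) (A : set T) (f : T -> R) :
  Rintegral mu A (fun x => - f x) = - Rintegral mu A f.
Proof.
rewrite /Rintegral (integralE _ _ (EFin \o f)) (integralE _ _ (EFin \o (fun x => - f x))).
have -> : EFin \o (fun x => - f x) = (\- (EFin \o f))%E by [].
rewrite funeposN funenegN.
have h1 : (0 <= \int[mu]_(x in A) ((EFin \o f)^\+ x))%E by exact: integral_ge0.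
have h2 : (0 <= \int[mu]_(x in A) ((EFin \o f)^\- x))%E by exact: integral_ge0.
move: h1 h2; case: (integral _ _ _) => [a||//]; case: (integral _ _ _) => [b||//] /= _ _;
  by rewrite ?oppr0 ?opprB.
Qed.

Lemma area_integral_conj (A : set C) (f : C -> C) :
  area_integral A (fun z => (f z)^*%C) = (area_integral A f)^*%C.
Proof.
have ImJ w : Im (w^*)%C = - Im w by case: w.
have ReJ w : Re (w^*)%C = Re w by case: w.
rewrite /area_integral /= -RintegralN; congr (_ +i* _); apply: eq_Rintegral => q _.
  by rewrite ReJ.
by rewrite ImJ.
Qed.

(** The derivative of [f] in the direction [v] is the conjugate of [q' * v]; for [v = 1] and
    [v = 'i] the two contributions to [dbar] coincide. *)
Lemma dbar_conj (f q : C -> C) w : (\forall u \near w, f u = (q u)^*%C) -> derivable q w 1 ->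
  dbar f w = (cder q w)^*%C.
Proof.
move=> fq dq.
have rd v : real_deriv f v w = ((cder q w) * v)^*%C.
  have l : cderiv (fun t : R => w + t%:C * v : C) 0 v.
    have := cderiv_line w v 0.
    by apply: cderiv_near; apply: filterE => t; rewrite mulrC.
  have dq0 : is_derive (w + (0 : R)%:C * v) 1 q (cder q w).
    by rewrite mul0r addr0; exact: derivable_is_derive.
  have c1 := cderiv_conj (cderiv_comp l dq0).
  have [c2 c3] : cderiv (fun t : R => f (w + t%:C * v)) 0 ((cder q w) * v)^*%C.
    apply: cderiv_near c1.
    have := cderiv_continuous l; rewrite /prop_for /continuous_at mul0r addr0 => cl.
    have fq0 : \forall t \near (0 : R), f (w + t%:C * v) = (q (w + t%:C * v))^*%C := cl _ fq.
    by apply: filterS fq0 => t ->.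
  by rewrite /real_deriv !derive1E (@derive_val _ _ _ _ _ _ _ c2) (@derive_val _ _ _ _ _ _ _ c3) complex_eta.
rewrite /dbar !rd mulr1 [cder q w * _]mulrC conjc_iM.
have i2 : 'i%C * 'i%C = -1 :> C by rewrite -expr2 sqr_i.
have -> : 'i%C * (- 'i%C * (cder q w)^*%C) = - ('i%C * 'i%C) * (cder q w)^*%C by ring.
by rewrite i2; field.
Qed.

Variables (Omega : set C) (K : C -> C -> C).
Hypotheses (oO : open Omega) (HK : bergman_kernel Omega K).

(** Apply the reproducing property at [z] to [K(., w)] and at [w] to [K(., z)]: the two integrands
    are conjugate to each other. *)
Lemma kernel_hermitian z w : Omega z -> Omega w -> K z w = (K w z)^*%C.
Proof.
move=> Oz Ow; have [Az rz] := HK Oz; have [Aw rw] := HK Ow.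
rewrite (rz _ Aw) (rw _ Az) -area_integral_conj; apply: eq_area_integral => u _.
by rewrite rmorphM /= conjcK mulrC.
Qed.

(** Hermitian symmetry moves the conjugate derivatives in the second variable to ordinary
    derivatives of the holomorphic function [K(., z)]. *)
Lemma bergman_derivE m z w : Omega z -> Omega w ->
  bergman_deriv K m z w = (iter m (@cder R) (fun u => K u z) w)^*%C.
Proof.
move=> Oz; have [[hK _] _] := HK Oz.
have hm j : holomorphic_on Omega (iter j (@cder R) (fun u => K u z)).
  by elim: j => [//|j IH]; exact: holomorphic_cder.
rewrite /bergman_deriv; elim: m w => [|m IH] w Ow /=; first exact: kernel_hermitian.
apply: dbar_conj; last exact: hm.
have nO : nbhs w Omega by exact: open_nbhs_nbhs.
by apply: filterS nO => u; exact: IH.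
Qed.

(** The value [h z] is the conjugate of the pairing of [K(., z)] with [h], to which the formula for
    the pairing applies. *)
Lemma combination_of_pairing h n (p : 'I_n -> C) (m : 'I_n -> nat) (c : 'I_n -> nat -> C) :
  bergman_space Omega h -> (forall i, Omega (p i)) ->
  (forall f, bergman_space Omega f ->
    area_integral Omega (fun z => f z * (h z)^*%C) =
    \sum_i \sum_(j < m i) c i j * iter j (@cder R) f (p i)) ->
  bergman_combination Omega K h.
Proof.
(* A Bergman combination sums over orders up to and including [m i], the pairing only below [m i];
   the extra coefficient is [0], which also covers [m i = 0]. *)
move=> Ah pO hc; exists n, p, m, (fun i j => if (j < m i)%N then (c i j)^*%C else 0).
split => // z Oz; have [Az rz] := HK Oz.
have -> : h z = (area_integral Omega (fun u => K u z * (h u)^*%C))^*%C.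
  rewrite (rz _ Ah) -area_integral_conj; apply: eq_area_integral => u _.
  by rewrite rmorphM /= conjcK mulrC.
rewrite (hc _ Az) rmorph_sum; apply: eq_bigr => i _.
rewrite big_ord_recr /= ltnn mul0r addr0 rmorph_sum; apply: eq_bigr => j _.
by rewrite ltn_ord rmorphM /= bergman_derivE.
Qed.

End BergmanKernel.

(** * From a Gustafsson mapping to its conjugate boundary function *)

Section Gustafsson.
Variable R : realType.
Local Notation C := (cplane R).
Implicit Types (z w : C).

(** [H] is the second sheet function pulled back by [phi]. The estimates for [g] and for [g^2 / 2]
    are found together, since the second needs [g] and [H] bounded near the boundary, as their
    limits there are finite. *)
Lemma gustafsson_boundary (Omega : set C) (g : C -> C) : open Omega -> gustafsson_mapping Omega g ->
  exists H : C -> C,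
  (forall z0, Omega z0 -> exists m (k : C -> C), exists2 r : R, 0 < r &
    (forall z, normc (z - z0) < r -> derivable k z 1) /\
    (forall z, normc (z - z0) < r -> z != z0 -> (z - z0) ^+ m * H z = k z)) /\
  (forall e : R, 0 < e -> exists K : set C, [/\ compact K, K `<=` Omega &
    forall z, Omega z -> ~ K z -> [/\ derivable H z 1, normc ((g z)^*%C - H z) < e &
      normc (((g z) ^+ 2 / 2)^*%C - H z ^+ 2 / 2) < e]]).
Proof.
move=> oO [hg injg [Ds [phi [psi [F [[bDs curves [hphi hpsi phiK psiK] atl FG] np]]]]]].
have [oD _ _ _] := bDs.
exists (fun z => back F (phi z)); split=> [z0 Oz0|e e0].
  have [r r0 hr] := open_normcP oO Oz0.
  apply: (back_local atl r0) => [z zr|z zr ez].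
    by split; [exact/hphi/hr|have [] := phiK z (hr z zr)].
  by have [_ <-] := phiK z (hr z zr); have [_ <-] := phiK z0 Oz0; rewrite ez.
have [|Kd [cKd KdD hKd]] := @compact_off_boundary R Ds (fun s =>
    [/\ derivable (back F) s 1, normc ((g (psi s))^*%C - back F s) < e &
      normc (((g (psi s)) ^+ 2 / 2)^*%C - back F s ^+ 2 / 2) < e]) bDs.
  move=> b bb; have [a ha] := back_boundary bDs curves atl FG np bb.
  (* Write [u] and [v] for [g] and [H] at the point: [u^* - v] is below [2 * d0] and [u^* + v] at
     most [2 * (|a| + d0)]. Half of their product is then at most [2 * d0 * (|a| + 1)], which is at
     most [e / 2]. *)
  pose d0 := Num.min 1 (e / (4 * (normc a + 1))).
  have a1 : 0 < normc a + 1 by have := normc_ge0 a; lra.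
  have d00 : 0 < d0 by rewrite lt_min ltr01 divr_gt0// mulr_gt0.
  have [d01 d0e] : d0 <= 1 /\ d0 <= e / (4 * (normc a + 1)) by rewrite !ge_min !lexx orbT.
  have {}d0e : d0 * (4 * (normc a + 1)) <= e by rewrite -ler_pdivlMr// mulr_gt0.
  have [d dpos hd] := ha d0 d00; exists d => // s Ds_s sb.
  have [h1 h2 h3] := hd s Ds_s sb.
  move: h1 h2 h3; set u := g (psi s); move: (back F s) => v h1 h2 h3.
  have t1 : normc ((u^*)%C - v) < 2 * d0.
    have := normc_triangle ((u^*)%C) v (a^*)%C.
    rewrite -[((u^*)%C) - (a^*)%C]rmorphB normc_conj (normcB (a^*)%C); lra.
  split; first exact: h1.
    by have := normc_ge0 a; nra.
  have -> : ((u ^+ 2 / 2)^*)%C - v ^+ 2 / 2 = ((u^*)%C - v) * ((u^*)%C + v) / 2 :> C.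
    rewrite rmorphM fmorphV rmorphXn rmorph_nat /=; by field.
  have t2 : normc ((u^*)%C + v) <= 2 * (normc a + d0).
    have -> : (u^*)%C + v = (u - a)^*%C + (v - (a^*)%C) + ((a^*)%C + (a^*)%C) by rewrite rmorphB /=; ring.
    have := le_normcD ((u - a)^*%C + (v - (a^*)%C)) ((a^*)%C + (a^*)%C).
    have := le_normcD ((u - a)^*%C) (v - (a^*)%C); have := le_normcD ((a^*)%C) ((a^*)%C).
    rewrite !normc_conj; lra.
  have n2 : normc (2 : C) = 2 by have := normc_real (2 : R); rewrite rmorph_nat ger0_norm.
  rewrite normcM normcV n2 normcM ltr_pdivrMr//.
  have : normc ((u^*)%C - v) * normc ((u^*)%C + v) <= 2 * d0 * (2 * (normc a + d0)).
    by apply: ler_pM; rewrite ?normc_ge0// ltW.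
  by have := normc_ge0 a; nra.
(* A compact subset of [Omega_s] is carried back to one of [Omega]; this is the only way in which
   the boundary of [Omega] enters. *)
exists (psi @` Kd); split.
- apply: continuous_compact cKd; apply: continuous_in_subspaceT => s; rewrite inE => /KdD Dss.
  exact: holomorphic_continuous hpsi Dss.
- by move=> _ [s /KdD Dss <-]; have [] := psiK s Dss.
- move=> z Oz nK; have [Dz ez] := phiK z Oz.
  have nKd : ~ Kd (phi z) by move=> Kz; apply: nK; exists (phi z).
  have [h1 h2 h3] := hKd _ Dz nKd; rewrite ez in h2 h3.
  split; [|exact: h2|exact: h3].
  exact: is_derive_derivable (is_derivec_comp (holomorphic_is_derive hphi Oz) (derivable_is_derive h1)).
Qed.

Lemma cder_half_square (Omega : set C) g z : holomorphic_on Omega g -> Omega z ->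
  is_derive z 1 (fun z : C => g z ^+ 2 / 2) (g z * cder g z).
Proof.
move=> hg Oz; have dg := holomorphic_is_derive hg Oz.
have := is_derivecM (is_derivecM dg dg) (is_derivec_cst z (2^-1 : C)).
by move=> h; apply: is_derive_eq h _; rewrite mulr0 addr0; field.
Qed.

End Gustafsson.

Theorem theorem4p2 (R : realType) (Omega : set (cplane R))
    (K : cplane R -> cplane R -> cplane R) (g : cplane R -> cplane R)
    (HOmega : bounded_domain Omega)
    (HbOmega : bounded_by_curves (@smooth_simple_closed R) Omega)
    (HK : bergman_kernel Omega K)
    (Hg : gustafsson_mapping Omega g) :
  exists2 f : cplane R -> sphere R,
    bergman_representative_mapping Omega K f &
    forall z, Omega z -> f z = to_sphere (g z).
Proof.
have [oO _ [z0 Oz0] _] := HOmega; have [hg injg _] := Hg.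
have [H [loc bnd]] := gustafsson_boundary oO Hg.
have [A1 [n1 [p1 [m1 [c1 [pO1 hc1]]]]]] : bergman_space Omega (cder g) /\
    exists n (p : 'I_n -> cplane R) (m : 'I_n -> nat) (c : 'I_n -> nat -> cplane R),
    (forall i, Omega (p i)) /\
    forall f, bergman_space Omega f ->
      area_integral Omega (fun z => f z * (cder g z)^*%C) =
      \sum_i \sum_(j < m i) c i j * iter j (@cder R) f (p i).
  apply: (bergman_pairing oO hg loc) => e /bnd[K1 [cK KO hK]]; exists K1; split => // z Oz nK.
  by have [] := hK z Oz nK.
pose h z : cplane R := g z ^+ 2 / 2.
have dh z : Omega z -> is_derive z 1 h (g z * cder g z) by exact: cder_half_square.
have hh : holomorphic_on Omega h by move=> z /dh/is_derive_derivable.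
have [A2 [n2 [p2 [m2 [c2 [pO2 hc2]]]]]] : bergman_space Omega (cder h) /\
    exists n (p : 'I_n -> cplane R) (m : 'I_n -> nat) (c : 'I_n -> nat -> cplane R),
    (forall i, Omega (p i)) /\
    forall f, bergman_space Omega f ->
      area_integral Omega (fun z => f z * (cder h z)^*%C) =
      \sum_i \sum_(j < m i) c i j * iter j (@cder R) f (p i).
  (* The partner of [g^2 / 2] has the same poles as [H], with the exponent [m] doubled. *)
  apply: (@bergman_pairing R Omega h (fun z => H z ^+ 2 / 2) oO hh) => [z1 Oz1|e].
    have [m [k [r r0 [dk Hk]]]] := loc z1 Oz1.
    exists (m + m)%N, (fun z => k z ^+ 2 / 2); exists r; first exact: r0.
    split => z zr.
      have dkz : holomorphic_on [set z : cplane R | normc (z - z1) < r] k by move=> w; exact: dk.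
      exact: is_derive_derivable (cder_half_square dkz zr).
    by move=> zz; rewrite -(Hk z zr zz) exprD; field.
  move=> /bnd[K1 [cK KO hK]]; exists K1; split => // z Oz nK.
  have [dH _ h3] := hK z Oz nK; split; last exact: h3.
  have dHz : holomorphic_on [set z] H by move=> w /= ->.
  exact: is_derive_derivable (cder_half_square dHz (erefl z)).
have B1 := combination_of_pairing oO HK A1 pO1 hc1.
have B2 := combination_of_pairing oO HK A2 pO2 hc2.
exists (fun z => to_sphere (g z)) => //; split.
- move=> z Oz; left; exists g.
  have nO : nbhs z Omega by exact: open_nbhs_nbhs.
  by apply: filterS nO => w Ow; split; [exact: hg|].
- by move=> z w Oz Ow [] /injg; apply.
exists (cder h), (cder g); split => //.
  (* The denominator [g'] is not identically zero: otherwise [g] would be constant on a disc,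
     against injectivity. *)
  apply: contrapT => nex; have [r r0 hr] := open_normcP oO Oz0.
  have g0 w : normc (w - z0) < r -> is_derive w 1 g 0.
    move=> wr; have Ow := hr w wr; have := holomorphic_is_derive hg Ow.
    have [->//|ne] := eqVneq (cder g w) 0.
    by exfalso; apply: nex; exists w.
  have e : z0 + (r / 2)%:C - z0 = (r / 2)%:C by rewrite addrC addKr.
  have wr : normc (z0 + (r / 2)%:C - z0) < r.
    by rewrite e normc_real gtr0_norm; lra.
  have := injg _ _ (hr _ wr) Oz0 (const_of_derive0 g0 wr).
  move=> /(congr1 (fun x => x - z0)); rewrite e subrr => /(congr1 (@complex.Re R)) /=.
  lra.
move=> z Oz gz; congr to_sphere.
by rewrite /cder (is_derive_val (dh z Oz)) mulfK.
Qed.
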